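(* Let $1\le p<\infty$, let $\mu$ be a finite positive Borel measure on $(0,1)$, and let $\Gamma_\mu$ be the operator with matrix entries $\gamma_{n,k}=\binom{n+k}{k}\int_0^1 t^k(1-t)^n\,d\mu(t)$, $n,k\ge 0$. Let $$\psi_p(t)=\frac{t^{\frac1p-1}}{(1-t)^{\frac1p}}\ \text{ if } p>1,\qquad \psi_1(t)=\log\left(\frac{e}{t}\right)\frac{1}{1-t}\ \text{ if } p=1,\qquad 0<t<1.$$ Then $\Gamma_\mu$ is bounded on $H^p$ if and only if $$\int_0^1\psi_p(t)\,d\mu(t)<\infty.$$ Furthermore, there exist positive constants $A_p,B_p$ depending only on $p$ such that $$A_p\int_0^1\psi_p(t)\,d\mu(t)\le \|\Gamma_\mu\|_{H^p\to H^p}\le B_p\int_0^1\psi_p(t)\,d\mu(t).$$ In particular, when $2\le p<\infty$, the exact value of the norm is $$\|\Gamma_\mu\|_{H^p\to H^p}=\int_0^1\frac{t^{\frac1p-1}}{(1-t)^{\frac1p}}\,d\mu(t).$$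
   Context: $\mathbb{D}$ is the open unit disc in $\mathbb{C}$. For $0<p<\infty$, $H^p=H^p(\mathbb{D})$ is the Hardy space of analytic functions $f$ on $\mathbb{D}$ with $\|f\|_{H^p}=\sup_{0\le r<1}\left(\frac1{2\pi}\int_0^{2\pi}|f(re^{i\theta})|^p\,d\theta\right)^{1/p}<\infty$. For a polynomial $f(z)=\sum_k a_kz^k$, $\Gamma_\mu f(z)=\sum_{n=0}^\infty\left(\sum_{k}\gamma_{n,k}a_k\right)z^n$, which converges in $\mathbb{D}$. The operator $\Gamma_\mu$ is said to be bounded on $H^p$ if there is a constant $C$ with $\|\Gamma_\mu f\|_{H^p}\le C\|f\|_{H^p}$ for all polynomials $f$; since polynomials are dense in $H^p$, it then extends uniquely to a bounded linear operator on $H^p$, whose operator norm is $\|\Gamma_\mu\|_{H^p\to H^p}$ (the norm is understood as $+\infty$ when $\Gamma_\mu$ is not bounded). *)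

(* Defs.v *)
From HB Require Import structures.
From mathcomp Require Import all_boot all_order all_algebra.
From mathcomp Require Import all_classical all_reals all_analysis.
From mathcomp Require Import complex.

Set Implicit Arguments.
Unset Strict Implicit.
Unset Printing Implicit Defensive.

Import Order.TTheory GRing.Theory Num.Theory.
Import numFieldNormedType.Exports.

Local Open Scope classical_set_scope.
Local Open Scope complex_scope.
Local Open Scope ring_scope.

(* The topology on the complex numbers is the one of the regular module
   [R[i]^o], given by the modulus; [R[i]] itself carries no topology. *)

Definition unit_disc (R : realType) : set R[i] := [set z | `|z| < 1].

Definition power_series_sum (R : realType) (a : nat -> R[i]) (z : R[i]) : R[i] :=
  lim (series (fun n => a n * z ^+ n : R[i]^o) @ \oo).

(* Functions on the disc are total functions on R[i] whose values outside the
   disc are irrelevant.  Analyticity is understood in the sense of Weierstrass;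
   on a disc this means being the sum of a single power series at the centre. *)
Definition analytic_on_disc (R : realType) (f : R[i] -> R[i]) : Prop :=
  exists a : nat -> R[i], forall z, unit_disc z ->
    series (fun n => a n * z ^+ n : R[i]^o) @ \oo --> (f z : R[i]^o).

Definition circle_pt (R : realType) (r theta : R) : R[i] :=
  (r * cos theta) +i* (r * sin theta).

Definition integral_mean (R : realType) (p : R) (f : R[i] -> R[i]) (r : R) :
    \bar R :=
  ((((2 * pi)^-1)%R%:E *
    \int[lebesgue_measure]_(theta in `[0%R, (2 * pi)%R])
      (Normc.normc (f (circle_pt r theta)) `^ p)%:E) `^ p^-1)%E.

Definition hardy_norm (R : realType) (p : R) (f : R[i] -> R[i]) : \bar R :=
  ereal_sup [set integral_mean p f r | r in `[0, 1[%classic].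

Definition hardy (R : realType) (p : R) : set (R[i] -> R[i]) :=
  [set f | analytic_on_disc f /\ (hardy_norm p f < +oo)%E].

Definition gamma_entry (R : realType) (mu : {finite_measure set R -> \bar R})
    (n k : nat) : R :=
  ('C((n + k)%N, k))%:R * \int[mu]_(t in `]0, 1[) (t ^+ k * (1 - t) ^+ n).

Definition Gamma_poly (R : realType) (mu : {finite_measure set R -> \bar R})
    (q : {poly R[i]}) : R[i] -> R[i] :=
  power_series_sum (fun n => \sum_(k < size q) (gamma_entry mu n k)%:C * q`_k).

Definition Gamma_bounded (R : realType) (p : R)
    (mu : {finite_measure set R -> \bar R}) : Prop :=
  exists C : R, forall q : {poly R[i]},
    (hardy_norm p (Gamma_poly mu q) <= C%:E * hardy_norm p (horner q))%E.

(* [T] is a bounded linear operator on H^p which agrees with [Gamma_poly mu] on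
   polynomials; equality of functions is equality on the disc. *)
Definition bounded_extension (R : realType) (p : R)
    (mu : {finite_measure set R -> \bar R})
    (T : (R[i] -> R[i]) -> R[i] -> R[i]) : Prop :=
  [/\ forall f, hardy p f -> hardy p (T f),
      forall c f g, hardy p f -> hardy p g -> forall z, unit_disc z ->
        T (fun w => c * f w + g w) z = c * T f z + T g z,
      exists C : R, forall f, hardy p f ->
        (hardy_norm p (T f) <= C%:E * hardy_norm p f)%E &
      forall (q : {poly R[i]}) z, unit_disc z ->
        T (horner q) z = Gamma_poly mu q z].

Definition operator_norm (R : realType) (p : R)
    (T : (R[i] -> R[i]) -> R[i] -> R[i]) : \bar R :=
  ereal_sup [set hardy_norm p (T f) |
             f in [set f | hardy p f /\ (hardy_norm p f <= 1)%E]].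

(* By density of the polynomials in H^p there is at most one bounded extension
   (up to values outside the disc), so the infimum is the operator norm of that
   extension, and it is +oo, the infimum of the empty set, when there is none. *)
Definition Gamma_norm (R : realType) (p : R)
    (mu : {finite_measure set R -> \bar R}) : \bar R :=
  ereal_inf [set operator_norm p T | T in bounded_extension p mu].

Definition psi (R : realType) (p t : R) : R :=
  if p == 1 then ln (expR 1 / t) * (1 - t)^-1
  else t `^ (p^-1 - 1) / (1 - t) `^ p^-1.

(* Main.v *)
Require Import Defs.
From mathcomp Require Import all_boot all_order all_algebra.
From mathcomp Require Import all_classical all_reals all_analysis.
From mathcomp Require Import complex.
From mathcomp Require Import measurable_realfun.
From mathcomp Require Import ring lra.

Set Implicit Arguments.
Unset Strict Implicit.
Unset Printing Implicit Defensive.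

Import Order.TTheory GRing.Theory Num.Theory.
Import numFieldNormedType.Exports.

Local Open Scope classical_set_scope.
Local Open Scope ring_scope.

(** The operator is an average of weighted composition operators: summing the
    binomial series gives, for a polynomial [q] and [|z| < 1],
    [Gamma_poly mu q z = \int (wt t z * q (phi t z)) dmu(t)], where
    [wt t z = 1 / (1 - (1 - t) z)] and [phi t z = t * wt t z]
    ([Gamma_polyE]).  Minkowski's inequality for the integral over [t]
    ([Gamma_mean_le]) therefore reduces the upper bounds to the norm of
    [q |-> wt t * (q \o phi t)].

    The map [phi t] sends the unit circle onto a circle that touches it at [1].
    The subharmonicity of [|1 - w|^2 |q(w)|^p] ([horocycle_subharmonic]),
    integrated along this circle, gives
    [E(|wt t|^2 |q \o phi t|^p) <= E(|q|^p) / (t (1 - t))] ([mean_wt_sqr_le]),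
    with [E] the mean over the unit circle.
    Since [|wt t| <= 1 / t], for [2 <= p] the remaining factor [|wt t|^(p - 2)] is
    at most [t^(2 - p)], and the norm is at most
    [kern p t = t^(1/p - 1) / (1 - t)^(1/p)].  For [p < 2] the exponent [p - 2] is
    negative; then one writes [q = c + g X]: the factor [phi t] produced by [X]
    makes up for the missing powers of [wt t], and the constant contributes the
    norm of [wt t], which is where the logarithm in the case [p = 1] comes from
    ([mean_wcomp_le]).

    For the lower bound, the operator is tested on polynomials close to
    [f z = (1 - rho z)^(-1/p)].  The quotient of [wt t * (f \o phi t)] by [f] has a
    nonnegative real part ([Re_test_ratio_ge0]) and tends to [kern p t] when [z]
    and [rho] tend to [1] and [1 - rho] is small compared with [1 - |z|]
    ([cvg_Re_test_ratio]).  By Fatou's lemma the operator multiplies [f] by at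
    least any given number below the integral of [kern p], at all points near [1]
    of a suitable circle; as the norm of [f] on the part of the circle near [1]
    tends to infinity, the rest of the circle is negligible, and every bound for
    the operator is at least the integral of [kern p] ([kern_integral_le]).  For
    [2 <= p] this meets the upper bound.  For [p = 1] the missing logarithm is
    obtained from the image of the constant [1], whose imaginary part does not
    suffer any cancellation ([log_integral_le]).

    It remains to pass from polynomials to the Hardy space.  A bound for the
    polynomials is transferred to an extension of the operator by applying it to
    polynomial approximations of the dilations of [f] and taking the limit of the
    images along an ultrafilter; the Taylor coefficients of the images are bounded
    by their norms, so that the limit is analytic, of norm at most the given bound
    times the norm of [f] ([Gamma_norm_le]). *)

(** * Complex numbers and complex-valued integrals *)

Notation normc := Normc.normc.
Arguments Normc.normc : simpl never.
Notation Re := complex.Re.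
Notation Im := complex.Im.

Section ComplexModulus.
Context {R : realType}.
Implicit Types (z w : R[i]) (x y : R).

Lemma normc_sqrtE z : normc z = Num.sqrt (Re z ^+ 2 + Im z ^+ 2).
Proof. by case: z. Qed.

Lemma normr_normc z : `|z| = (normc z)%:C%C.
Proof. by rewrite normc_def normc_sqrtE. Qed.

Lemma normc_ge0 z : 0 <= normc z.
Proof. by rewrite normc_sqrtE sqrtr_ge0. Qed.

Lemma sqr_normcE z : normc z ^+ 2 = Re z ^+ 2 + Im z ^+ 2.
Proof. by rewrite normc_sqrtE sqr_sqrtr// addr_ge0// sqr_ge0. Qed.

Lemma normc_eq0 z : (normc z == 0) = (z == 0).
Proof.
apply/eqP/eqP => [/Normc.eq0_normc//|->]; exact: Normc.normc0.
Qed.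

Lemma normc_gt0 z : (0 < normc z) = (z != 0).
Proof. by rewrite lt_def normc_ge0 andbT normc_eq0. Qed.

Lemma ler_normcD z w : normc (z + w) <= normc z + normc w.
Proof. exact: le_normcD. Qed.

Lemma ler_normcB z w : normc (z - w) <= normc z + normc w.
Proof. by rewrite -(normcN w) ler_normcD. Qed.

Lemma normcBC z w : normc (z - w) = normc (w - z).
Proof. by rewrite -normcN opprB. Qed.

Lemma lerB_normc z w : normc z - normc w <= normc (z - w).
Proof. by rewrite lerBlDr -{1}(subrK w z) ler_normcD. Qed.

Lemma normcX z n : normc (z ^+ n) = normc z ^+ n.
Proof.
elim: n => [|n IH]; first by rewrite !expr0 Normc.normc1.
by rewrite !exprS Normc.normcM IH.
Qed.

Lemma normcR x : normc x%:C%C = `|x|.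
Proof. by rewrite normc_sqrtE/= expr0n addr0 sqrtr_sqr. Qed.

Lemma normcJ z : normc z^*%C = normc z.
Proof. by rewrite !normc_sqrtE; case: z => a b /=; rewrite sqrrN. Qed.

Lemma normr_Re_le z : `|Re z| <= normc z.
Proof. by rewrite normc_sqrtE -sqrtr_sqr ler_wsqrtr// lerDl sqr_ge0. Qed.

Lemma normr_Im_le z : `|Im z| <= normc z.
Proof. by rewrite normc_sqrtE -sqrtr_sqr ler_wsqrtr// lerDr sqr_ge0. Qed.

Lemma Re_le_normc z : Re z <= normc z.
Proof. exact: le_trans (ler_norm _) (normr_Re_le z). Qed.

Lemma normc_le_ReIm z : normc z <= `|Re z| + `|Im z|.
Proof.
rewrite -(@ler_pXn2r _ 2)// ?nnegrE ?normc_ge0 ?addr_ge0//.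
rewrite sqr_normcE sqrrD !real_normK ?num_real//.
by rewrite [leRHS]addrAC lerDl mulrn_wge0// mulr_ge0.
Qed.

Lemma ReM z w : Re (z * w) = Re z * Re w - Im z * Im w.
Proof. by case: z; case: w. Qed.

Lemma ImM z w : Im (z * w) = Re z * Im w + Im z * Re w.
Proof. by case: z; case: w. Qed.

Lemma ReV z : Re z^-1 = Re z / normc z ^+ 2.
Proof. by rewrite sqr_normcE; case: z. Qed.

Lemma ImV z : Im z^-1 = - Im z / normc z ^+ 2.
Proof. by rewrite sqr_normcE mulNr; case: z. Qed.

Lemma eqcP z w : Re z = Re w -> Im z = Im w -> z = w.
Proof. by case: z => a b; case: w => c d /= -> ->. Qed.

Lemma conjcB z w : (z - w)^*%C = z^*%C - w^*%C.
Proof. by case: z; case: w => *; apply: eqcP => /=; ring. Qed.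

Lemma conjcM z w : (z * w)^*%C = z^*%C * w^*%C.
Proof. by case: z; case: w => *; apply: eqcP => /=; ring. Qed.

Lemma mulcJ z : z * z^*%C = (normc z ^+ 2)%:C%C.
Proof. by rewrite sqr_normcE; case: z => a b; apply: eqcP => /=; ring. Qed.

Lemma unit_discE z : unit_disc z <-> normc z < 1.
Proof. by rewrite /unit_disc/= normr_normc -ltcR. Qed.

Definition cis x : R[i] := (cos x +i* sin x)%C.

Lemma circle_ptE (r x : R) : circle_pt r x = r%:C%C * cis x.
Proof. by apply: eqcP; rewrite /circle_pt/= mul0r ?subr0 ?addr0. Qed.

Lemma normc_cis x : normc (cis x) = 1.
Proof. by rewrite normc_sqrtE/= cos2Dsin2 sqrtr1. Qed.

Lemma normc_circle_pt r x : normc (circle_pt r x) = `|r|.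
Proof. by rewrite circle_ptE Normc.normcM normcR normc_cis mulr1. Qed.

Lemma cis0 : cis 0 = 1.
Proof. by rewrite /cis cos0 sin0. Qed.

Lemma cisD x y : cis (x + y) = cis x * cis y.
Proof. by apply: eqcP; rewrite ?ReM ?ImM/= ?cosD ?sinD; ring. Qed.

Lemma cisN x : cis (- x) = (cis x)^*%C.
Proof. by rewrite /cis cosN sinN. Qed.

Lemma cis_neq0 x : cis x != 0.
Proof. by rewrite -normc_gt0 normc_cis. Qed.

Lemma cisV x : (cis x)^-1 = cis (- x).
Proof.
apply: (mulfI (cis_neq0 x)); rewrite divff ?cis_neq0//.
by rewrite -cisD subrr cis0.
Qed.

Lemma cisX x n : cis x ^+ n = cis (n%:R * x).
Proof.
elim: n => [|n IH]; first by rewrite mul0r cis0.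
by rewrite exprS IH -cisD -{1}(mul1r x) -mulrDl -natr1 addrC.
Qed.

End ComplexModulus.

Section ComplexMeasurable.
Context d (T : measurableType d) {R : realType}.
Implicit Types (D : set T) (f g : T -> R[i]).

Definition cmeasurable D f :=
  measurable_fun D (fun x => Re (f x)) /\ measurable_fun D (fun x => Im (f x)).

Lemma cmeasurable_cst D (c : R[i]) : cmeasurable D (fun=> c).
Proof. by split; exact: measurable_cst. Qed.

Lemma cmeasurableD D f g : cmeasurable D f -> cmeasurable D g ->
  cmeasurable D (fun x => f x + g x).
Proof.
move=> [rf jf] [rg jg]; split.
  apply: eq_measurable_fun (measurable_funD rf rg) => x _ /=.
  by case: (f x); case: (g x).
apply: eq_measurable_fun (measurable_funD jf jg) => x _ /=.
by case: (f x); case: (g x).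
Qed.

Lemma cmeasurableN D f : cmeasurable D f -> cmeasurable D (fun x => - f x).
Proof.
move=> [rf jf]; split.
  by apply: eq_measurable_fun (measurable_funN rf) => x _ /=; case: (f x).
by apply: eq_measurable_fun (measurable_funN jf) => x _ /=; case: (f x).
Qed.

Lemma cmeasurableB D f g : cmeasurable D f -> cmeasurable D g ->
  cmeasurable D (fun x => f x - g x).
Proof. by move=> mf mg; apply: cmeasurableD => //; exact: cmeasurableN. Qed.

Lemma cmeasurableM D f g : cmeasurable D f -> cmeasurable D g ->
  cmeasurable D (fun x => f x * g x).
Proof.
move=> [rf jf] [rg jg]; split.
  apply: eq_measurable_fun (measurable_funB (measurable_funM rf rg)
    (measurable_funM jf jg)) => x _ /=.
  by rewrite ReM.
apply: eq_measurable_fun (measurable_funD (measurable_funM rf jg)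
    (measurable_funM jf rg)) => x _ /=.
by rewrite ImM.
Qed.

Lemma cmeasurableX D f n : cmeasurable D f -> cmeasurable D (fun x => f x ^+ n).
Proof.
move=> mf; elim: n => [|n IH]; first exact: cmeasurable_cst.
under [X in cmeasurable _ X]eq_fun do rewrite exprS.
exact: cmeasurableM.
Qed.

Lemma cmeasurable_sum D I (s : seq I) (h : I -> T -> R[i]) :
  (forall i, cmeasurable D (h i)) -> cmeasurable D (fun x => \sum_(i <- s) h i x).
Proof.
move=> mh; elim: s => [|i s IH].
  under [X in cmeasurable _ X]eq_fun do rewrite big_nil.
  exact: cmeasurable_cst.
under [X in cmeasurable _ X]eq_fun do rewrite big_cons.
exact: cmeasurableD.
Qed.

Lemma cmeasurable_horner D f (q : {poly R[i]}) : cmeasurable D f ->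
  cmeasurable D (fun x => q.[f x]).
Proof.
move=> mf; under [X in cmeasurable _ X]eq_fun do rewrite horner_coef.
apply: cmeasurable_sum => i; apply: cmeasurableM; first exact: cmeasurable_cst.
exact: cmeasurableX.
Qed.

Lemma measurable_fun_powR D (h : T -> R) (p : R) : measurable_fun D h ->
  measurable_fun D (fun x => h x `^ p).
Proof.
move=> mh; apply: (@measurableT_comp _ _ _ _ _ _ (@powR R ^~ p)) => //.
Qed.

Lemma measurable_fun_inv D (h : T -> R) : measurable_fun D h ->
  measurable_fun D (fun x => (h x)^-1).
Proof.
move=> mh; have -> : (fun x => (h x)^-1) = (fun x => h x * (h x ^+ 2) `^ (-1)).
  apply/funext => x; rewrite powR_inv1 ?sqr_ge0// expr2.
  have [->|h0] := eqVneq (h x) 0; first by rewrite invr0 mul0r.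
  by rewrite invfM mulrA divff// mul1r.
apply: measurable_funM => //.
by apply: measurable_fun_powR; exact: measurable_funX.
Qed.

Lemma measurable_normc D f : cmeasurable D f ->
  measurable_fun D (fun x => normc (f x)).
Proof.
move=> [rf jf].
have -> : (fun x => normc (f x)) =
    (fun x => (Re (f x) ^+ 2 + Im (f x) ^+ 2) `^ (2^-1)).
  by apply/funext => x; rewrite normc_sqrtE powR12_sqrt// addr_ge0// sqr_ge0.
apply: measurable_fun_powR.
by apply: measurable_funD; exact: measurable_funX.
Qed.

Lemma cmeasurableV D f : cmeasurable D f -> cmeasurable D (fun x => (f x)^-1).
Proof.
move=> mf; have mn := measurable_fun_inv (measurable_funX 2 (measurable_normc mf)).
case: mf => rf jf; split.
  apply: eq_measurable_fun (measurable_funM rf mn) => x _ /=.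
  by rewrite ReV.
apply: eq_measurable_fun (measurable_funM (measurable_funN jf) mn) => x _ /=.
by rewrite ImV.
Qed.

Lemma cmeasurable_real D (h : T -> R) : measurable_fun D h ->
  cmeasurable D (fun x => (h x)%:C%C).
Proof. by move=> mh; split => //=; exact: measurable_cst. Qed.

Lemma cmeasurable_conj D f : cmeasurable D f -> cmeasurable D (fun x => (f x)^*%C).
Proof.
move=> [rf jf]; split.
  by apply: eq_measurable_fun rf => x _ /=; case: (f x).
by apply: eq_measurable_fun (measurable_funN jf) => x _ /=; case: (f x).
Qed.

Lemma measurable_normc_powR D f (p : R) : cmeasurable D f ->
  measurable_fun D (fun x => normc (f x) `^ p).
Proof.
by move=> mf; apply: measurable_fun_powR; exact: measurable_normc.
Qed.

End ComplexMeasurable.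

Lemma cmeasurable_comp d1 d2 (T1 : measurableType d1) (T2 : measurableType d2)
    {R : realType} (f : T2 -> R[i]) (g : T1 -> T2) :
  cmeasurable setT f -> measurable_fun setT g -> cmeasurable setT (fun x => f (g x)).
Proof.
by move=> [rf jf] mg; split; [apply: (measurableT_comp rf)|apply: (measurableT_comp jf)].
Qed.

Lemma cmeasurable_cis {R : realType} : cmeasurable setT (@cis R).
Proof.
by split; apply: continuous_measurable_fun; [exact: continuous_cos|exact: continuous_sin].
Qed.

Lemma cmeasurable_circle_pt {R : realType} (r : R) : cmeasurable setT (circle_pt r).
Proof.
have -> : circle_pt r = fun x => r%:C%C * cis x by apply/funext => x; exact: circle_ptE.
apply: cmeasurableM; first exact: cmeasurable_cst.
exact: cmeasurable_cis.
Qed.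

Section ComplexIntegral.
Context d (T : measurableType d) {R : realType}.
Context (mu : {measure set T -> \bar R}) (D : set T).
Context (mD : measurable D).
Implicit Types (f g : T -> R[i]) (c : R[i]).

Definition cintegrable f :=
  mu.-integrable D (fun x => (Re (f x))%:E) /\
  mu.-integrable D (fun x => (Im (f x))%:E).

Definition cint f : R[i] :=
  ((\int[mu]_(x in D) Re (f x)) +i* (\int[mu]_(x in D) Im (f x)))%C.

Lemma eq_cint f g : {in D, f =1 g} -> cint f = cint g.
Proof.
by move=> fg; rewrite /cint; congr (_ +i* _)%C; apply: eq_Rintegral => x xD; rewrite fg.
Qed.

Lemma cintegrableD f g : cintegrable f -> cintegrable g ->
  cintegrable (fun x => f x + g x).
Proof.
move=> [rf jf] [rg jg]; split.
  apply: eq_integrable (integrableD mD rf rg) => // x _.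
  by rewrite -EFinD; case: (f x); case: (g x).
apply: eq_integrable (integrableD mD jf jg) => // x _.
by rewrite -EFinD; case: (f x); case: (g x).
Qed.

Lemma cintD f g : cintegrable f -> cintegrable g ->
  cint (fun x => f x + g x) = cint f + cint g.
Proof.
move=> [rf jf] [rg jg]; apply: eqcP => /=.
  rewrite -RintegralD//; apply: eq_Rintegral => x _.
  by case: (f x); case: (g x).
rewrite -RintegralD//; apply: eq_Rintegral => x _.
by case: (f x); case: (g x).
Qed.

Lemma cintegrableZ c f : cintegrable f -> cintegrable (fun x => c * f x).
Proof.
move=> [rf jf]; split.
  apply: eq_integrable (integrableB mD (integrableZl mD (Re c) rf)
    (integrableZl mD (Im c) jf)) => // x _.
  by rewrite -!EFinM -EFinB ReM.
apply: eq_integrable (integrableD mD (integrableZl mD (Re c) jf)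
    (integrableZl mD (Im c) rf)) => // x _.
by rewrite -!EFinM -EFinD ImM.
Qed.

Lemma cintZ c f : cintegrable f -> cint (fun x => c * f x) = c * cint f.
Proof.
move=> [rf jf]; apply: eqcP; rewrite ?ReM ?ImM /=.
  rewrite -!RintegralZl// -RintegralB//.
  - by apply: eq_Rintegral => x _; rewrite ReM.
  - exact: eq_integrable (integrableZl mD (Re c) rf).
  - exact: eq_integrable (integrableZl mD (Im c) jf).
rewrite -!RintegralZl// -RintegralD//.
- by apply: eq_Rintegral => x _; rewrite ImM.
- exact: eq_integrable (integrableZl mD (Re c) jf).
- exact: eq_integrable (integrableZl mD (Im c) rf).
Qed.

Lemma cint_sum I (s : seq I) (h : I -> T -> R[i]) :
  (forall i, cintegrable (h i)) ->
  cintegrable (fun x => \sum_(i <- s) h i x) /\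
  cint (fun x => \sum_(i <- s) h i x) = \sum_(i <- s) cint (h i).
Proof.
move=> hi; elim: s => [|i s [IH1 IH2]].
  under eq_fun do rewrite big_nil; rewrite big_nil; split.
    by split; exact: integrable0.
  by apply: eqcP => /=; rewrite /Rintegral integral0.
under eq_fun do rewrite big_cons; rewrite big_cons; split; first exact: cintegrableD.
by rewrite cintD// IH2.
Qed.

(** Rotating the value of the integral onto the positive real axis reduces the
    triangle inequality to the monotonicity of the integral of the real part. *)
Lemma normc_cint_le f : cintegrable f ->
  mu.-integrable D (fun x => (normc (f x))%:E) ->
  normc (cint f) <= \int[mu]_(x in D) normc (f x).
Proof.
move=> intf intn; have [c0|c0] := eqVneq (cint f) 0.
  by rewrite c0 Normc.normc0 Rintegral_ge0// => x _; exact: normc_ge0.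
set c := cint f in c0 *.
have nc0 : 0 < normc c by rewrite normc_gt0.
have -> : normc c = Re ((c^*%C / (normc c)%:C%C) * c).
  rewrite mulrAC [c^*%C * c]mulrC mulcJ -fmorphV -rmorphM/= expr2 mulfK//.
  by rewrite gt_eqF.
rewrite -cintZ//; apply: le_Rintegral => //.
  by case: (cintegrableZ (c^*%C / (normc c)%:C%C) intf).
move=> x _; apply: le_trans (Re_le_normc _) _.
rewrite !Normc.normcM normcJ Normc.normcV normcR ger0_norm ?normc_ge0//.
by rewrite divff ?mul1r// gt_eqF.
Qed.

Lemma normc_cint_le_cst f (M : R) : (mu D < +oo)%E -> cintegrable f ->
  mu.-integrable D (fun x => (normc (f x))%:E) ->
  (forall x, D x -> normc (f x) <= M) -> normc (cint f) <= M * fine (mu D).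
Proof.
move=> muD intf intn fM; apply: (le_trans (normc_cint_le intf intn)).
rewrite -Rintegral_cst//; apply: le_Rintegral => //.
by apply: measurable_bounded_integrable => //; exact: bounded_cst.
Qed.

End ComplexIntegral.

Section BoundedIntegral.
Context d (T : measurableType d) {R : realType}.
Context (mu : {finite_measure set T -> \bar R}) (D : set T).
Context (mD : measurable D).
Implicit Types (f g : T -> R[i]) (c : R[i]).

Lemma finite_measure_lty : (mu D < +oo)%E.
Proof. by rewrite -ge0_fin_numE//; exact: fin_num_measure. Qed.

Lemma bounded_integrable (h : T -> R) (M : R) : measurable_fun D h ->
  (forall x, D x -> `|h x| <= M) -> mu.-integrable D (fun x => (h x)%:E).
Proof.
move=> mh hM; apply: measurable_bounded_integrable => //.
  exact: finite_measure_lty.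
by exists M; split; [exact: num_real|move=> y My x Dx; exact: le_trans (hM x Dx) (ltW My)].
Qed.

Lemma bounded_cintegrable f (M : R) : cmeasurable D f ->
  (forall x, D x -> normc (f x) <= M) -> cintegrable mu D f.
Proof.
move=> [rf jf] fM; split; apply: (@bounded_integrable _ M) => // x Dx.
  by apply: le_trans (normr_Re_le _) (fM x Dx).
by apply: le_trans (normr_Im_le _) (fM x Dx).
Qed.

Lemma bounded_normc_integrable f (M : R) : cmeasurable D f ->
  (forall x, D x -> normc (f x) <= M) -> mu.-integrable D (fun x => (normc (f x))%:E).
Proof.
move=> mf fM; apply: (@bounded_integrable _ M); first exact: measurable_normc.
by move=> x Dx; rewrite ger0_norm ?normc_ge0// fM.
Qed.

Lemma normc_cint_bounded f (M : R) : cmeasurable D f ->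
  (forall x, D x -> normc (f x) <= M) -> normc (cint mu D f) <= M * fine (mu D).
Proof.
move=> mf fM; apply: normc_cint_le_cst => //; first exact: finite_measure_lty.
  exact: bounded_cintegrable fM.
exact: bounded_normc_integrable fM.
Qed.

End BoundedIntegral.

(** * Means over the circle and the Poisson formula *)

Section JensenInequality.
Context {R : realType}.

(** By convexity the graph of the power function lies above its tangent line at
    [l]. *)
Lemma young_tangent (p h l : R) : 1 <= p -> 0 <= h -> 0 <= l ->
  h * l `^ (p - 1) <= h `^ p / p + (1 - p^-1) * l `^ p.
Proof.
move=> p1 h0 l0; have p0 : 0 < p by apply: lt_le_trans p1.
move: p1; rewrite le_eqVlt => /orP[/eqP<-|p1].
  by rewrite subrr powRr0 invr1 subrr mul0r addr0 !mulr1 powRr1.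
have p10 : 0 < p - 1 by rewrite subr_gt0.
have q0 : 0 < p / (p - 1) by rewrite divr_gt0.
have := @conjugate_powR R h (l `^ (p - 1)) p (p / (p - 1)) h0 (powR_ge0 _ _) p0 q0.
have pn : p != 0 by rewrite gt_eqF.
have p1n : p - 1 != 0 by rewrite gt_eqF.
have -> : p^-1 + (p / (p - 1))^-1 = 1 by field; rewrite pn p1n.
move=> /(_ erefl); rewrite -powRrM.
have -> : (p - 1) * (p / (p - 1)) = p by field.
have -> : (p / (p - 1))^-1 = 1 - p^-1 by field; rewrite pn p1n.
by rewrite [(1 - _) * _]mulrC.
Qed.

(** Jensen's inequality for the power function and the measure of density [k],
    obtained by integrating the tangent line of the power function at the mean
    value. *)
Lemma weighted_jensen d (T : measurableType d) (mu : {measure set T -> \bar R})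
    (D : set T) (p I : R) (k h : T -> R) :
  measurable D -> 1 <= p -> 0 < I ->
  measurable_fun D h -> (forall x, D x -> 0 <= h x) -> (forall x, D x -> 0 <= k x) ->
  mu.-integrable D (fun x => (k x)%:E) ->
  mu.-integrable D (fun x => (h x * k x)%:E) ->
  \int[mu]_(x in D) k x <= I ->
  ((((\int[mu]_(x in D) (h x * k x))%R `^ p)%R)%:E <=
    (I `^ (p - 1))%:E * \int[mu]_(x in D) (h x `^ p * k x)%:E)%E.
Proof.
move=> mD p1 I0 mh h0 k0 ik ihk kI; have p0 : 0 < p by apply: lt_le_trans p1.
set X := Rintegral _ _ _.
have X0 : 0 <= X by apply: Rintegral_ge0 => x Dx; rewrite mulr_ge0 ?h0 ?k0.
have mk : measurable_fun D k by apply/measurable_EFinP; case/integrableP: ik.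
have Y0 : (0 <= \int[mu]_(x in D) (h x `^ p * k x)%:E)%E.
  by apply: integral_ge0 => x Dx; rewrite lee_fin mulr_ge0 ?powR_ge0 ?k0.
have mY : measurable_fun D (fun x => h x `^ p * k x).
  by apply: measurable_funM => //; exact: measurable_fun_powR.
case: (ltP (\int[mu]_(x in D) (h x `^ p * k x)%:E)%E +oo%E) => [Yoo|]; last first.
  rewrite leye_eq => /eqP ->.
  by rewrite gt0_muley ?leey// lte_fin powR_gt0.
have iY : mu.-integrable D (fun x => (h x `^ p * k x)%:E).
  apply/integrableP; split; first exact/measurable_EFinP.
  rewrite (eq_integral (fun x => (h x `^ p * k x)%:E))// => x /set_mem Dx.
  by rewrite /= ger0_norm// mulr_ge0 ?powR_ge0 ?k0.
set Y := Rintegral mu D (fun x => h x `^ p * k x).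
have -> : (\int[mu]_(x in D) (h x `^ p * k x)%:E)%E = Y%:E.
  by rewrite /Y /Rintegral fineK// ge0_fin_numE.
rewrite -EFinM lee_fin; pose l := X / I.
have l0 : 0 <= l by rewrite divr_ge0// ltW.
have key : l `^ (p - 1) * X <= p^-1 * Y + (1 - p^-1) * l `^ p * I.
  have ip : 0 <= 1 - p^-1 by rewrite subr_ge0 invf_le1.
  apply: (@le_trans _ _ (p^-1 * Y + (1 - p^-1) * l `^ p * \int[mu]_(x in D) k x)); last first.
    by rewrite lerD2l ler_wpM2l// mulr_ge0// powR_ge0.
  rewrite -!RintegralZl// -RintegralD//; last 2 first.
  - exact: eq_integrable (integrableZl mD p^-1 iY).
  - exact: eq_integrable (integrableZl mD ((1 - p^-1) * l `^ p) ik).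
  apply: le_Rintegral => //.
  - exact: eq_integrable (integrableZl mD (l `^ (p - 1)) ihk).
  - by apply: eq_integrable (integrableD mD (integrableZl mD p^-1 iY)
      (integrableZl mD ((1 - p^-1) * l `^ p) ik)).
  move=> x Dx.
  have := ler_wpM2r (k0 x Dx) (young_tangent p1 (h0 x Dx) l0).
  by move=> hk; rewrite -subr_ge0 in hk; rewrite -subr_ge0; apply: (le_trans hk);
    rewrite le_eqVlt; apply/orP; left; apply/eqP; ring.
have lX : l * I = X by rewrite /l divfK// gt_eqF.
have lp : l `^ (p - 1) * l = l `^ p.
  have [l00|ln0] := eqVneq l 0.
    by rewrite l00 mulr0 powR0// gt_eqF.
  by rewrite -{2}(powRr1 l0) -powRD ?subrK// ln0 implybT.
have e : l `^ (p - 1) * X = l `^ p * I by rewrite -lX mulrA lp.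
rewrite e in key.
have le1 : l `^ p * I <= Y.
  rewrite -(@ler_pM2l _ p^-1) ?invr_gt0//.
  move: key; rewrite mulrBl mul1r mulrBl -lerBlDr opprB addrCA subrr addr0.
  by rewrite mulrA.
have -> : X `^ p = I `^ (p - 1) * (l `^ p * I).
  rewrite -lX powRM ?(ltW I0)// [RHS]mulrCA; congr (_ * _).
  rewrite -{3}(powRr1 (ltW I0)) -powRD ?subrK//.
  by rewrite (gt_eqF I0) implybT.
by rewrite ler_wpM2l// powR_ge0.
Qed.

End JensenInequality.

Section CircleMean.
Context {R : realType}.

Lemma twopi_gt0 : 0 < 2 * pi :> R.
Proof. by rewrite mulr_gt0// pi_gt0. Qed.

(** The normalized arc length of the unit circle, in terms of the angle. *)
Definition circ : probability (measurableTypeR R) R := uniform_prob twopi_gt0.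

Lemma integral_circ (f : R -> \bar R) : measurable_fun setT f ->
  (forall x, 0 <= f x)%E ->
  (\int[circ]_x f x = (2 * pi)^-1%:E * \int[lebesgue_measure]_(x in `[0%R, (2 * pi)%R]) f x)%E.
Proof. by move=> mf f0; rewrite integral_uniform// subr0. Qed.

Lemma integral_meanE (p : R) f r : cmeasurable setT (fun x => f (circle_pt r x)) ->
  integral_mean p f r = ((\int[circ]_x (normc (f (circle_pt r x)) `^ p)%:E) `^ p^-1)%E.
Proof.
move=> mf; rewrite /integral_mean integral_circ// => [|x].
  exact/measurable_EFinP/measurable_normc_powR.
by rewrite lee_fin powR_ge0.
Qed.

Lemma FTC_everywhere (f F : R -> R) (a b : R) : a < b ->
  (forall x : R, is_derive x 1 F (f x)) -> continuous f ->
  (\int[lebesgue_measure]_(x in `[a, b]) (f x)%:E = (F b - F a)%:E)%E.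
Proof.
move=> ab dF cf; have cF : continuous F.
  move=> x; apply: differentiable_continuous; apply/derivable1_diffP.
  by case: (dF x).
rewrite (@continuous_FTC2 _ f F)//.
- exact: continuous_subspaceT.
- split.
  + by move=> x _; case: (dF x).
  + by apply: cvg_at_right_filter; exact: cF.
  + by apply: cvg_at_left_filter; exact: cF.
- by move=> x _; rewrite derive1E; case: (dF x).
Qed.

Lemma circ_setT : fine (circ [set: R]) = 1.
Proof. by rewrite probability_setT. Qed.

(** The bound [M] provides the integrability of [f] that the passage to real-valued
    integrals requires. *)
Lemma mean_FTC (f F : R -> R) (M : R) : (forall x : R, is_derive x 1 F (f x)) ->
  continuous f -> (forall x, `|f x| <= M) ->
  \int[circ]_x f x = (F (2 * pi) - F 0) / (2 * pi).
Proof.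
move=> dF cf fM; have mf := continuous_measurable_fun cf.
have -> : \int[circ]_x f x = \int[circ]_x (f x + M) - M.
  have if_ : circ.-integrable setT (fun x => (f x)%:E).
    by apply: (@bounded_integrable _ _ _ circ _ measurableT f M).
  have iM : circ.-integrable setT (fun x : R => M%:E).
    by apply: (@bounded_integrable _ _ _ circ _ measurableT (fun=> M) `|M|).
  rewrite RintegralD// Rintegral_cst// [in X in _ = _ + X - _]circ_setT.
  by rewrite mulr1 addrK.
have fM0 x : 0 <= f x + M.
  by move: (fM x); rewrite ler_norml => /andP[+ _]; rewrite -subr_ge0 opprK.
rewrite /Rintegral integral_circ//; last first.
  by apply/measurable_EFinP; apply: measurable_funD.
have dG (x : R) : is_derive x 1 (fun y => F y + M * y) (f x + M).
  apply: is_deriveD; rewrite -[X in is_derive _ _ _ X](mulr1 M).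
  exact: is_deriveZ.
rewrite (FTC_everywhere twopi_gt0 dG).
  rewrite /= mulr0 addr0 addrAC mulrDr [_^-1 * (M * _)]mulrCA mulVf; last first.
    by rewrite gt_eqF// twopi_gt0.
  by rewrite mulr1 addrK mulrC.
by move=> x; apply: cvgD; [exact: cf|exact: cvg_cst].
Qed.

Lemma cint_cis n : cint circ setT (fun x => cis x ^+ n.+1) = 0.
Proof.
have n0 : n.+1%:R != 0 :> R by rewrite pnatr_eq0.
have e x : cis x ^+ n.+1 = cis (n.+1%:R * x) :> R[i] by exact: cisX.
have p2 k : cos (k.+1%:R * (2 * pi)) = 1 :> R /\ sin (k.+1%:R * (2 * pi)) = 0 :> R.
  elim: k => [|k [IH1 IH2]].
    by rewrite mul1r mulr_natl cos2pi sin2pi.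
  rewrite -natr1 mulrDl mul1r cosD sinD IH1 IH2 mulr_natl cos2pi sin2pi.
  by rewrite !mulr0 mulr1 subr0 mul0r addr0.
have [c2 s2] := p2 n.
have ds (x : R) : is_derive x 1 (fun y : R => n.+1%:R * y) n.+1%:R.
  rewrite -[X in is_derive _ _ _ X](mulr1 n.+1%:R); exact: is_deriveZ.
have cn : continuous (fun x : R => n.+1%:R * x) by apply: mulrl_continuous.
apply: eqcP => /=.
  have dF (x : R) : is_derive x 1 (fun x => n.+1%:R^-1 * sin (n.+1%:R * x))
      (Re (cis x ^+ n.+1)).
    rewrite e /=.
    have := is_deriveZ n.+1%:R^-1 (is_derive1_comp (is_derive_sin (n.+1%:R * x)) (ds x)).
    move=> H; apply: (is_derive_eq H).
    by rewrite -[LHS]/(_ * _) mulrCA mulVf// mulr1.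
  rewrite (mean_FTC (M := 1) dF).
  - by rewrite s2 !mulr0 sin0 mulr0 subrr mul0r.
  - under eq_fun do rewrite e /=.
    by move=> x; apply: continuous_comp; [exact: cn|exact: continuous_cos].
  - by move=> x; rewrite e /= ler_norml cos_geN1 cos_le1.
have dF (x : R) : is_derive x 1 (fun x => - n.+1%:R^-1 * cos (n.+1%:R * x))
    (Im (cis x ^+ n.+1)).
  rewrite e /=.
  have := is_deriveZ (- n.+1%:R^-1) (is_derive1_comp (is_derive_cos (n.+1%:R * x)) (ds x)).
  move=> H; apply: (is_derive_eq H).
  by rewrite -[LHS]/(_ * _) mulNr mulrCA mulVf// mulr1 opprK.
rewrite (mean_FTC (M := 1) dF).
- by rewrite c2 mulr0 cos0 subrr mul0r.
- under eq_fun do rewrite e /=.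
  by move=> x; apply: continuous_comp; [exact: cn|exact: continuous_sin].
- by move=> x; rewrite e /= ler_norml sin_geN1 sin_le1.
Qed.

End CircleMean.

Section PoissonKernel.
Context {R : realType}.
Implicit Types (w a : R[i]) (x : R).

Lemma cauchy_denominator_ge a z : normc a < 1 -> normc z <= 1 ->
  1 - normc a <= normc (1 - a * z).
Proof.
move=> a1 z1; apply: le_trans (lerB_normc _ _).
by rewrite Normc.normc1 Normc.normcM lerD2l lerN2 ler_piMr// normc_ge0.
Qed.

Lemma cauchy_denominator_neq0 a z : normc a < 1 -> normc z <= 1 -> 1 - a * z != 0.
Proof.
move=> a1 z1; rewrite -normc_gt0.
by apply: lt_le_trans (cauchy_denominator_ge a1 z1); rewrite subr_gt0.
Qed.

Lemma normc_cauchy_le a z : normc a < 1 -> normc z <= 1 ->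
  normc (1 - a * z)^-1 <= (1 - normc a)^-1.
Proof.
move=> a1 z1; rewrite Normc.normcV lef_pV2 ?cauchy_denominator_ge//.
  by rewrite posrE normc_gt0 cauchy_denominator_neq0.
by rewrite posrE subr_gt0.
Qed.

Lemma cmeasurable_cauchy a n :
  cmeasurable setT (fun x => cis x ^+ n / (1 - a * cis x)).
Proof.
apply: cmeasurableM; first by apply: cmeasurableX; exact: cmeasurable_cis.
apply: cmeasurableV; apply: cmeasurableB; first exact: cmeasurable_cst.
by apply: cmeasurableM; [exact: cmeasurable_cst|exact: cmeasurable_cis].
Qed.

Lemma normc_cauchy_cis_le a n x : normc a < 1 ->
  normc (cis x ^+ n / (1 - a * cis x)) <= (1 - normc a)^-1.
Proof.
move=> a1; rewrite Normc.normcM normcX normc_cis expr1n mul1r.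
by rewrite normc_cauchy_le// normc_cis.
Qed.

Lemma cintegrable_circ (f : R -> R[i]) (M : R) : cmeasurable setT f ->
  (forall x, normc (f x) <= M) -> cintegrable circ setT f.
Proof. by move=> mf fM; apply: (@bounded_cintegrable _ _ _ circ _ measurableT f M). Qed.

Lemma normc_cint_circ (f : R -> R[i]) (M : R) : cmeasurable setT f ->
  (forall x, normc (f x) <= M) -> normc (cint circ setT f) <= M.
Proof.
move=> mf fM.
have := @normc_cint_bounded _ _ _ circ _ measurableT f M mf (fun x _ => fM x).
by rewrite circ_setT mulr1.
Qed.

Lemma cint_circ1 : cint circ setT (fun x : R => 1 : R[i]) = 1.
Proof. by apply: eqcP; rewrite /cint/= Rintegral_cst// circ_setT ?mulr1 ?mul0r. Qed.

(** Expanding one step of the geometric series gives [J n = a J (n + 1)] for the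
    moments [J n] of the Cauchy kernel with [0 < n]; they are bounded, so they
    vanish. *)
Lemma cint_cauchy a n : normc a < 1 ->
  cint circ setT (fun x => cis x ^+ n / (1 - a * cis x)) = (n == 0)%:R.
Proof.
move=> a1; pose J k := cint circ setT (fun x => cis x ^+ k / (1 - a * cis x)).
have iJ k : cintegrable circ setT (fun x => cis x ^+ k / (1 - a * cis x)).
  apply: (@cintegrable_circ _ (1 - normc a)^-1); first exact: cmeasurable_cauchy.
  by move=> x; exact: normc_cauchy_cis_le.
have icis k : cintegrable circ setT (fun x => cis x ^+ k).
  apply: (@cintegrable_circ _ 1); first by apply: cmeasurableX; exact: cmeasurable_cis.
  by move=> x; rewrite normcX normc_cis expr1n.
have step k : J k = cint circ setT (fun x => cis x ^+ k) + a * J k.+1.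
  rewrite /J -cintZ// -cintD//; last exact: cintegrableZ.
  apply: eq_cint => x _.
  have ne0 : 1 - a * cis x != 0 by rewrite cauchy_denominator_neq0// normc_cis.
  by apply: (mulIf ne0); rewrite mulrDl divfK// mulrA divfK// exprS; ring.
have J0 k : J k.+1 = 0.
  have bound m : normc (J k.+1) <= normc a ^+ m * (1 - normc a)^-1.
    have -> : J k.+1 = a ^+ m * J (m + k.+1)%N.
      elim: m => [|m IH]; first by rewrite expr0 mul1r.
      by rewrite IH addnS step cint_cis add0r mulrA -exprSr addSn addnS.
    rewrite Normc.normcM normcX ler_wpM2l ?exprn_ge0 ?normc_ge0//.
    apply: normc_cint_circ; first exact: cmeasurable_cauchy.
    by move=> x; exact: normc_cauchy_cis_le.
  apply/eqP; rewrite -normc_eq0 eq_le normc_ge0 andbT.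
  have cv : (fun m => normc a ^+ m * (1 - normc a)^-1) @ \oo --> (0 : R).
    rewrite -[X in _ --> X](mul0r (1 - normc a)^-1); apply: cvgMl.
    by apply: cvg_expr; rewrite ger0_norm// normc_ge0.
  by apply: (ler_cvg_to (cvg_cst (normc (J k.+1))) cv); near=> m; exact: bound.
case: n => [|n]; last exact: J0.
rewrite [LHS]step J0 mulr0 addr0.
by rewrite -[RHS]cint_circ1; apply: eq_cint => x _; rewrite expr0.
Unshelve. all: by end_near. Qed.

Definition poisson w x : R := (1 - normc w ^+ 2) / normc (cis x - w) ^+ 2.

Lemma normc_cis_sub w x : normc (cis x - w) = normc (1 - w^*%C * cis x).
Proof.
have -> : cis x - w = cis x * (1 - w^*%C * cis x)^*%C.
  rewrite conjcB conjc1 conjcM conjcK -cisN -cisV mulrBr mulr1 mulrCA.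
  by rewrite divff ?mulr1// cis_neq0.
by rewrite Normc.normcM normc_cis mul1r normcJ.
Qed.

Lemma poisson_ge0 w x : normc w < 1 -> 0 <= poisson w x.
Proof.
move=> w1; rewrite divr_ge0 ?sqr_ge0// subr_ge0 expr_le1// ?normc_ge0//.
exact: ltW.
Qed.

Lemma poissonE w x : normc w < 1 ->
  poisson w x = 2 * Re (1 - w^*%C * cis x)^-1 - 1.
Proof.
move=> w1; rewrite /poisson normc_cis_sub ReV; set u := 1 - w^*%C * _.
have u0 : normc u ^+ 2 != 0.
  by rewrite expf_neq0// gt_eqF// normc_gt0 cauchy_denominator_neq0 ?normcJ ?normc_cis.
suff -> : 1 - normc w ^+ 2 = 2 * Re u - normc u ^+ 2.
  by rewrite mulrBl divff// mulrA.
rewrite !sqr_normcE /u; case: w {w1 u u0} => a b /=.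
have := cos2Dsin2 x; move: (cos x) (sin x) => c s e.
have -> : (1 - (a * c - - b * s)) ^+ 2 + (0 - (a * s + - b * c)) ^+ 2 =
  1 - 2 * (a * c + b * s) + (a ^+ 2 + b ^+ 2) * (c ^+ 2 + s ^+ 2) by ring.
by rewrite e; ring.
Qed.

Lemma normcJ_lt1 w : normc w < 1 -> normc w^*%C < 1.
Proof. by rewrite normcJ. Qed.

Lemma measurable_poisson w : measurable_fun setT (poisson w).
Proof.
apply: measurable_funM => //; apply: measurable_fun_inv; apply: measurable_funX.
apply: measurable_normc; apply: cmeasurableB; last exact: cmeasurable_cst.
exact: cmeasurable_cis.
Qed.

Lemma poisson_le w x : normc w < 1 ->
  poisson w x <= 2 / (1 - normc w).
Proof.
move=> w1; rewrite poissonE//; apply: (@le_trans _ _ (2 * Re (1 - w^*%C * cis x)^-1)).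
  by rewrite gerBl.
rewrite ler_pM2l//; apply: le_trans (Re_le_normc _) _.
by rewrite -(normcJ w) normc_cauchy_le ?normcJ ?normc_cis.
Qed.

Lemma normr_poisson_le w x : normc w < 1 -> `|poisson w x| <= 2 / (1 - normc w).
Proof. by move=> w1; rewrite ger0_norm ?poisson_le// poisson_ge0. Qed.

Lemma integrable_circ (h : R -> R) (M : R) : measurable_fun setT h ->
  (forall x, `|h x| <= M) -> circ.-integrable setT (fun x => (h x)%:E).
Proof. by move=> mh hM; apply: (@bounded_integrable _ _ _ circ _ measurableT h M). Qed.

Lemma integrable_poisson w : normc w < 1 ->
  circ.-integrable setT (fun x => (poisson w x)%:E).
Proof.
move=> w1; apply: (@integrable_circ _ (2 / (1 - normc w))).
  exact: measurable_poisson.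
by move=> x; exact: normr_poisson_le.
Qed.

Lemma mean_poisson w : normc w < 1 -> \int[circ]_x poisson w x = 1.
Proof.
move=> w1; have w1' := normcJ_lt1 w1.
have [i0 _] : cintegrable circ setT (fun x => (1 - w^*%C * cis x)^-1).
  apply: (@cintegrable_circ _ (1 - normc w)^-1).
    have := cmeasurable_cauchy w^*%C 0.
    by under eq_fun do rewrite expr0 mul1r.
  by move=> x; rewrite -(normcJ w) normc_cauchy_le// normc_cis.
have c1 : circ.-integrable setT (fun x : R => 1%:E).
  by apply: (@integrable_circ _ 1) => // x; rewrite normr1.
transitivity (\int[circ]_x (2 * Re (1 - w^*%C * cis x)^-1 - 1)).
  by apply: eq_Rintegral => x _; exact: poissonE.
rewrite RintegralB//; last exact: eq_integrable (integrableZl measurableT 2 i0).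
rewrite RintegralZl// Rintegral_cst// [in X in _ - _ * X]circ_setT mulr1.
have /(congr1 (@complex.Re R)) /= := cint_cauchy 0 w1'.
under eq_Rintegral do rewrite expr0 mul1r.
by move=> ->; ring.
Qed.

Lemma cintegrable_poisson w n : normc w < 1 ->
  cintegrable circ setT (fun x => (poisson w x)%:C%C * cis x ^+ n).
Proof.
move=> w1; apply: (@cintegrable_circ _ (2 / (1 - normc w))).
  apply: cmeasurableM; first exact: cmeasurable_real (measurable_poisson w).
  by apply: cmeasurableX; exact: cmeasurable_cis.
move=> x; rewrite Normc.normcM normcX normc_cis expr1n mulr1 normcR.
exact: normr_poisson_le.
Qed.

(** Multiplying the kernel by [cis x - w] leaves a multiple of a Cauchy kernel,
    whose moments are known; hence each moment is [w] times the previous one. *)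
Lemma cint_poisson_cis w n : normc w < 1 ->
  cint circ setT (fun x => (poisson w x)%:C%C * cis x ^+ n) = w ^+ n.
Proof.
move=> w1; have w1' := normcJ_lt1 w1.
elim: n => [|n IH].
  apply: eqcP => /=.
    rewrite -[RHS](mean_poisson w1); apply: eq_Rintegral => x _.
    by rewrite mulr1 mulr0 subr0.
  under eq_Rintegral do rewrite mulr0 mul0r addr0.
  by rewrite Rintegral_cst// mul0r.
have iC : cintegrable circ setT (fun x => cis x ^+ n.+1 / (1 - w^*%C * cis x)).
  apply: (@cintegrable_circ _ (1 - normc w^*%C)^-1); first exact: cmeasurable_cauchy.
  by move=> x; exact: normc_cauchy_cis_le.
have -> : cint circ setT (fun x => (poisson w x)%:C%C * cis x ^+ n.+1) =
    cint circ setT (fun x => w * ((poisson w x)%:C%C * cis x ^+ n) +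
      (1 - normc w ^+ 2)%:C%C * (cis x ^+ n.+1 / (1 - w^*%C * cis x))).
  apply: eq_cint => x _.
  have cw : cis x - w != 0.
    by rewrite -normc_gt0 normc_cis_sub normc_gt0 cauchy_denominator_neq0// normc_cis.
  have e : (poisson w x)%:C%C =
      (1 - normc w ^+ 2)%:C%C / ((cis x - w) * (cis x - w)^*%C).
    by rewrite mulcJ -fmorphV -rmorphM.
  have e2 : (cis x - w)^*%C = (1 - w^*%C * cis x) / cis x.
    by rewrite conjcB -cisN -cisV mulrBl mul1r mulfK// cis_neq0.
  have ne0 : 1 - w^*%C * cis x != 0 by rewrite cauchy_denominator_neq0// normc_cis.
  rewrite e e2 [cis x ^+ n.+1]exprS; move: (cis_neq0 x) cw ne0.
  move: ((1 - normc w ^+ 2)%:C%C) (cis x ^+ n) (w^*%C) (cis x).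
  by move=> A y w' c c0 cw ne0; field; rewrite cw c0 ne0.
rewrite cintD//; last 2 first.
- by apply: cintegrableZ => //; exact: cintegrable_poisson.
- exact: cintegrableZ.
rewrite cintZ//; last exact: cintegrable_poisson.
by rewrite IH cintZ// cint_cauchy// mulr0 addr0 exprS.
Qed.

Lemma cint_poisson_horner w (q : {poly R[i]}) : normc w < 1 ->
  cint circ setT (fun x => (poisson w x)%:C%C * q.[cis x]) = q.[w].
Proof.
move=> w1; rewrite horner_coef.
transitivity (cint circ setT (fun x => \sum_(i < size q)
    q`_i * ((poisson w x)%:C%C * cis x ^+ i))).
  apply: eq_cint => x _; rewrite horner_coef mulr_sumr; apply: eq_bigr => i _.
  by rewrite mulrCA.
rewrite (cint_sum measurableT (index_enum _) _).2; last first.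
  by move=> i; apply: cintegrableZ => //; exact: cintegrable_poisson.
apply: eq_bigr => i _; rewrite cintZ//; last exact: cintegrable_poisson.
by rewrite cint_poisson_cis.
Qed.

End PoissonKernel.

(** * The disc algebra and mean value inequalities *)

Section DiscAlgebra.
Context {R : realType}.
Implicit Types (f g : R[i] -> R[i]) (q : {poly R[i]}).

(** The disc algebra, as the uniform closure of the polynomials on the closed disc:
    the Poisson inequality passes from polynomials to their uniform limits. *)
Definition disc_algebra g := forall e : R, 0 < e ->
  exists q, forall z, normc z <= 1 -> normc (g z - q.[z]) <= e.

Lemma horner_bound q : exists2 M : R, 0 < M & forall z, normc z <= 1 -> normc q.[z] <= M.
Proof.
exists (1 + \sum_(i < size q) normc q`_i).
  by rewrite ltr_wpDr// sumr_ge0// => i _; exact: normc_ge0.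
move=> z z1; rewrite horner_coef; apply: (@le_trans _ _ (\sum_(i < size q) normc q`_i)).
  elim/big_ind2: _ => [|a b c d ab cd|i _]; first by rewrite Normc.normc0.
    by apply: le_trans (ler_normcD _ _) _; exact: lerD.
  rewrite Normc.normcM normcX ler_piMr ?normc_ge0//.
  by rewrite exprn_ile1 ?normc_ge0.
by rewrite lerDr.
Qed.

Lemma disc_algebra_bound g : disc_algebra g ->
  exists2 M : R, 0 < M & forall z, normc z <= 1 -> normc (g z) <= M.
Proof.
move=> /(_ 1 ltr01)[q gq]; have [M M0 qM] := horner_bound q.
exists (1 + M) => [|z z1]; first by rewrite addr_gt0.
by rewrite -(subrK q.[z] (g z)); apply: le_trans (ler_normcD _ _) _; rewrite lerD ?gq ?qM.
Qed.

Lemma disc_algebra_poly q : disc_algebra (horner q).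
Proof.
by move=> e e0; exists q => z _; rewrite subrr Normc.normc0 ltW.
Qed.

Lemma eq_disc_algebra f g : (forall z, normc z <= 1 -> f z = g z) ->
  disc_algebra f -> disc_algebra g.
Proof.
by move=> fg af e /af[q fq]; exists q => z z1; rewrite -fg// fq.
Qed.

Lemma disc_algebraD f g : disc_algebra f -> disc_algebra g ->
  disc_algebra (fun z => f z + g z).
Proof.
move=> af ag e e0; have e20 : 0 < e / 2 by rewrite divr_gt0.
have [qf hf] := af _ e20; have [qg hg] := ag _ e20.
exists (qf + qg) => z z1; rewrite hornerD opprD addrACA.
by apply: le_trans (ler_normcD _ _) _; rewrite [leRHS]splitr lerD ?hf ?hg.
Qed.

Lemma disc_algebraM f g : disc_algebra f -> disc_algebra g ->
  disc_algebra (fun z => f z * g z).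
Proof.
move=> af ag e e0; have [M M0 gM] := disc_algebra_bound ag.
have [qf hf] := af (e / 2 / M) (divr_gt0 (divr_gt0 e0 (ltr0n _ 2)) M0).
have [N N0 qN] := horner_bound qf.
have [qg hg] := ag (e / 2 / N) (divr_gt0 (divr_gt0 e0 (ltr0n _ 2)) N0).
exists (qf * qg) => z z1; rewrite hornerM.
have -> : f z * g z - qf.[z] * qg.[z] =
  (f z - qf.[z]) * g z + qf.[z] * (g z - qg.[z]) by ring.
apply: le_trans (ler_normcD _ _) _; rewrite !Normc.normcM [leRHS]splitr lerD//.
  rewrite -[leRHS](divfK (lt0r_neq0 M0)).
  by rewrite ler_pM ?normc_ge0 ?hf ?gM.
rewrite -[leRHS](divfK (lt0r_neq0 N0)) [leRHS]mulrC.
by rewrite ler_pM ?normc_ge0 ?hg ?qN.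
Qed.

Lemma disc_algebra_cst (c : R[i]) : disc_algebra (fun=> c).
Proof.
apply: (@eq_disc_algebra (horner c%:P)); last exact: disc_algebra_poly.
by move=> z _; rewrite hornerC.
Qed.

Lemma disc_algebra_id : disc_algebra id.
Proof.
apply: (@eq_disc_algebra (horner 'X)); last exact: disc_algebra_poly.
by move=> z _; rewrite hornerX.
Qed.

Lemma disc_algebraX f n : disc_algebra f -> disc_algebra (fun z => f z ^+ n).
Proof.
move=> af; elim: n => [|n IH].
  apply: (@eq_disc_algebra (fun=> 1)); last exact: disc_algebra_cst.
  by move=> z _; rewrite expr0.
apply: (@eq_disc_algebra (fun z => f z * f z ^+ n)); last exact: disc_algebraM.
by move=> z _; rewrite exprS.
Qed.

Lemma disc_algebra_sum I (s : seq I) (h : I -> R[i] -> R[i]) :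
  (forall i, disc_algebra (h i)) -> disc_algebra (fun z => \sum_(i <- s) h i z).
Proof.
move=> mh; elim: s => [|i s IH].
  apply: (@eq_disc_algebra (fun=> 0)); last exact: disc_algebra_cst.
  by move=> z _; rewrite big_nil.
apply: (@eq_disc_algebra (fun z => h i z + \sum_(i <- s) h i z)); last exact: disc_algebraD.
by move=> z _; rewrite big_cons.
Qed.

Lemma disc_algebra_horner f q : disc_algebra f -> disc_algebra (fun z => q.[f z]).
Proof.
move=> af; apply: (@eq_disc_algebra (fun z => \sum_(i < size q) q`_i * f z ^+ i)).
  by move=> z _; rewrite horner_coef.
apply: disc_algebra_sum => i; apply: disc_algebraM; first exact: disc_algebra_cst.
exact: disc_algebraX.
Qed.

Lemma uniform_limit_disc_algebra g :
  (forall e : R, 0 < e -> exists2 f, disc_algebra f &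
     forall z, normc z <= 1 -> normc (g z - f z) <= e) ->
  disc_algebra g.
Proof.
move=> H e e0; have e20 : 0 < e / 2 by rewrite divr_gt0.
have [f af gf] := H _ e20; have [q fq] := af _ e20.
exists q => z z1; rewrite -(subrK (f z) (g z)) -addrA.
by apply: le_trans (ler_normcD _ _) _; rewrite [leRHS]splitr lerD ?gf ?fq.
Qed.

Lemma geometric_small (x e : R) : 0 <= x < 1 -> 0 < e -> exists N, x ^+ N <= e.
Proof.
move=> /andP[x0 x1] e0.
have cv : (fun m => x ^+ m) @ \oo --> (0 : R) by apply: cvg_expr; rewrite ger0_norm.
have /cvgr0Pnorm_le /(_ _ e0) [N _ hN] := cv.
by exists N; have := hN N (leqnn N); rewrite /= ger0_norm// exprn_ge0.
Qed.

Lemma disc_algebra_cauchy (a : R[i]) : normc a < 1 ->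
  disc_algebra (fun z => (1 - a * z)^-1).
Proof.
move=> a1; apply: uniform_limit_disc_algebra => e e0.
have a10 : 0 < 1 - normc a by rewrite subr_gt0.
have [N hN] : exists N, normc a ^+ N <= e * (1 - normc a).
  by apply: geometric_small; rewrite ?normc_ge0// mulr_gt0.
exists (fun z => \sum_(i < N) (a * z) ^+ i).
  apply: disc_algebra_sum => i; apply: disc_algebraX; apply: disc_algebraM.
    exact: disc_algebra_cst.
  exact: disc_algebra_id.
move=> z z1; have ne0 := cauchy_denominator_neq0 a1 z1.
have -> : (1 - a * z)^-1 - \sum_(i < N) (a * z) ^+ i = (a * z) ^+ N / (1 - a * z).
  have S : (1 - a * z) * \sum_(i < N) (a * z) ^+ i = 1 - (a * z) ^+ N.
    by apply: oppr_inj; rewrite -mulNr !opprB -subrX1.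
  by apply: (mulfI ne0); rewrite mulrBr divff// S mulrCA divff// mulr1 subKr.
rewrite Normc.normcM normcX Normc.normcM.
apply: (@le_trans _ _ (normc a ^+ N * (1 - normc a)^-1)); last first.
  by rewrite ler_pdivrMr.
rewrite ler_pM ?exprn_ge0 ?mulr_ge0 ?normc_ge0 ?normc_cauchy_le//.
by rewrite lerXn2r ?nnegrE ?mulr_ge0 ?normc_ge0// ler_piMr// normc_ge0.
Qed.

End DiscAlgebra.

Section MeanValueInequalities.
Context {R : realType}.
Implicit Types (g : R[i] -> R[i]) (p r : R) (w : R[i]).

Lemma poisson_horner_le w (q : {poly R[i]}) : normc w < 1 ->
  normc q.[w] <= \int[circ]_x (normc q.[cis x] * poisson w x).
Proof.
move=> w1; have [M M0 qM] := horner_bound q.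
have mq : cmeasurable setT (fun x => q.[cis x]).
  by apply: cmeasurable_horner; exact: cmeasurable_cis.
have mf : cmeasurable setT (fun x => (poisson w x)%:C%C * q.[cis x]).
  by apply: cmeasurableM => //; exact: cmeasurable_real (measurable_poisson w).
have bf x : normc ((poisson w x)%:C%C * q.[cis x]) <= 2 / (1 - normc w) * M.
  by rewrite Normc.normcM normcR ler_pM ?normc_ge0 ?normr_poisson_le ?qM ?normc_cis.
rewrite -(cint_poisson_horner q w1).
apply: le_trans (normc_cint_le _ _ _) _ => //.
- by apply: cintegrable_circ bf.
- apply: (@integrable_circ _ _ (2 / (1 - normc w) * M)).
    exact: measurable_normc.
  by move=> x; rewrite ger0_norm ?normc_ge0.
- rewrite le_eqVlt; apply/orP; left; apply/eqP; apply: eq_Rintegral => x _.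
  by rewrite Normc.normcM normcR ger0_norm ?poisson_ge0// mulrC.
Qed.

Lemma poisson_disc_algebra_le w g : normc w < 1 -> disc_algebra g ->
  cmeasurable setT (fun x => g (cis x)) ->
  normc (g w) <= \int[circ]_x (normc (g (cis x)) * poisson w x).
Proof.
move=> w1 ag mg; have [M M0 gM] := disc_algebra_bound ag.
apply/ler_addgt0Pr => e e0; have e20 : 0 < e / 2 by rewrite divr_gt0.
have [q gq] := ag _ e20; have [N N0 qN] := horner_bound q.
have mq : cmeasurable setT (fun x => q.[cis x]).
  by apply: cmeasurable_horner; exact: cmeasurable_cis.
have c1 (x : R) : normc (cis x) <= 1 by rewrite normc_cis.
have igP : circ.-integrable setT (fun x => (normc (g (cis x)) * poisson w x)%:E).
  apply: (@integrable_circ _ _ (M * (2 / (1 - normc w)))).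
    by apply: measurable_funM; [exact: measurable_normc|exact: measurable_poisson].
  by move=> x; rewrite normrM ler_pM ?normr_poisson_le// ger0_norm ?normc_ge0 ?gM.
have iqP : circ.-integrable setT (fun x => (normc q.[cis x] * poisson w x)%:E).
  apply: (@integrable_circ _ _ (N * (2 / (1 - normc w)))).
    by apply: measurable_funM; [exact: measurable_normc|exact: measurable_poisson].
  by move=> x; rewrite normrM ler_pM ?normr_poisson_le// ger0_norm ?normc_ge0 ?qN.
have iP := integrable_poisson w1.
have -> : \int[circ]_x (normc (g (cis x)) * poisson w x) + e =
    \int[circ]_x (normc (g (cis x)) * poisson w x + e / 2 * poisson w x) + e / 2.
  rewrite RintegralD//; last exact: eq_integrable (integrableZl measurableT (e / 2) iP).
  by rewrite RintegralZl// mean_poisson// mulr1 -addrA -splitr.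
rewrite -(subrK q.[w] (g w)) addrC; apply: le_trans (ler_normcD _ _) _.
apply: lerD; last by rewrite gq// ltW.
apply: le_trans (poisson_horner_le q w1) _.
apply: le_Rintegral => //.
  apply: eq_integrable (integrableD measurableT igP (integrableZl measurableT (e / 2) iP)) => // x _.
move=> x _; rewrite -mulrDl ler_wpM2r ?poisson_ge0//.
rewrite -(subrK (g (cis x)) q.[cis x]) addrC.
by apply: le_trans (ler_normcD _ _) _; rewrite lerD2l normcBC gq.
Qed.

(** Subharmonicity of the [p]-th power of the modulus: Jensen's inequality for the
    Poisson kernel, which is a probability density. *)
Lemma poisson_powR_le p w g : 1 <= p -> normc w < 1 -> disc_algebra g ->
  cmeasurable setT (fun x => g (cis x)) ->
  ((normc (g w) `^ p)%:E <=
    \int[circ]_x (normc (g (cis x)) `^ p * poisson w x)%:E)%E.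
Proof.
move=> p1 w1 ag mg; have [M M0 gM] := disc_algebra_bound ag.
have p0 : 0 <= p by apply: le_trans p1.
have igP : circ.-integrable setT (fun x => (normc (g (cis x)) * poisson w x)%:E).
  apply: (@integrable_circ _ _ (M * (2 / (1 - normc w)))).
    by apply: measurable_funM; [exact: measurable_normc|exact: measurable_poisson].
  move=> x; rewrite normrM ler_pM ?normr_poisson_le// ger0_norm ?normc_ge0 ?gM//.
  by rewrite normc_cis.
have := @weighted_jensen R _ _ circ setT p 1 (poisson w) (fun x => normc (g (cis x))).
rewrite powR1 mul1e => J; apply: le_trans (J _ _ _ _ _ _ _ _ _) => //.
- rewrite lee_fin ge0_ler_powR ?nnegrE ?normc_ge0//; last exact: poisson_disc_algebra_le.
  by apply: Rintegral_ge0 => x _; rewrite mulr_ge0 ?normc_ge0 ?poisson_ge0.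
- exact: measurable_normc.
- by move=> x _; exact: normc_ge0.
- by move=> x _; exact: poisson_ge0.
- exact: integrable_poisson.
- by rewrite mean_poisson.
Qed.

Lemma poisson_sym (r x y : R) : 0 <= r ->
  poisson (circle_pt r x) y = poisson (circle_pt r y) x.
Proof.
move=> r0; rewrite /poisson !normc_circle_pt; congr (_ / _ ^+ 2).
apply/eqP; rewrite -(@eqrXn2 _ 2) ?normc_ge0// !sqr_normcE /circle_pt /=.
apply/eqP; have := cos2Dsin2 x; have := cos2Dsin2 y.
move: (cos x) (sin x) (cos y) (sin y) => c s c' s' e e'.
rewrite (_ : (c' - r * c) ^+ 2 + (s' - r * s) ^+ 2 =
  (c' ^+ 2 + s' ^+ 2) + r ^+ 2 * (c ^+ 2 + s ^+ 2) - 2 * r * (c * c' + s * s')); last by ring.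
rewrite (_ : (c - r * c') ^+ 2 + (s - r * s') ^+ 2 =
  (c ^+ 2 + s ^+ 2) + r ^+ 2 * (c' ^+ 2 + s' ^+ 2) - 2 * r * (c * c' + s * s')); last by ring.
by rewrite e e'.
Qed.

(** The previous inequality is integrated along the inner circle; the Poisson
    kernel is symmetric in the two angles and has mean [1]. *)
Lemma mean_radius_le p r g : 1 <= p -> 0 <= r < 1 -> disc_algebra g ->
  cmeasurable setT (fun x => g (cis x)) ->
  cmeasurable setT (fun x => g (circle_pt r x)) ->
  (\int[circ]_x (normc (g (circle_pt r x)) `^ p)%:E <=
   \int[circ]_x (normc (g (cis x)) `^ p)%:E)%E.
Proof.
move=> p1 /andP[r0 r1] ag mg mgr.
have w1 x : normc (circle_pt r x) < 1 by rewrite normc_circle_pt ger0_norm.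
pose F (z : measurableTypeR R * measurableTypeR R) :=
  (normc (g (cis z.2)) `^ p * poisson (circle_pt r z.1) z.2)%:E.
have mF : measurable_fun setT F.
  apply/measurable_EFinP; apply: measurable_funM.
    apply: (measurableT_comp (f := fun x => normc (g (cis x)) `^ p)) => //.
    exact: measurable_normc_powR.
  apply: measurable_funM.
    apply: measurable_funB => //; apply: measurable_funX; apply: measurable_normc.
    by apply: cmeasurable_comp => //; exact: cmeasurable_circle_pt.
  apply: measurable_fun_inv; apply: measurable_funX; apply: measurable_normc.
  apply: cmeasurableB.
    by apply: cmeasurable_comp => //; exact: cmeasurable_cis.
  by apply: cmeasurable_comp => //; exact: cmeasurable_circle_pt.
have F0 z : (0 <= F z)%E.
  by rewrite lee_fin mulr_ge0 ?powR_ge0 ?poisson_ge0.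
apply: (@le_trans _ _ (\int[circ]_x \int[circ]_y F (x, y))%E).
  apply: ge0_le_integral => //.
  - by move=> x _; rewrite lee_fin powR_ge0.
  - exact/measurable_EFinP/measurable_normc_powR.
  - exact: measurable_fun_fubini_tonelli_F.
  - by move=> x _; rewrite /F /=; exact: (poisson_powR_le p1 (w1 x) ag mg).
rewrite fubini_tonelli//; apply: ge0_le_integral => //.
- by move=> x _; exact: integral_ge0.
- exact: measurable_fun_fubini_tonelli_G.
- exact/measurable_EFinP/measurable_normc_powR.
move=> y _; rewrite /F /=.
under eq_integral do rewrite EFinM poisson_sym//.
rewrite ge0_integralZl//; last 3 first.
- by apply/measurable_EFinP; exact: measurable_poisson.
- by move=> x _; rewrite lee_fin poisson_ge0.
- by rewrite lee_fin powR_ge0.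
have <- : (\int[circ]_x poisson (circle_pt r y) x)%:E =
    (\int[circ]_x (poisson (circle_pt r y) x)%:E)%E.
  by rewrite /Rintegral fineK//; exact: integrable_fin_num (integrable_poisson _).
by rewrite mean_poisson// mule1.
Qed.

(** Up to a factor the integrand is a Poisson kernel. *)
Lemma integral_inv_sqr (A B : R[i]) : normc B < normc A ->
  (\int[circ]_x ((normc (A - B * cis x) ^+ 2)^-1)%:E =
   ((normc A ^+ 2 - normc B ^+ 2)^-1)%:E)%E.
Proof.
move=> BA; have nA : 0 < normc A by apply: le_lt_trans BA; exact: normc_ge0.
have A0 : A != 0 by rewrite -normc_gt0.
pose w := (B / A)^*%C.
have w1 : normc w < 1.
  by rewrite normcJ Normc.normcM Normc.normcV ltr_pdivrMr// mul1r.
have nw : normc w = normc B / normc A by rewrite normcJ Normc.normcM Normc.normcV.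
have d0 : 0 < 1 - normc w ^+ 2 by rewrite subr_gt0 expr_lt1// normc_ge0.
under eq_integral => x _.
  rewrite (_ : (_ ^+ 2)^-1 = (normc A ^+ 2 * (1 - normc w ^+ 2))^-1 * poisson w x); last first.
    rewrite /poisson normc_cis_sub conjcK.
    have -> : A - B * cis x = A * (1 - B / A * cis x) by field.
    have u0 : normc (1 - B / A * cis x) != 0.
      rewrite normc_eq0 cauchy_denominator_neq0 ?normc_cis//.
      by rewrite -normcJ.
    rewrite Normc.normcM; move: u0 (lt0r_neq0 nA) (lt0r_neq0 d0).
    move: (normc (1 - _)) (normc A) (1 - normc w ^+ 2) => u a d u0 a0 d0'.
    by field; rewrite u0 a0 d0'.
  rewrite EFinM.
  over.
rewrite ge0_integralZl//; last 3 first.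
- by apply/measurable_EFinP; exact: measurable_poisson.
- by move=> x _; rewrite lee_fin poisson_ge0.
- by rewrite lee_fin invr_ge0 mulr_ge0 ?sqr_ge0// ltW.
have <- : (\int[circ]_x poisson w x)%:E = (\int[circ]_x (poisson w x)%:E)%E.
  by rewrite /Rintegral fineK//; exact: integrable_fin_num (integrable_poisson _).
rewrite mean_poisson// mule1; congr (_^-1)%:E.
by rewrite nw mulrBr mulr1 exprMn mulrCA -exprMn divff ?gt_eqF// expr1n mulr1.
Qed.

End MeanValueInequalities.

(** * Logarithms and powers on the right half-plane *)

Section ComplexExponential.
Context {R : realType}.
Implicit Types (z w : R[i]) (x y s : R).

Definition cexp z : R[i] := (expR (Re z))%:C%C * cis (Im z).

(** The principal logarithm, on the right half-plane. *)
Definition clog z : R[i] := (ln (normc z) +i* atan (Im z / Re z))%C.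

Definition cpow z s : R[i] := cexp (s%:C%C * clog z).

Lemma ReZ s z : Re (s%:C%C * z) = s * Re z.
Proof. by rewrite ReM /= mul0r subr0. Qed.

Lemma ImZ s z : Im (s%:C%C * z) = s * Im z.
Proof. by rewrite ImM /= mul0r addr0. Qed.

Lemma ReD z w : Re (z + w) = Re z + Re w.
Proof. by case: z; case: w. Qed.

Lemma ImD z w : Im (z + w) = Im z + Im w.
Proof. by case: z; case: w. Qed.

Lemma ReN z : Re (- z) = - Re z.
Proof. by case: z. Qed.

Lemma ImN z : Im (- z) = - Im z.
Proof. by case: z. Qed.

Lemma cexpD z w : cexp (z + w) = cexp z * cexp w.
Proof. by rewrite /cexp ReD ImD expRD cisD rmorphM /= mulrACA. Qed.

Lemma cexp0 : cexp 0 = 1.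
Proof. by rewrite /cexp /= expR0 cis0 mulr1. Qed.

Lemma normc_cexp z : normc (cexp z) = expR (Re z).
Proof. by rewrite Normc.normcM normc_cis normcR mulr1 ger0_norm// expR_ge0. Qed.

Lemma cexpM_natl n z : cexp (n%:R * z) = cexp z ^+ n.
Proof.
elim: n => [|n IH]; first by rewrite mul0r cexp0.
by rewrite exprS -IH -cexpD -natr1 mulrDl mul1r addrC.
Qed.

Lemma cis_atan x : cis (atan x) = (Num.sqrt (1 + x ^+ 2))^-1%:C%C * (1 +i* x)%C.
Proof.
rewrite /cis; have c := cos_atan x.
have c0 : cos (atan x) != 0 by rewrite c invr_eq0 gt_eqF// sqrtr_gt0 ltr_wpDr// sqr_ge0.
have -> : sin (atan x) = x * cos (atan x).
  by rewrite -[in X in _ = X * _](atanK x) /tan divfK.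
by apply: eqcP; rewrite ?ReM ?ImM /= c; ring.
Qed.

Lemma Im_clog z : Im (clog z) = atan (Im z / Re z).
Proof. by []. Qed.

Lemma cexp_clog z : 0 < Re z -> cexp (clog z) = z.
Proof.
case: z => a b /= a0; rewrite /cexp /= cis_atan lnK; last first.
  by rewrite posrE sqrtr_gt0 ltr_pwDl ?exprn_gt0// sqr_ge0.
have -> : 1 + (b / a) ^+ 2 = (a ^+ 2 + b ^+ 2) / a ^+ 2 by field; rewrite gt_eqF.
have s0 : Num.sqrt (a ^+ 2 + b ^+ 2) != 0.
  by rewrite gt_eqF// sqrtr_gt0 ltr_pwDl ?exprn_gt0// sqr_ge0.
rewrite sqrtrM ?addr_ge0 ?sqr_ge0// sqrtrV ?sqr_ge0// sqrtr_sqr gtr0_norm//.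
rewrite invfM invrK mulrA -rmorphM /= mulrA divff// mul1r.
by apply: eqcP => /=; field; rewrite gt_eqF.
Qed.

Lemma clog_neq0 z : 0 < Re z -> z != 0.
Proof. by move=> z0; apply: contraTneq z0 => ->; rewrite ltxx. Qed.

Lemma atan_tan_cis (t : R) : - (pi / 2) < t < pi / 2 -> atan (sin t / cos t) = t.
Proof. by move=> t2; rewrite -/(tan t) tanK// in_itv. Qed.

Lemma normr_Im_clog z : `|Im (clog z)| < pi / 2.
Proof. by rewrite /= ltr_norml atan_gtNpi2 atan_ltpi2. Qed.

Lemma Re_cexp z : Re (cexp z) = expR (Re z) * cos (Im z).
Proof. by rewrite ReM /= mul0r subr0. Qed.

Lemma Im_cexp z : Im (cexp z) = expR (Re z) * sin (Im z).
Proof. by rewrite ImM /= mul0r addr0. Qed.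

Lemma clog_cexp z : `|Im z| < pi / 2 -> clog (cexp z) = z.
Proof.
rewrite ltr_norml => zi; apply: eqcP; rewrite /clog.
  by rewrite -[LHS]/(ln (normc (cexp z))) normc_cexp expRK.
rewrite -[LHS]/(atan (Im (cexp z) / Re (cexp z))) Re_cexp Im_cexp -mulf_div divff ?mul1r ?atan_tan_cis//.
by rewrite gt_eqF// expR_gt0.
Qed.

Lemma normr_Im_clog_add z w : 0 < Re z -> 0 < Re w -> 0 <= Re (z * w) ->
  `|Im (clog z) + Im (clog w)| <= pi / 2.
Proof.
move=> z0 w0 zw0; rewrite leNgt; apply/negP => big.
have tw : `|Im (clog z) + Im (clog w)| < pi.
  apply: le_lt_trans (ler_normD _ _) _.
  by rewrite [ltRHS]splitr ltrD// normr_Im_clog.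
move: zw0; rewrite -{1}(cexp_clog z0) -(cexp_clog w0) -cexpD Re_cexp ImD.
rewrite pmulr_rge0 ?expR_gt0//; apply/negP; rewrite -ltNge.
rewrite -cos_norm -[X in cos X](subrK pi) cosDpi oppr_lt0.
by apply: cos_gt0_pihalf; apply/andP; split; lra.
Qed.

Lemma clogM z w : 0 < Re z -> 0 < Re w -> 0 < Re (z * w) ->
  clog (z * w) = clog z + clog w.
Proof.
move=> z0 w0 zw0; rewrite -{1}(cexp_clog z0) -{1}(cexp_clog w0) -cexpD clog_cexp//.
rewrite ImD lt_neqAle normr_Im_clog_add ?ltW// andbT.
apply/negP => /eqP e.
move: zw0; rewrite -{1}(cexp_clog z0) -(cexp_clog w0) -cexpD Re_cexp ImD.
by rewrite -cos_norm e cos_pihalf mulr0 ltxx.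
Qed.

Lemma normc_cpow z s : z != 0 -> normc (cpow z s) = normc z `^ s.
Proof.
by move=> z0; rewrite normc_cexp ReZ /= /powR normc_eq0 (negbTE z0).
Qed.

End ComplexExponential.

Section ComplexExpMeasurable.
Context d (T : measurableType d) {R : realType}.
Implicit Types (D : set T) (f : T -> R[i]).

Lemma cmeasurable_clog D f : cmeasurable D f -> cmeasurable D (fun x => clog (f x)).
Proof.
move=> mf; split => /=.
  by apply: measurableT_comp; [exact: measurable_ln|exact: measurable_normc].
apply: (@measurableT_comp _ _ _ _ _ _ (@atan R)).
  by apply: continuous_measurable_fun; exact: continuous_atan.
case: mf => rf jf; apply: measurable_funM => //; exact: measurable_fun_inv.
Qed.

Lemma cmeasurable_cexp D f : cmeasurable D f -> cmeasurable D (fun x => cexp (f x)).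
Proof.
move=> [rf jf]; apply: cmeasurableM.
  by apply: cmeasurable_real; apply: measurableT_comp => //; exact: measurable_expR.
have [mc ms] := @cmeasurable_cis R.
by split; [apply: (measurableT_comp mc)|apply: (measurableT_comp ms)].
Qed.

Lemma cmeasurable_cpow D f (s : R) : cmeasurable D f ->
  cmeasurable D (fun x => cpow (f x) s).
Proof.
move=> mf; apply: cmeasurable_cexp; apply: cmeasurableM; last exact: cmeasurable_clog.
exact: cmeasurable_cst.
Qed.

End ComplexExpMeasurable.

Section UniformApproximation.
Context {R : realType}.
Implicit Types (x y : R).

Lemma is_derive_exprn n (x : R) : is_derive x 1 (fun y : R => y ^+ n) (n%:R * x ^+ n.-1).
Proof.
have H := is_deriveX n (is_derive_id x (1 : R)).
have e : (fun y : R => y ^+ n) = id ^+ n by apply/funext => y; rewrite exprfctE.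
by rewrite e; apply: (is_derive_eq H); rewrite /GRing.scale /= mulr1.
Qed.

Lemma derive_bound_le (f df : R -> R) (y K : R) :
  (forall x, `|x| <= `|y| -> is_derive x 1 f (df x)) ->
  (forall x, `|x| <= `|y| -> `|df x| <= K) -> `|f y - f 0| <= K * `|y|.
Proof.
move=> dF K0; have [->|yn0] := eqVneq y 0; first by rewrite subrr !normr0 mulr0.
have contf (a b : R) : (forall x, x \in `[a, b] -> `|x| <= `|y|) ->
    {within `[a, b], continuous f}.
  move=> ab; apply: derivable_within_continuous => x xab.
  by case: (dF x (ab x xab)).
have [y0|y0] := ltP 0 y.
  have sub x : x \in `[0, y] -> `|x| <= `|y|.
    by rewrite in_itv /= => /andP[x0 xy]; rewrite !ger0_norm ?(ltW y0).
  have [c|c cy ->] := @MVT _ f df 0 y y0 _ (contf _ _ sub).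
    by move=> cy; apply: dF; apply: sub; exact: subset_itv_oo_cc cy.
  rewrite subr0 normrM ler_wpM2r// K0// sub//; exact: subset_itv_oo_cc cy.
have {}y0 : y < 0 by rewrite lt_neqAle yn0.
have sub x : x \in `[y, 0] -> `|x| <= `|y|.
  by rewrite in_itv /= => /andP[x0 xy]; rewrite !ler0_norm ?(ltW y0)// lerN2.
have [c|c cy e] := @MVT _ f df y 0 y0 _ (contf _ _ sub).
  by move=> cy; apply: dF; apply: sub; exact: subset_itv_oo_cc cy.
rewrite distrC e sub0r normrM normrN ler_wpM2r// K0// sub//; exact: subset_itv_oo_cc cy.
Qed.

Lemma normr_sin_le y : `|sin y| <= `|y|.
Proof.
have := @derive_bound_le sin cos y 1 (fun x _ => is_derive_sin x).
rewrite sin0 subr0 mul1r; apply => x _.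
by rewrite ler_norml cos_geN1 cos_le1.
Qed.

Lemma normr_cosB1_le y : `|cos y - 1| <= y ^+ 2.
Proof.
have := @derive_bound_le cos (fun x => - sin x) y `|y| (fun x _ => is_derive_cos x).
rewrite cos0 -expr2 real_normK ?num_real//; apply => x xy.
by rewrite normrN; apply: le_trans (normr_sin_le x) xy.
Qed.

Lemma normr_sinB_le y : `|y| <= 1 -> `|sin y - y| <= y ^+ 2.
Proof.
move=> y1.
have dF x : is_derive x 1 (fun t => sin t - t) (cos x - 1).
  by apply: is_deriveB.
have := @derive_bound_le (fun t => sin t - t) (fun x => cos x - 1) y `|y| (fun x _ => dF x).
rewrite sin0 !subr0 -expr2 real_normK ?num_real//; apply => x xy.
apply: le_trans (normr_cosB1_le x) _; rewrite -real_normK ?num_real// expr2.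
by rewrite (le_trans _ xy)// ler_piMl// (le_trans xy).
Qed.

Lemma normr_expRB1_le x : `|x| <= 2^-1 -> `|expR x - 1 - x| <= 2 * x ^+ 2.
Proof.
rewrite ler_norml => /andP[x1 x2].
rewrite ger0_norm; last by rewrite -addrA -opprD subr_ge0 expR_ge1Dx.
have e : expR x * (1 - x) <= 1.
  by rewrite -ler_pdivlMl ?expR_gt0// mulr1 -expRN expR_ge1Dx.
have x0 : 0 < 1 - x by lra.
rewrite -(ler_pM2r x0) !mulrBl; move: (expR x * _) e => E e.
nra.
Qed.

Lemma cexp_approx1 (z : R[i]) : normc z <= 2^-1 ->
  normc (cexp z - 1 - z) <= 8 * normc z ^+ 2.
Proof.
move=> z1; have rz := le_trans (normr_Re_le z) z1.
have iz := le_trans (normr_Im_le z) z1.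
apply: le_trans (normc_le_ReIm _) _; rewrite sqr_normcE !ReD !ImD !ReN !ImN Re_cexp Im_cexp /=.
have := normr_expRB1_le rz.
have := normr_cosB1_le (Im z); have := normr_sinB_le (le_trans iz (ltW _)).
have := normr_sin_le (Im z).
move: (Re z) (Im z) rz iz => x y rz iz s1 /(_ ltac:(lra)) s2 c1 e1.
have eb : `|expR x - 1| <= 2 * `|x|.
  rewrite -[expR x - 1](subrK x); apply: le_trans (ler_normD _ _) _.
  have : 2 * x ^+ 2 <= `|x|.
    rewrite -real_normK ?num_real// expr2 mulrA ler_piMl//.
    by rewrite mulrC -ler_pdivlMr// mul1r.
  lra.
have e2 : expR x <= 2.
  move: eb; rewrite ler_norml => /andP[_]; lra.
have h1 : `|expR x * cos y - 1 - x| <= 2 * x ^+ 2 + 2 * y ^+ 2.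
  have -> : expR x * cos y - 1 - x = (expR x - 1 - x) + expR x * (cos y - 1) by ring.
  apply: le_trans (ler_normD _ _) _; rewrite lerD// normrM ger0_norm ?expR_ge0//.
  by rewrite ler_pM ?expR_ge0.
have h2 : `|expR x * sin y - 0 - y| <= 2 * `|x| * `|y| + y ^+ 2.
  have -> : expR x * sin y - 0 - y = (expR x - 1) * sin y + (sin y - y) by ring.
  apply: le_trans (ler_normD _ _) _; rewrite lerD// normrM.
  by rewrite ler_pM.
have h3 : 2 * `|x| * `|y| <= x ^+ 2 + y ^+ 2.
  have := sqr_ge0 (`|x| - `|y|).
  by rewrite sqrrB !real_normK ?num_real// -mulr_natl; lra.
have := sqr_ge0 x; have := sqr_ge0 y; lra.
Qed.

Lemma normc_exprB_le (a b : R[i]) (K : R) n : normc a <= K -> normc b <= K ->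
  normc (a ^+ n - b ^+ n) <= n%:R * K ^+ n.-1 * normc (a - b).
Proof.
move=> aK bK; have K0 : 0 <= K by apply: le_trans aK; exact: normc_ge0.
rewrite subrXX Normc.normcM mulrC ler_wpM2r ?normc_ge0//.
case: n => [|n]; first by rewrite big_ord0 Normc.normc0 !mul0r.
have -> : n.+1%:R * K ^+ n.+1.-1 = \sum_(i < n.+1) K ^+ n.
  by rewrite sumr_const card_ord mulr_natl.
elim/big_ind2: _ => [|u v u' v' uv uv'|i _]; first by rewrite Normc.normc0.
  by apply: le_trans (ler_normcD _ _) _; exact: lerD.
rewrite Normc.normcM !normcX /= (_ : K ^+ n = K ^+ (n - i) * K ^+ i); last first.
  by rewrite -exprD subnK// -ltnS.
by rewrite ler_pM ?exprn_ge0 ?normc_ge0// lerXn2r// nnegrE ?normc_ge0.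
Qed.

(** Euler's limit [(1 + g / m) ^ m], uniformly on the disc. *)
Lemma disc_algebra_cexp (g : R[i] -> R[i]) : disc_algebra g ->
  disc_algebra (fun z => cexp (g z)).
Proof.
move=> ag; have [M M0 gM] := disc_algebra_bound ag.
apply: uniform_limit_disc_algebra => e e0.
pose m := (Num.truncn (2 * M + 8 * M ^+ 2 * expR M / e)).+1.
have hm : 2 * M + 8 * M ^+ 2 * expR M / e <= m%:R.
  by apply: ltW; exact: truncnS_gt.
have b0 : 0 <= 8 * M ^+ 2 * expR M / e.
  by rewrite divr_ge0 ?mulr_ge0 ?expR_ge0 ?exprn_ge0// ltW.
have m0 : 0 < m%:R :> R by rewrite ltr0n.
have hm1 : M / m%:R <= 2^-1 by rewrite ler_pdivrMr//; lra.
have hm2 : 8 * M ^+ 2 * expR M / m%:R <= e.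
  rewrite ler_pdivrMr// [e * _]mulrC -ler_pdivrMr//; lra.
exists (fun z => (1 + m%:R^-1%:C%C * g z) ^+ m).
  apply: disc_algebraX; apply: disc_algebraD; first exact: disc_algebra_cst.
  by apply: disc_algebraM => //; exact: disc_algebra_cst.
move=> z z1; set h := m%:R^-1%:C%C * g z.
have nh : normc h <= M / m%:R.
  by rewrite Normc.normcM normcR ger0_norm ?invr_ge0 ?(ltW m0)// mulrC
    ler_pM2r ?invr_gt0// gM.
have -> : cexp (g z) = cexp h ^+ m.
  rewrite -cexpM_natl /h mulrA.
  have -> : m%:R = (m%:R : R)%:C%C by rewrite rmorph_nat.
  by rewrite -rmorphM /= divff ?gt_eqF// mul1r.
have K1 : normc (cexp h) <= expR (M / m%:R).
  by rewrite normc_cexp ler_expR; apply: le_trans (Re_le_normc _) nh.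
have K2 : normc (1 + h) <= expR (M / m%:R).
  apply: le_trans (ler_normcD _ _) _; rewrite Normc.normc1.
  by apply: le_trans (expR_ge1Dx _); rewrite lerD2l.
apply: le_trans (normc_exprB_le _ K1 K2) _.
have -> : cexp h - (1 + h) = cexp h - 1 - h by ring.
apply: le_trans (ler_wpM2l _ (cexp_approx1 (le_trans nh hm1))) _.
  by rewrite mulr_ge0 ?exprn_ge0 ?expR_ge0.
have h2 : normc h ^+ 2 <= (M / m%:R) ^+ 2.
  by rewrite lerXn2r// nnegrE ?normc_ge0// divr_ge0 1?ltW.
have eM : expR (M / m%:R) ^+ m.-1 <= expR M.
  apply: (@le_trans _ _ (expR (M / m%:R) ^+ m)).
    by rewrite ler_eXn2l// ?leq_pred// expR_gt1 divr_gt0.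
  by rewrite -expRM_natl mulrCA divff ?gt_eqF// mulr1.
apply: le_trans hm2.
have -> : 8 * M ^+ 2 * expR M / m%:R = m%:R * expR M * (8 * (M / m%:R) ^+ 2).
  by field; rewrite gt_eqF.
apply: ler_pM; rewrite ?mulr_ge0 ?exprn_ge0 ?expR_ge0 ?normc_ge0//.
  by rewrite ler_pM2l.
by rewrite ler_pM2l.
Qed.

(** Along the segment from [0] to [w], the logarithm and the partial sums of its
    Taylor series have derivatives that differ by the tail of a geometric
    series. *)
Lemma clog_taylor (w : R[i]) (rho : R) N : normc w <= rho -> rho < 1 ->
  normc (clog (1 - w) + \sum_(n < N) n.+1%:R^-1%:C%C * w ^+ n.+1) <=
    2 * (rho ^+ N / (1 - rho)).
Proof.
move=> wr r1; have r0 : 0 <= rho by apply: le_trans wr; exact: normc_ge0.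
have r10 : 0 < 1 - rho by rewrite subr_gt0.
case: w wr => a b wr.
pose w : R[i] := (a +i* b)%C; rewrite -/w in wr *.
pose u x := 1 - x%:C%C * w.
have Reu x : Re (u x) = 1 - x * a by rewrite /u /=; ring.
have Imu x : Im (u x) = - x * b by rewrite /u /=; ring.
have nxw x : `|x| <= 1 -> normc (x%:C%C * w) <= rho.
  move=> x1; rewrite Normc.normcM normcR; apply: le_trans wr.
  by rewrite ler_piMl ?normc_ge0.
have nu x : `|x| <= 1 -> 1 - rho <= normc (u x).
  move=> x1; apply: le_trans (lerB_normc _ _); rewrite Normc.normc1.
  by rewrite lerD2l lerN2 nxw.
have Reu0 x : `|x| <= 1 -> 0 < 1 - x * a.
  move=> x1; rewrite subr_gt0; apply: le_lt_trans r1; apply: le_trans (nxw _ x1).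
  by rewrite -[x * a](_ : Re (x%:C%C * w) = _) ?Re_le_normc//= mul0r subr0.
pose S x := \sum_(n < N) n.+1%:R^-1%:C%C * (x%:C%C * w) ^+ n.+1.
pose D x := - (w / u x) + \sum_(n < N) x%:C%C ^+ n * w ^+ n.+1.
have Dle x : `|x| <= 1 -> normc (D x) <= rho ^+ N / (1 - rho).
  move=> x1; have u0 : u x != 0.
    by rewrite -normc_gt0; apply: lt_le_trans (nu _ x1).
  have -> : D x = - (w * (x%:C%C * w) ^+ N / u x).
    have geo : (1 - x%:C%C * w) * (\sum_(n < N) (x%:C%C * w) ^+ n) = 1 - (x%:C%C * w) ^+ N.
      by apply: oppr_inj; rewrite -mulNr !opprB -subrX1.
    have -> : D x = - (w / u x) + w * \sum_(n < N) (x%:C%C * w) ^+ n.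
      rewrite /D mulr_sumr; congr (_ + _); apply: eq_bigr => n _.
      by rewrite exprMn exprS; ring.
    apply: (mulfI u0); rewrite mulrDr 2!mulrN ![u x * (_ / u x)]mulrC !divfK//.
    by rewrite mulrCA /u geo; ring.
  rewrite normcN !Normc.normcM normcX Normc.normcV.
  apply: ler_pM; rewrite ?mulr_ge0 ?exprn_ge0 ?invr_ge0 ?normc_ge0//.
    rewrite -[leRHS]mul1r; apply: ler_pM; rewrite ?exprn_ge0 ?normc_ge0//.
      by rewrite (le_trans wr)// ltW.
    by rewrite lerXn2r ?nnegrE ?normc_ge0// nxw.
  by rewrite lef_pV2 ?posrE ?nu//; apply: lt_le_trans (nu _ x1).
have dmono (k : nat) (c x : R) :
    is_derive x 1 (fun y => c * (k.+1%:R^-1 * y ^+ k.+1)) (c * x ^+ k).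
  have H := is_deriveZ c (is_deriveZ k.+1%:R^-1 (is_derive_exprn k.+1 x)).
  apply: (is_derive_eq H); rewrite /GRing.scale /=; congr (_ * _).
  by rewrite mulrA mulVf ?mul1r// pnatr_eq0.
have dsum m (c : nat -> R) x :
    is_derive x 1 (fun y => \sum_(n < m) c n * (n.+1%:R^-1 * y ^+ n.+1))
      (\sum_(n < m) c n * x ^+ n).
  elim: m => [|k IH].
    by rewrite big_ord0; under eq_fun do rewrite big_ord0; exact: is_derive_cst.
  rewrite big_ord_recr /=; under eq_fun do rewrite big_ord_recr /=.
  by apply: is_deriveD.
have ReS x : Re (S x) = \sum_(n < N) Re (w ^+ n.+1) * (n.+1%:R^-1 * x ^+ n.+1).
  rewrite /S (big_morph _ (@ReD R) (erefl : Re 0 = 0)); apply: eq_bigr => n _.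
  by rewrite ReZ exprMn -rmorphXn /= ReZ; ring.
have ImS x : Im (S x) = \sum_(n < N) Im (w ^+ n.+1) * (n.+1%:R^-1 * x ^+ n.+1).
  rewrite /S (big_morph _ (@ImD R) (erefl : Im 0 = 0)); apply: eq_bigr => n _.
  by rewrite ImZ exprMn -rmorphXn /= ImZ; ring.
have ReSD x : Re (\sum_(n < N) x%:C%C ^+ n * w ^+ n.+1) = \sum_(n < N) Re (w ^+ n.+1) * x ^+ n.
  rewrite (big_morph _ (@ReD R) (erefl : Re 0 = 0)); apply: eq_bigr => n _.
  by rewrite -rmorphXn /= ReZ mulrC.
have ImSD x : Im (\sum_(n < N) x%:C%C ^+ n * w ^+ n.+1) = \sum_(n < N) Im (w ^+ n.+1) * x ^+ n.
  rewrite (big_morph _ (@ImD R) (erefl : Im 0 = 0)); apply: eq_bigr => n _.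
  by rewrite -rmorphXn /= ImZ mulrC.
pose F x := clog (u x) + S x.
have lin (c x : R) : is_derive x 1 (fun y => 1 - y * c) (- c).
  have := is_deriveB (is_derive_cst (1 : R) x 1) (is_deriveZ c (is_derive_id x (1 : R))).
  move=> H; have e : (fun y : R => 1 - y * c) = cst 1 - c \*: id.
    by apply/funext => y; rewrite /= fctE /GRing.scale /= mulrC.
  by rewrite e; apply: (is_derive_eq H); rewrite /GRing.scale /= mulr1 sub0r.
have dRe x : `|x| <= 1 -> is_derive x 1 (fun y => Re (F y)) (Re (D x)).
  move=> x1.
  pose q y := (1 - y * a) ^+ 2 + b ^+ 2 * y ^+ 2.
  have qE y : normc (u y) ^+ 2 = q y by rewrite sqr_normcE Reu Imu /q; ring.
  have q0 : 0 < q x by rewrite -qE exprn_gt0//; apply: lt_le_trans (nu _ x1).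
  have eF : (fun y => Re (F y)) = (fun y => 2^-1 * ln (q y) +
      \sum_(n < N) Re (w ^+ n.+1) * (n.+1%:R^-1 * y ^+ n.+1)).
    apply/funext => y; rewrite /F ReD ReS /= -qE -[in RHS]powR_mulrn ?normc_ge0//.
    by rewrite ln_powR mulrA mulVf ?mul1r// pnatr_eq0.
  have dq : is_derive x 1 q (2 * (1 - x * a) * - a + b ^+ 2 * (2 * x)).
    have := is_deriveD (@is_derive1_comp R (fun y => y ^+ 2) (fun y => 1 - y * a) x _ _
        (is_derive_exprn 2 _) (lin a x)) (is_deriveZ (b ^+ 2) (is_derive_exprn 2 x)).
    move=> H; apply: (is_derive_eq H); rewrite /GRing.scale /=; ring.
  have dl := is_deriveZ 2^-1 (is_derive1_comp (is_derive1_ln q0) dq).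
  rewrite eF; have H := is_deriveD dl (dsum N (fun n => Re (w ^+ n.+1)) x).
  apply: (is_derive_eq H); rewrite /D ReD ReSD; congr (_ + _).
  rewrite ReN ReM ReV ImV Reu Imu qE /GRing.scale /=.
  by field; rewrite gt_eqF.
have dIm x : `|x| <= 1 -> is_derive x 1 (fun y => Im (F y)) (Im (D x)).
  move=> x1.
  pose q y := (- b * y) / (1 - y * a).
  have eF : (fun y => Im (F y)) = (fun y => atan (q y) +
      \sum_(n < N) Im (w ^+ n.+1) * (n.+1%:R^-1 * y ^+ n.+1)).
    by apply/funext => y; rewrite /F ImD ImS Im_clog Reu Imu /q !mulNr [b * y]mulrC.
  have v0 := lt0r_neq0 (Reu0 x x1).
  have dq : is_derive x 1 q (- b / (1 - x * a) ^+ 2).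
    have := is_deriveM (is_deriveZ (- b) (is_derive_id x (1 : R))) (@is_deriveV R (fun y => 1 - y * a) x _ _ v0 (lin a x)).
    move=> H; apply: (is_derive_eq H); rewrite /GRing.scale /= -[_ *: _]/(- b * x).
    by field.
  have dl := is_derive1_comp (is_derive1_atan (q x)) dq.
  rewrite eF; have H := is_deriveD dl (dsum N (fun n => Im (w ^+ n.+1)) x).
  apply: (is_derive_eq H); rewrite /D ImD ImSD; congr (_ + _).
  have q2 : normc (u x) ^+ 2 = (1 - x * a) ^+ 2 + (b * x) ^+ 2.
    by rewrite sqr_normcE Reu Imu; ring.
  have q0 : normc (u x) ^+ 2 != 0.
    by rewrite expf_neq0// gt_eqF//; apply: lt_le_trans (nu _ x1).
  rewrite ImN ImM ReV ImV Reu Imu q2 /q /=; rewrite q2 in q0.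
  have -> : 1 + (- b * x / (1 - x * a)) ^+ 2 = ((1 - x * a) ^+ 2 + (b * x) ^+ 2) / (1 - x * a) ^+ 2.
    by field.
  by field; rewrite q0 v0.
have F0 : F 0 = 0.
  rewrite /F /S /u mul0r subr0 big1 ?addr0; last first.
    by move=> n _; rewrite expr0n mulr0.
  by rewrite /clog Normc.normc1 ln1 /= mul0r atan0.
have -> : clog (1 - w) + \sum_(n < N) n.+1%:R^-1%:C%C * w ^+ n.+1 = F 1.
  by rewrite /F /S /u mul1r.
have b1 := @derive_bound_le _ _ 1 (rho ^+ N / (1 - rho))
  (fun x h => dRe x (le_trans h (eq_ind_r (fun t => t <= 1) (lexx _) (normr1 R)))).
have b2 := @derive_bound_le _ _ 1 (rho ^+ N / (1 - rho))
  (fun x h => dIm x (le_trans h (eq_ind_r (fun t => t <= 1) (lexx _) (normr1 R)))).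
apply: le_trans (normc_le_ReIm _) _; rewrite mulr_natl mulr2n; apply: lerD.
  move: b1; rewrite F0 subr0 normr1 mulr1; apply => x x1.
  by apply: le_trans (normr_Re_le _) (Dle _ x1).
move: b2; rewrite F0 subr0 normr1 mulr1; apply => x x1.
by apply: le_trans (normr_Im_le _) (Dle _ x1).
Qed.

Lemma disc_algebra_clog (rho : R) : 0 <= rho < 1 ->
  disc_algebra (fun z => clog (1 - rho%:C%C * z)).
Proof.
move=> /andP[r0 r1]; apply: uniform_limit_disc_algebra => e e0.
have r10 : 0 < 1 - rho by rewrite subr_gt0.
have [N hN] : exists N, rho ^+ N <= e / 2 * (1 - rho).
  by apply: geometric_small; rewrite ?r0// mulr_gt0// divr_gt0.
exists (fun z => - \sum_(n < N) n.+1%:R^-1%:C%C * (rho%:C%C * z) ^+ n.+1).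
  apply: (@eq_disc_algebra _ (fun z => -1 * \sum_(n < N) n.+1%:R^-1%:C%C * (rho%:C%C * z) ^+ n.+1)).
    by move=> z _; rewrite mulN1r.
  apply: disc_algebraM; first exact: disc_algebra_cst.
  apply: disc_algebra_sum => n; apply: disc_algebraM; first exact: disc_algebra_cst.
  apply: disc_algebraX; apply: disc_algebraM; first exact: disc_algebra_cst.
  exact: disc_algebra_id.
move=> z z1; rewrite opprK; apply: le_trans (@clog_taylor _ rho N _ r1) _.
  by rewrite Normc.normcM normcR ger0_norm// ler_piMr.
by rewrite mulrA ler_pdivrMr//; lra.
Qed.

Lemma disc_algebra_cpow (rho s : R) : 0 <= rho < 1 ->
  disc_algebra (fun z => cpow (1 - rho%:C%C * z) s).
Proof.
move=> r; apply: disc_algebra_cexp; apply: disc_algebraM; first exact: disc_algebra_cst.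
exact: disc_algebra_clog.
Qed.

End UniformApproximation.

(** * The weighted composition operators *)

Section WeightedComposition.
Context {R : realType}.
Implicit Types (t x y r : R) (z w : R[i]) (q : {poly R[i]}).

Definition wt t z : R[i] := (1 - (1 - t)%:C%C * z)^-1.

Definition phi t z : R[i] := t%:C%C * wt t z.

Definition wcomp t q z : R[i] := wt t z * q.[phi t z].

Lemma normc_1B t : 0 < t < 1 -> normc (1 - t)%:C%C = 1 - t.
Proof. by move=> /andP[_ t1]; rewrite normcR ger0_norm// subr_ge0 ltW. Qed.

Lemma normc_1B_lt1 t : 0 < t < 1 -> normc (1 - t)%:C%C < 1.
Proof. by move=> t01; rewrite normc_1B//; case/andP: t01 => ? ?; lra. Qed.

Lemma wt_denominator_neq0 t z : 0 < t < 1 -> normc z <= 1 -> 1 - (1 - t)%:C%C * z != 0.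
Proof. by move=> t01 z1; exact: cauchy_denominator_neq0 (normc_1B_lt1 t01) z1. Qed.

Lemma wt_neq0 t z : 0 < t < 1 -> normc z <= 1 -> wt t z != 0.
Proof. by move=> t01 z1; rewrite invr_eq0 wt_denominator_neq0. Qed.

Lemma normc_wt_le t z : 0 < t < 1 -> normc z <= 1 -> normc (wt t z) <= t^-1.
Proof.
move=> t01 z1; have := normc_cauchy_le (normc_1B_lt1 t01) z1.
by rewrite normc_1B// subKr.
Qed.

Lemma normc_phi_le t z : 0 < t < 1 -> normc z <= 1 -> normc (phi t z) <= 1.
Proof.
move=> t01 z1; case/andP: (t01) => t0 t1; rewrite Normc.normcM normcR gtr0_norm//.
by rewrite -ler_pdivlMl// mulr1 normc_wt_le.
Qed.

Lemma one_sub_phi t z : 0 < t < 1 -> normc z <= 1 ->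
  1 - phi t z = (1 - t)%:C%C * (1 - z) * wt t z.
Proof.
move=> t01 z1; have ne0 := wt_denominator_neq0 t01 z1.
have e : wt t z * (1 - (1 - t)%:C%C * z) = 1 by rewrite mulVf.
by rewrite -{1}e /phi rmorphB /=; ring.
Qed.

Lemma normc_phi_lt1 t z : 0 < t < 1 -> normc z < 1 -> normc (phi t z) < 1.
Proof.
move=> t01 z1; case/andP: (t01) => t0 t1; rewrite Normc.normcM normcR gtr0_norm//.
rewrite -ltr_pdivlMl// mulr1 Normc.normcV ltf_pV2 ?posrE//; last first.
  by rewrite normc_gt0 wt_denominator_neq0// ltW.
apply: lt_le_trans (lerB_normc _ _); rewrite Normc.normc1 Normc.normcM normc_1B//.
have : (1 - t) * normc z < 1 - t by rewrite gtr_pMr// subr_gt0.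
lra.
Qed.

(** The image circle touches the unit circle at [1]. *)
Lemma one_sub_sqr_phi t x : 0 < t < 1 ->
  1 - normc (phi t (cis x)) ^+ 2 =
    (1 - t) * normc (1 - cis x) ^+ 2 * normc (wt t (cis x)) ^+ 2.
Proof.
move=> t01; case/andP: (t01) => t0 t1.
have c1 : normc (cis x) <= 1 by rewrite normc_cis.
have ne0 := wt_denominator_neq0 t01 c1.
rewrite /phi Normc.normcM normcR gtr0_norm// /wt Normc.normcV.
have : normc (1 - (1 - t)%:C%C * cis x) ^+ 2 != 0 by rewrite expf_neq0// normc_eq0.
rewrite !exprMn !exprVn => n0; apply: (mulIf n0); rewrite mulrBl !divfK//.
rewrite !sqr_normcE /=; have := cos2Dsin2 x; move: (cos x) (sin x) => c s e.
have -> : (1 - ((1 - t) * c - 0 * s)) ^+ 2 + (0 - ((1 - t) * s + 0 * c)) ^+ 2 =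
  1 - 2 * (1 - t) * c + (1 - t) ^+ 2 * (c ^+ 2 + s ^+ 2) by ring.
rewrite e.
have -> : (1 - c) ^+ 2 + (0 - s) ^+ 2 = 1 - 2 * c + (c ^+ 2 + s ^+ 2) by ring.
by rewrite e; ring.
Qed.

Lemma cmeasurable_wt t (f : R -> R[i]) : cmeasurable setT f ->
  cmeasurable setT (fun x => wt t (f x)).
Proof.
move=> mf; apply: cmeasurableV; apply: cmeasurableB; first exact: cmeasurable_cst.
by apply: cmeasurableM => //; exact: cmeasurable_cst.
Qed.

Lemma cmeasurable_phi t (f : R -> R[i]) : cmeasurable setT f ->
  cmeasurable setT (fun x => phi t (f x)).
Proof.
by move=> mf; apply: cmeasurableM; [exact: cmeasurable_cst|exact: cmeasurable_wt].
Qed.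

Lemma cmeasurable_wcomp t q (f : R -> R[i]) : cmeasurable setT f ->
  cmeasurable setT (fun x => wcomp t q (f x)).
Proof.
move=> mf; apply: cmeasurableM; first exact: cmeasurable_wt.
by apply: cmeasurable_horner; exact: cmeasurable_phi.
Qed.

Lemma disc_algebra_wt t : 0 < t < 1 -> disc_algebra (wt t).
Proof. by move=> t01; exact: disc_algebra_cauchy (normc_1B_lt1 t01). Qed.

Lemma disc_algebra_wcomp t q : 0 < t < 1 -> disc_algebra (wcomp t q).
Proof.
move=> t01; apply: disc_algebraM; first exact: disc_algebra_wt.
apply: disc_algebra_horner; apply: disc_algebraM; first exact: disc_algebra_cst.
exact: disc_algebra_wt.
Qed.

Lemma cmeasurable_horner_cis q : cmeasurable setT (fun x => q.[cis x]).
Proof. by apply: cmeasurable_horner; exact: cmeasurable_cis. Qed.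

Lemma EFin_Rintegral_circ (h : R -> R) : circ.-integrable setT (fun x => (h x)%:E) ->
  (\int[circ]_x h x)%:E = (\int[circ]_x (h x)%:E)%E.
Proof. by move=> ih; rewrite /Rintegral fineK//; exact: integrable_fin_num ih. Qed.

(** The function [(1 - w) ^ (2 / p) * q] is analytic, and the [p]-th power of
    its modulus is [|1 - w| ^ 2 * |q| ^ p].  To have a function in the disc
    algebra one first moves the singularity at [1] out of the closed disc. *)
Lemma horocycle_subharmonic (p : R) q w : 1 <= p -> normc w < 1 ->
  normc (1 - w) ^+ 2 * normc q.[w] `^ p <=
  \int[circ]_y (normc (1 - cis y) ^+ 2 * normc q.[cis y] `^ p * poisson w y).
Proof.
move=> p1 w1; have p0 : 0 < p by apply: lt_le_trans p1.
have [M M0 qM] := horner_bound q.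
pose P := 2 / (1 - normc w).
have P0 : 0 <= P by rewrite divr_ge0// subr_ge0 ltW.
have c1 y : normc (cis y : R[i]) <= 1 by rewrite normc_cis.
have qMp z : normc z <= 1 -> normc q.[z] `^ p <= M `^ p.
  move=> z1; apply: ge0_ler_powR; rewrite ?nnegrE ?normc_ge0 ?qM ?(ltW p0)//.
  exact: ltW.
have PM y : `|poisson w y| <= P by exact: normr_poisson_le.
have mqp : measurable_fun setT (fun y => normc q.[cis y] `^ p).
  exact: measurable_normc_powR (cmeasurable_horner_cis q).
have mP := measurable_poisson w.
have m1 (rho : R) : cmeasurable setT (fun y => 1 - rho%:C%C * cis y).
  apply: cmeasurableB; first exact: cmeasurable_cst.
  by apply: cmeasurableM; [exact: cmeasurable_cst|exact: cmeasurable_cis].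
have n1 (rho : R) z : 0 <= rho <= 1 -> normc z <= 1 -> normc (1 - rho%:C%C * z) <= 2.
  move=> /andP[r0 r1] z1; apply: le_trans (ler_normcB _ _) _.
  rewrite Normc.normc1 -[leRHS]/(1 + 1) lerD2l Normc.normcM normcR ger0_norm//.
  by rewrite mulr_ile1// normc_ge0.
have i1 (rho : R) : 0 <= rho <= 1 -> circ.-integrable setT (fun y =>
    (normc (1 - rho%:C%C * cis y) ^+ 2 * normc q.[cis y] `^ p * poisson w y)%:E).
  move=> r01; apply: (@integrable_circ _ _ (2 ^+ 2 * M `^ p * P)).
    apply: measurable_funM => //; apply: measurable_funM => //.
    by apply: measurable_funX; exact: measurable_normc.
  move=> y; rewrite normrM; apply: ler_pM => //.
  rewrite ger0_norm ?mulr_ge0 ?exprn_ge0 ?powR_ge0 ?normc_ge0//.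
  apply: ler_pM; rewrite ?exprn_ge0 ?powR_ge0 ?normc_ge0 ?qMp//.
  by rewrite lerXn2r ?nnegrE ?normc_ge0 ?n1.
have i2 : circ.-integrable setT (fun y => (normc q.[cis y] `^ p * poisson w y)%:E).
  apply: (@integrable_circ _ _ (M `^ p * P)); first exact: measurable_funM.
  by move=> y; rewrite normrM ler_pM// (ger0_norm (powR_ge0 _ _)) qMp.
pose C := \int[circ]_y (normc q.[cis y] `^ p * poisson w y).
have near1 (rho : R) z : 0 <= rho <= 1 -> normc z <= 1 ->
    `|normc (1 - rho%:C%C * z) ^+ 2 - normc (1 - z) ^+ 2| <= 4 * (1 - rho).
  move=> r01 z1; have r1 : 0 <= 1 - rho by case/andP: r01; lra.
  have a1 := n1 _ _ r01 z1.
  have a2 : normc (1 - z) <= 2.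
    by apply: le_trans (ler_normcB _ _) _; rewrite Normc.normc1 -[leRHS]/(1 + 1) lerD2l.
  have d : `|normc (1 - rho%:C%C * z) - normc (1 - z)| <= 1 - rho.
    have e : normc ((1 - rho%:C%C * z) - (1 - z)) <= 1 - rho.
      have -> : (1 - rho%:C%C * z) - (1 - z) = (1 - rho)%:C%C * z by rewrite rmorphB /=; ring.
      by rewrite Normc.normcM normcR ger0_norm// ler_piMr.
    rewrite ler_norml; apply/andP; split; last exact: le_trans (lerB_normc _ _) e.
    by rewrite lerNl opprB; apply: le_trans (lerB_normc _ _) _; rewrite normcBC.
  rewrite subr_sqr normrM mulrC ler_pM// ger0_norm ?addr_ge0 ?normc_ge0//.
  lra.
have C0 : 0 <= C.
  by apply: Rintegral_ge0 => y _; rewrite mulr_ge0 ?powR_ge0 ?poisson_ge0.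
apply/ler_addgt0Pr => e e0.
pose d := Num.min 1 (e / (4 * C + 4 * M `^ p + 1)).
have D0 : 0 < 4 * C + 4 * M `^ p + 1.
  by rewrite ltr_wpDl// addr_ge0// mulr_ge0// powR_ge0.
have d0 : 0 < d by rewrite lt_min ltr01 divr_gt0.
have d1 : d <= 1 by rewrite ge_min lexx.
have de : d * (4 * C + 4 * M `^ p + 1) <= e.
  by rewrite -ler_pdivlMr// ge_min lexx orbT.
pose rho := 1 - d.
have r01 : 0 <= rho < 1 by rewrite /rho; apply/andP; split; lra.
have r01' : 0 <= rho <= 1 by case/andP: r01 => -> /ltW ->.
have rw z : normc z <= 1 -> 1 - rho%:C%C * z != 0.
  move=> z1; apply: cauchy_denominator_neq0 => //.
  by case/andP: r01 => r0 r1; rewrite normcR ger0_norm.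
pose G z := cpow (1 - rho%:C%C * z) (2 / p) * q.[z].
have nG z : normc z <= 1 -> normc (G z) `^ p = normc (1 - rho%:C%C * z) ^+ 2 * normc q.[z] `^ p.
  move=> z1; rewrite Normc.normcM powRM ?normc_ge0// normc_cpow ?rw// -powRrM.
  by rewrite divfK ?gt_eqF// powR_mulrn ?normc_ge0.
have aG : disc_algebra G.
  by apply: disc_algebraM; [exact: disc_algebra_cpow|exact: disc_algebra_poly].
have mG : cmeasurable setT (fun y => G (cis y)).
  by apply: cmeasurableM; [exact: cmeasurable_cpow|exact: cmeasurable_horner_cis].
have := poisson_powR_le p1 w1 aG mG; rewrite nG ?(ltW w1)//.
under eq_integral do rewrite nG ?normc_cis//.
rewrite -EFin_Rintegral_circ ?lee_fin; last exact: i1.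
move=> main.
have up : \int[circ]_y (normc (1 - rho%:C%C * cis y) ^+ 2 * normc q.[cis y] `^ p * poisson w y)
   <= \int[circ]_y (normc (1 - cis y) ^+ 2 * normc q.[cis y] `^ p * poisson w y) + 4 * d * C.
  have i11 := i1 1; rewrite ler01 lexx in i11.
  have {}i11 : circ.-integrable setT (fun y =>
    (normc (1 - cis y) ^+ 2 * normc q.[cis y] `^ p * poisson w y)%:E).
    by apply: eq_integrable (i11 erefl) => // y _; rewrite mul1r.
  rewrite /C -RintegralZl// -RintegralD//; last exact: eq_integrable (integrableZl measurableT (4 * d) i2).
  apply: le_Rintegral => //; first exact: i1.
    by apply: eq_integrable (integrableD measurableT i11 (integrableZl measurableT (4 * d) i2)).
  move=> y _; rewrite -mulrA -[leRHS]addrC -lerBlDr -mulrA -mulrBl.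
  apply: ler_wpM2r; first by apply: mulr_ge0; [exact: powR_ge0|exact: poisson_ge0].
  apply: le_trans (ler_norm _) _; apply: le_trans (near1 _ _ r01' (c1 y)) _.
  by rewrite /rho; lra.
have low : normc (1 - w) ^+ 2 * normc q.[w] `^ p <=
    normc (1 - rho%:C%C * w) ^+ 2 * normc q.[w] `^ p + 4 * d * M `^ p.
  rewrite -lerBlDl -mulrBl; apply: (@le_trans _ _ (4 * d * normc q.[w] `^ p)).
    rewrite ler_wpM2r ?powR_ge0//; apply: le_trans (ler_norm _) _; rewrite distrC.
    by apply: le_trans (near1 _ _ r01' (ltW w1)) _; rewrite /rho; lra.
  by rewrite ler_wpM2l ?qMp ?mulr_ge0 ?(ltW w1)// ltW.
move: de; rewrite !mulrDr !mulrA; lra.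
Qed.

End WeightedComposition.

Section CompositionBounds.
Context {R : realType}.
Implicit Types (t x y r p : R) (z w : R[i]) (q : {poly R[i]}).

(** A point has no mass: the mean of [1 / |1 - b cis x| ^ 2] would otherwise grow
    like [(1 - b) ^ (-2)] as [b] tends to [1], while it is [1 / (1 - b ^ 2)]. *)
Lemma ae_cis_neq1 : \forall x \ae (@circ R), cis x != 1.
Proof.
pose N := [set x : measurableTypeR R | normc (1 - cis x) = 0].
have mn : measurable_fun [set: measurableTypeR R] (fun x => normc (1 - cis x)).
  apply: measurable_normc; apply: cmeasurableB; first exact: cmeasurable_cst.
  exact: cmeasurable_cis.
have mN : measurable N.
  have := mn measurableT _ (measurable_set1 (0 : R)); rewrite setTI.
  by congr measurable; apply/seteqP.
exists N; split=> //; last first.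
  move=> x /= /negP; rewrite negbK => /eqP e; rewrite -[N x]/(normc (1 - cis x) = 0).
  by rewrite e subrr Normc.normc0.
have fN : circ N \is a fin_num by rewrite fin_num_measure.
rewrite -(fineK fN); congr (_%:E); apply/eqP; rewrite eq_le fine_ge0// andbT.
apply/ler_addgt0Pr => e0 e00; rewrite add0r.
pose e := Num.min e0 2^-1.
have e0' : 0 < e by rewrite lt_min e00/= invr_gt0.
have e1 : e <= 2^-1 by rewrite ge_min lexx orbT.
have ee0 : e <= e0 by rewrite ge_min lexx.
apply: le_trans ee0; pose b := 1 - e.
have b0 : 0 <= b by rewrite /b; lra.
have nb : normc b%:C%C = b by rewrite normcR ger0_norm.
have := @integral_inv_sqr R 1 b%:C%C.
rewrite nb Normc.normc1 => /(_ _)H.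
have {}H : (\int[circ]_x ((normc (1 - b%:C%C * cis x) ^+ 2)^-1)%:E =
  ((1 ^+ 2 - b ^+ 2)^-1)%:E)%E by apply: H; rewrite /b; lra.
have mf : measurable_fun [set: measurableTypeR R]
    (fun x => ((normc (1 - b%:C%C * cis x) ^+ 2)^-1)%:E).
  apply/measurable_EFinP; apply: measurable_fun_inv; apply: measurable_funX.
  apply: measurable_normc; apply: cmeasurableB; first exact: cmeasurable_cst.
  by apply: cmeasurableM; [exact: cmeasurable_cst|exact: cmeasurable_cis].
have : ((e ^+ 2)^-1%:E * circ N <= ((1 ^+ 2 - b ^+ 2)^-1)%:E)%E.
  rewrite -H -integral_cst//.
  apply: (@le_trans _ _ (\int[circ]_(x in N) ((normc (1 - b%:C%C * cis x) ^+ 2)^-1)%:E)%E).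
    apply: ge0_le_integral => //.
    - by move=> x _; rewrite lee_fin invr_ge0 sqr_ge0.
    - exact: measurable_funTS.
    - move=> x /Normc.eq0_normc /eqP; rewrite subr_eq0 => /eqP <-.
      have -> : 1 - b%:C%C * 1 = e%:C%C by rewrite mulr1 /b rmorphB rmorph1 subKr.
      by rewrite normcR gtr0_norm.
  apply: ge0_subset_integral => //.
  by move=> x _; rewrite lee_fin invr_ge0 sqr_ge0.
rewrite -(fineK fN) -EFinM lee_fin /=; move: (fine _) => c.
have -> : 1 ^+ 2 - b ^+ 2 = e * (2 - e) by rewrite /b; ring.
have e2 : 0 < 2 - e by lra.
rewrite ler_pdivrMl ?exprn_gt0// => h; apply: (le_trans h).
have -> : e ^+ 2 * (e * (2 - e))^-1 = e / (2 - e).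
  by field; rewrite (gt_eqF e0') (gt_eqF e2).
by rewrite ler_pdivrMr// ler_peMr ?(ltW e0'); lra.
Qed.

(** For fixed [y], the denominator on the right-hand side is the square of the
    modulus of an affine function of [cis x], so that the mean in [x] of its inverse
    is given by [integral_inv_sqr]. *)
Lemma poisson_phi_kernel t x y : 0 < t < 1 -> cis x != 1 :> R[i] ->
  poisson (phi t (cis x)) y * normc (wt t (cis x)) ^+ 2 =
  ((1 - t) * normc (cis y - t%:C%C - (1 - t)%:C%C * cis y * cis x) ^+ 2)^-1 *
    normc (1 - phi t (cis x)) ^+ 2.
Proof.
move=> t01 x1; case/andP: (t01) => t0 t1.
have c1 : normc (cis x) <= 1 by rewrite normc_cis.
have w0 : normc (wt t (cis x)) != 0 by rewrite normc_eq0 wt_neq0.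
rewrite /poisson one_sub_sqr_phi// one_sub_phi// !Normc.normcM normc_1B//.
have -> : cis y - phi t (cis x) =
    wt t (cis x) * (cis y - t%:C%C - (1 - t)%:C%C * cis y * cis x).
  have e : wt t (cis x) * (1 - (1 - t)%:C%C * cis x) = 1.
    by rewrite mulVf// wt_denominator_neq0.
  rewrite -{1}[cis y]mul1r -{1}e /phi; ring.
rewrite Normc.normcM; have t10 : 1 - t != 0 by rewrite gt_eqF// subr_gt0.
have [a0|a0] := eqVneq (normc (cis y - t%:C%C - (1 - t)%:C%C * cis y * cis x)) 0.
  by rewrite a0 expr0n /= !mulr0 expr0n /= !invr0 mulr0 !mul0r.
move: w0 t10 a0; move: (normc (wt _ _)) (1 - t) (normc (_ - _ - _)) (normc (1 - _)).
by move=> u v a b u0 v0 a0; field; rewrite u0 v0 a0.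
Qed.

Lemma normc_phi_cis_lt1 t x : 0 < t < 1 -> cis x != 1 :> R[i] ->
  normc (phi t (cis x)) < 1.
Proof.
move=> t01 x1; case/andP: (t01) => t0 t1.
rewrite -(@ltr_pXn2r _ 2)// ?nnegrE ?normc_ge0// expr1n -subr_gt0 one_sub_sqr_phi//.
have x0 : 1 - cis x != 0 by rewrite subr_eq0 eq_sym.
by rewrite !mulr_gt0 ?exprn_gt0 ?subr_gt0 ?normc_gt0 ?wt_neq0 ?normc_cis.
Qed.

(** The inequality [horocycle_subharmonic] at the points [phi t (cis x)] is divided
    by [|1 - phi t (cis x)| ^ 2] and integrated in [x]; after Tonelli's theorem, the
    mean in [x] of the kernel cancels the factor [|1 - cis y| ^ 2]. *)
Lemma mean_wt_sqr_le p t q : 1 <= p -> 0 < t < 1 ->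
  (\int[circ]_x (normc (wt t (cis x)) ^+ 2 * normc q.[phi t (cis x)] `^ p)%:E <=
   ((t * (1 - t))^-1)%:E * \int[circ]_y (normc q.[cis y] `^ p)%:E)%E.
Proof.
move=> p1 t01; case/andP: (t01) => t0 t1.
have t10 : 0 < 1 - t by rewrite subr_gt0.
pose K (z : measurableTypeR R * measurableTypeR R) : R :=
  ((1 - t) * normc (cis z.2 - t%:C%C - (1 - t)%:C%C * cis z.2 * cis z.1) ^+ 2)^-1.
pose F (z : measurableTypeR R * measurableTypeR R) :=
  (normc (1 - cis z.2) ^+ 2 * normc q.[cis z.2] `^ p * K z)%:E.
have K0 (z : measurableTypeR R * measurableTypeR R) : 0 <= K z by rewrite invr_ge0 mulr_ge0 ?sqr_ge0// ltW.
have m1 : measurable_fun [set: measurableTypeR R]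
    (fun y => normc (1 - cis y) ^+ 2 * normc q.[cis y] `^ p).
  apply: measurable_funM; last exact: measurable_normc_powR (cmeasurable_horner_cis q).
  apply: measurable_funX; apply: measurable_normc; apply: cmeasurableB.
    exact: cmeasurable_cst.
  exact: cmeasurable_cis.
have mK : measurable_fun setT K.
  apply: measurable_fun_inv; apply: measurable_funM => //; apply: measurable_funX.
  have c2 : cmeasurable [set: measurableTypeR R * measurableTypeR R] (fun u => cis u.2).
    by apply: cmeasurable_comp => //; exact: cmeasurable_cis.
  have c1 : cmeasurable [set: measurableTypeR R * measurableTypeR R] (fun u => cis u.1).
    by apply: cmeasurable_comp => //; exact: cmeasurable_cis.
  apply: measurable_normc; apply: cmeasurableB.
    by apply: cmeasurableB => //; exact: cmeasurable_cst.
  by apply: cmeasurableM => //; apply: cmeasurableM => //; exact: cmeasurable_cst.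
have mF : measurable_fun setT F.
  apply/measurable_EFinP; apply: measurable_funM => //.
  exact: (measurableT_comp m1 measurable_snd).
have F0 (z : measurableTypeR R * measurableTypeR R) : (0 <= F z)%E.
  by rewrite lee_fin mulr_ge0// mulr_ge0 ?powR_ge0 ?sqr_ge0.
apply: (@le_trans _ _ (\int[circ]_x \int[circ]_y F (x, y))%E).
  apply: ae_ge0_le_integral => //.
  - by move=> x _; rewrite lee_fin mulr_ge0 ?powR_ge0 ?sqr_ge0.
  - apply/measurable_EFinP; apply: measurable_funM.
      apply: measurable_funX; apply: measurable_normc; apply: cmeasurable_wt.
      exact: cmeasurable_cis.
    apply: measurable_normc_powR; apply: cmeasurable_horner; apply: cmeasurable_phi.
    exact: cmeasurable_cis.
  - by move=> x _; exact: integral_ge0.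
  - exact: measurable_fun_fubini_tonelli_F.
  have [N [mN N0 sN]] := ae_cis_neq1; exists N; split=> // x /= h.
  apply: sN => /= x1; apply: h => _.
  have f1 := normc_phi_cis_lt1 t01 x1.
  have k0 : 0 < normc (1 - phi t (cis x)) ^+ 2.
    rewrite exprn_gt0// normc_gt0 subr_eq0; apply: contraTneq f1 => <-.
    by rewrite Normc.normc1 ltxx.
  have FE y : F (x, y) = ((normc (wt t (cis x)) ^+ 2 / normc (1 - phi t (cis x)) ^+ 2) *
      (normc (1 - cis y) ^+ 2 * normc q.[cis y] `^ p * poisson (phi t (cis x)) y))%:E.
    congr (_%:E); rewrite [RHS]mulrCA; congr (_ * _).
    rewrite mulrAC [X in X / _]mulrC poisson_phi_kernel// mulfK//.
    by rewrite gt_eqF.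
  under eq_integral do rewrite FE EFinM.
  have [M M0 qM] := horner_bound q.
  have ii : circ.-integrable setT (fun y =>
      (normc (1 - cis y) ^+ 2 * normc q.[cis y] `^ p * poisson (phi t (cis x)) y)%:E).
    apply: (@integrable_circ _ _ (2 ^+ 2 * M `^ p * (2 / (1 - normc (phi t (cis x)))))).
      by apply: measurable_funM => //; exact: measurable_poisson.
    move=> y; rewrite normrM; apply: ler_pM => //; last exact: normr_poisson_le.
    rewrite ger0_norm ?mulr_ge0 ?exprn_ge0 ?powR_ge0 ?normc_ge0//.
    apply: ler_pM; rewrite ?exprn_ge0 ?powR_ge0 ?normc_ge0//.
      rewrite lerXn2r ?nnegrE ?normc_ge0//; apply: le_trans (ler_normcB _ _) _.
      by rewrite Normc.normc1 normc_cis.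
    have p0 : 0 <= p by apply: le_trans p1.
    by apply: ge0_ler_powR; rewrite ?nnegrE ?normc_ge0 ?(ltW M0)// qM// normc_cis.
  rewrite ge0_integralZl//; last 3 first.
  - by apply/measurable_EFinP; apply: measurable_funM => //; exact: measurable_poisson.
  - move=> y _; rewrite lee_fin; apply: mulr_ge0; last exact: poisson_ge0.
    by rewrite mulr_ge0 ?powR_ge0 ?sqr_ge0.
  - by rewrite lee_fin divr_ge0 ?sqr_ge0.
  rewrite -EFin_Rintegral_circ// -EFinM lee_fin.
  have := horocycle_subharmonic q p1 f1; rewrite -[X in X <= _ -> _]mulrC.
  rewrite -ler_pdivlMr// => H; apply: le_trans (ler_wpM2l (sqr_ge0 _) H) _.
  by rewrite [X in _ * X]mulrC mulrA.
rewrite fubini_tonelli// -ge0_integralZl//; last 3 first.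
- by apply/measurable_EFinP; exact: measurable_normc_powR (cmeasurable_horner_cis q).
- by move=> y _; rewrite lee_fin powR_ge0.
- by rewrite lee_fin invr_ge0 mulr_ge0// ltW.
apply: ge0_le_integral => //.
- by move=> y _; exact: integral_ge0.
- exact: measurable_fun_fubini_tonelli_G.
- apply/measurable_EFinP; apply: measurable_funM => //.
  exact: measurable_normc_powR (cmeasurable_horner_cis q).
move=> y _; have [y1|y1] := eqVneq (cis y : R[i]) 1.
  under eq_integral do rewrite /F /= y1 subrr Normc.normc0 expr0n /= mul0r mul0r.
  by rewrite integral0 -EFinM lee_fin mulr_ge0 ?powR_ge0// invr_ge0 mulr_ge0// ltW.
have y0 : 0 < normc (1 - cis y) ^+ 2.
  by rewrite exprn_gt0// normc_gt0 subr_eq0 eq_sym.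
have AB : normc (cis y - t%:C%C) ^+ 2 - normc ((1 - t)%:C%C * cis y) ^+ 2 =
    t * normc (1 - cis y) ^+ 2.
  rewrite Normc.normcM normc_cis mulr1 normc_1B// !sqr_normcE /=.
  have := cos2Dsin2 y; move: (cos y) (sin y) => c s e.
  have -> : (c - t) ^+ 2 + (s - 0) ^+ 2 = (c ^+ 2 + s ^+ 2) - 2 * t * c + t ^+ 2 by ring.
  have -> : (1 - c) ^+ 2 + (0 - s) ^+ 2 = 1 - 2 * c + (c ^+ 2 + s ^+ 2) by ring.
  by rewrite e; ring.
under eq_integral => x _.
  rewrite /F /K /= invfM mulrA EFinM.
  over.
rewrite /= ge0_integralZl//; last 3 first.
- apply/measurable_EFinP; apply: measurable_fun_inv; apply: measurable_funX.
  apply: measurable_normc; apply: cmeasurableB; first exact: cmeasurable_cst.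
  by apply: cmeasurableM; [exact: cmeasurable_cst|exact: cmeasurable_cis].
- by move=> x _; rewrite lee_fin invr_ge0 sqr_ge0.
- by rewrite lee_fin mulr_ge0 ?invr_ge0 ?(ltW t10)// mulr_ge0 ?powR_ge0 ?sqr_ge0.
rewrite integral_inv_sqr ?AB; last first.
  rewrite -(@ltr_pXn2r _ 2)// ?nnegrE ?normc_ge0// -subr_gt0 AB.
  by rewrite mulr_gt0.
rewrite -!EFinM lee_fin le_eqVlt; apply/orP; left; apply/eqP.
move: y0 => /lt0r_neq0; move: (normc (1 - _) ^+ 2) (_ `^ p) => a b a0.
by field; rewrite a0 (gt_eqF t0) (gt_eqF t10).
Qed.

End CompositionBounds.

(** * Explicit means over circles *)

Section CircleEstimates.
Context {R : realType}.
Implicit Types (p r x t : R).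

(** The sine is positive on the first half of the circle and negative on the
    second, so that the primitive is counted with opposite signs. *)
Lemma mean_abs_sin (k F : R -> R) : (forall x : R, is_derive x 1 F (sin x * k x)) ->
  continuous k -> (forall x, 0 <= k x) ->
  (\int[circ]_x (`|sin x| * k x)%:E = ((2 * F pi - F 0 - F (2 * pi)) / (2 * pi))%:E)%E.
Proof.
move=> dF ck k0; have pi0 := @pi_gt0 R.
have cs : continuous (fun x : R => sin x * k x).
  by move=> x; apply: cvgM; [exact: continuous_sin|exact: ck].
have ca : continuous (fun x : R => `|sin x| * k x).
  move=> x; apply: cvgM; last exact: ck.
  by apply: continuous_comp; [exact: continuous_sin|exact: norm_continuous].
have ma : measurable_fun [set: R] (fun x : R => (`|sin x| * k x)%:E).
  by apply/measurable_EFinP; exact: continuous_measurable_fun.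
rewrite integral_circ//; last by move=> x; rewrite lee_fin mulr_ge0.
have p2 : pi < 2 * pi :> R by lra.
rewrite (@itv_bndbnd_setU _ _ (BLeft 0) (BLeft pi) (BRight (2 * pi))); last 2 first.
- by rewrite bnd_simp ltW.
- by rewrite bnd_simp ltW.
rewrite ge0_integral_setU//; last 3 first.
- exact: measurable_funTS.
- by move=> x _; rewrite lee_fin mulr_ge0.
- apply/disj_setPS => x [/=]; rewrite !in_itv/= => /andP[_ a] /andP[b _].
  by move: (lt_le_trans a b); rewrite ltxx.
rewrite integral_itv_bndo_bndc//; last exact: measurable_funTS.
have e1 : (\int[lebesgue_measure]_(x in `[0%R, pi]) (`|sin x| * k x)%:E = (F pi - F 0)%:E)%E.
  rewrite -(FTC_everywhere pi0 dF cs); apply: eq_integral => x.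
  by rewrite inE/= in_itv/= => x0; rewrite ger0_norm// sin_ge0_pi.
have e2 : (\int[lebesgue_measure]_(x in `[pi, (2 * pi)%R]) (`|sin x| * k x)%:E =
    (F pi - F (2 * pi))%:E)%E.
  have dG (x : R) : is_derive x 1 (- F) (- (sin x * k x)) by exact: is_deriveN.
  have cG : continuous (fun x : R => - (sin x * k x)) by move=> x; apply: cvgN; exact: cs.
  rewrite (_ : F pi - F (2 * pi) = (- F) (2 * pi) - (- F) pi); last by rewrite !fctE; ring.
  rewrite -(FTC_everywhere p2 dG cG); apply: eq_integral => x.
  rewrite inE/= in_itv/= => /andP[x1 x2]; rewrite ler0_norm ?mulNr//.
  rewrite -[x](subrK pi) sinDpi oppr_le0 sin_ge0_pi// subr_ge0 x1 /=; lra.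
rewrite e1 e2 -EFinD -EFinM; congr (_%:E); rewrite mulrC; congr (_ / _); ring.
Qed.

Lemma normc_1Bcis r x : normc (1 - r%:C%C * cis x) ^+ 2 = 1 - 2 * r * cos x + r ^+ 2.
Proof.
rewrite sqr_normcE /=; have := cos2Dsin2 x; move: (cos x) (sin x) => c s e.
have -> : (1 - (r * c - 0 * s)) ^+ 2 + (0 - (r * s + 0 * c)) ^+ 2 =
  1 - 2 * r * c + r ^+ 2 * (c ^+ 2 + s ^+ 2) by ring.
by rewrite e mulr1.
Qed.

Lemma normc_1Bcis_gt0 r x : 0 <= r < 1 -> 0 < normc (1 - r%:C%C * cis x).
Proof.
move=> /andP[r0 r1]; rewrite normc_gt0; apply: cauchy_denominator_neq0.
  by rewrite normcR ger0_norm.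
by rewrite normc_cis.
Qed.

Lemma is_derive_sqr_normc r x :
  is_derive x 1 (fun y => normc (1 - r%:C%C * cis y) ^+ 2) (2 * r * sin x).
Proof.
have -> : (fun y => normc (1 - r%:C%C * cis y) ^+ 2) =
    (fun y => 1 + - (2 * r) * cos y + r ^+ 2).
  by apply/funext => y; rewrite normc_1Bcis; ring.
have H := is_deriveD (is_deriveD (is_derive_cst (1 : R) x 1)
  (is_deriveZ (- (2 * r)) (is_derive_cos x))) (is_derive_cst (r ^+ 2) x 1).
by apply: (is_derive_eq H); rewrite /GRing.scale /=; ring.
Qed.

Lemma continuous_normc_powR r s : 0 <= r < 1 ->
  continuous (fun x => normc (1 - r%:C%C * cis x) `^ s).
Proof.
move=> r01.
have -> : (fun x => normc (1 - r%:C%C * cis x) `^ s) =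
    (fun x => (normc (1 - r%:C%C * cis x) ^+ 2) `^ (s / 2)).
  apply/funext => x; rewrite -powR_mulrn ?normc_ge0// -powRrM.
  by congr (_ `^ _); field.
move=> x; apply: differentiable_continuous; apply/derivable1_diffP.
have n0 : 0 < normc (1 - r%:C%C * cis x) ^+ 2 by rewrite exprn_gt0// normc_1Bcis_gt0.
have H := @is_derive1_comp R (fun u => u `^ (s / 2))
  (fun y => normc (1 - r%:C%C * cis y) ^+ 2) x _ _
  (is_derive1_powR (s / 2) n0) (is_derive_sqr_normc r x).
by case: H.
Qed.

(** The integrand is [|sin x|] times a function of [cos x], and half the
    logarithm of [|1 - r cis x| ^ 2] is a primitive, up to the sign of the sine. *)
Lemma mean_log r : 0 <= r < 1 ->
  (\int[circ]_x (`|sin x| * (r * normc (1 - r%:C%C * cis x) `^ (- 2)))%:E =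
   (pi^-1 * ln ((1 + r) / (1 - r)))%:E)%E.
Proof.
move=> r01; case/andP: (r01) => r0 r1.
have dF x : is_derive x 1 (fun y => 2^-1 * ln (normc (1 - r%:C%C * cis y) ^+ 2))
    (sin x * (r * normc (1 - r%:C%C * cis x) `^ (- 2))).
  have n0 : 0 < normc (1 - r%:C%C * cis x) ^+ 2 by rewrite exprn_gt0// normc_1Bcis_gt0.
  have H := is_deriveZ 2^-1 (@is_derive1_comp R (@ln R)
    (fun y => normc (1 - r%:C%C * cis y) ^+ 2) x _ _
    (is_derive1_ln n0) (is_derive_sqr_normc r x)).
  apply: (is_derive_eq H); rewrite /GRing.scale /=.
  rewrite powRN powR_mulrn ?normc_ge0//.
  by field; rewrite gt_eqF// normc_1Bcis_gt0.
rewrite (mean_abs_sin dF).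
- congr (_%:E); have c2 : cos (2 * pi) = 1 :> R by rewrite mulr_natl cos2pi.
  have n0 x : cos x = 1 -> normc (1 - r%:C%C * cis x) ^+ 2 = (1 - r) ^+ 2.
    by move=> c; rewrite normc_1Bcis c; ring.
  rewrite (n0 0 (cos0 R)) (n0 _ c2) normc_1Bcis cospi.
  have -> : 1 - 2 * r * -1 + r ^+ 2 = (1 + r) ^+ 2 by ring.
  have r10 : 0 < 1 - r by lra.
  have r10' : 0 < 1 + r by lra.
  have l2 (s : R) : 0 < s -> ln (s ^+ 2) = 2 * ln s by move=> s0; rewrite lnXn// mulr_natl.
  rewrite (l2 _ r10) (l2 _ r10') ln_div//.
  move: (ln (1 + r)) (ln (1 - r)) (lt0r_neq0 (@pi_gt0 R)); move: (@pi R) => P a b P0.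
  by field.
- by move=> x; apply: cvgMr; exact: continuous_normc_powR.
- by move=> x; rewrite mulr_ge0 ?powR_ge0.
Qed.

Lemma mean_abs_sin_powR_le p r : 1 < p -> 0 <= r < 1 ->
  (\int[circ]_x (`|sin x| * (r * normc (1 - r%:C%C * cis x) `^ (- (p + 1))))%:E <=
   ((p - 1)^-1 * (1 - r) `^ (1 - p))%:E)%E.
Proof.
move=> p1 r01; case/andP: (r01) => r0 r1.
have p10 : 0 < p - 1 by lra.
pose c := - (p - 1)^-1.
have dF x : is_derive x 1 (fun y => c * (normc (1 - r%:C%C * cis y) ^+ 2) `^ ((1 - p) / 2))
    (sin x * (r * normc (1 - r%:C%C * cis x) `^ (- (p + 1)))).
  have n0 : 0 < normc (1 - r%:C%C * cis x) ^+ 2 by rewrite exprn_gt0// normc_1Bcis_gt0.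
  have H := is_deriveZ c (@is_derive1_comp R (fun u => u `^ ((1 - p) / 2))
    (fun y => normc (1 - r%:C%C * cis y) ^+ 2) x _ _
    (is_derive1_powR ((1 - p) / 2) n0) (is_derive_sqr_normc r x)).
  apply: (is_derive_eq H); rewrite /GRing.scale /=.
  rewrite -[in LHS]powR_mulrn ?normc_ge0// -powRrM.
  have -> : 2 * ((1 - p) / 2 - 1) = - (p + 1) by field.
  by rewrite /c; field; rewrite gt_eqF.
rewrite (mean_abs_sin dF).
- have n0 x : cos x = 1 -> (normc (1 - r%:C%C * cis x) ^+ 2) `^ ((1 - p) / 2) = (1 - r) `^ (1 - p).
    move=> cx; rewrite normc_1Bcis cx (_ : 1 - 2 * r * 1 + r ^+ 2 = (1 - r) ^+ 2); last by ring.
    by rewrite -powR_mulrn ?subr_ge0 ?(ltW r1)// -powRrM; congr (_ `^ _); field.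
  have c2 : cos (2 * pi) = 1 :> R by rewrite mulr_natl cos2pi.
  rewrite (n0 0 (cos0 R)) (n0 _ c2) lee_fin.
  set A := (1 - r) `^ _; set B := _ `^ _.
  have A0 : 0 <= A by exact: powR_ge0.
  have B0 : 0 <= B by exact: powR_ge0.
  have ppi : 1 <= pi :> R by have := @pi_ge2 R; lra.
  rewrite ler_pdivrMr ?twopi_gt0// /c.
  have ip : 0 <= (p - 1)^-1 by rewrite invr_ge0 ltW.
  have h1 : 0 <= (p - 1)^-1 * B by rewrite mulr_ge0.
  have h2 : 0 <= (p - 1)^-1 * A by rewrite mulr_ge0.
  have h3 : 0 <= ((p - 1)^-1 * A) * (pi - 1) by rewrite mulr_ge0// subr_ge0.
  move: h1 h3; rewrite !mulNr !mulrN mulrBr mulr1; lra.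
- by move=> x; apply: cvgMr; exact: continuous_normc_powR.
- by move=> x; rewrite mulr_ge0 ?powR_ge0.
Qed.

Lemma mean_Re_cauchy r : 0 <= r < 1 ->
  (\int[circ]_x (Re (1 - r%:C%C * cis x)^-1)%:E = 1)%E.
Proof.
move=> /andP[r0 r1]; have nr : normc (r%:C%C : R[i]) < 1 by rewrite normcR ger0_norm.
have [i0 _] : cintegrable circ setT (fun x => (1 - r%:C%C * cis x)^-1).
  apply: (@cintegrable_circ _ _ (1 - normc (r%:C%C : R[i]))^-1).
    have := cmeasurable_cauchy (r%:C%C) 0.
    by under eq_fun do rewrite expr0 mul1r.
  by move=> x; rewrite normc_cauchy_le// normc_cis.
rewrite -EFin_Rintegral_circ//; congr (_%:E).
have -> : 1 = Re (cint circ setT (fun x => cis x ^+ 0 / (1 - r%:C%C * cis x))) :> R.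
  by rewrite (cint_cauchy 0 nr).
by apply: eq_Rintegral => x _; rewrite expr0 mul1r.
Qed.

(** Writing [|u| <= Re u + |Im u|] with [u = 1 - r cis x] splits [|u| ^ (- p)]
    into a multiple of a Poisson kernel and an exact derivative. *)
Lemma mean_inv_powR_le p r : 1 <= p -> 0 <= r < 1 ->
  (\int[circ]_x (normc (1 - r%:C%C * cis x) `^ (- p))%:E <=
   ((1 - r) `^ (1 - p))%:E +
   \int[circ]_x (`|sin x| * (r * normc (1 - r%:C%C * cis x) `^ (- (p + 1))))%:E)%E.
Proof.
move=> p1 r01; case/andP: (r01) => r0 r1.
have r10 : 0 < 1 - r by lra.
have mu : cmeasurable setT (fun x => 1 - r%:C%C * cis x : R[i]).
  apply: cmeasurableB; first exact: cmeasurable_cst.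
  by apply: cmeasurableM; [exact: cmeasurable_cst|exact: cmeasurable_cis].
have mn s : measurable_fun setT (fun x : R => normc (1 - r%:C%C * cis x) `^ s).
  exact: measurable_normc_powR.
have Re0 x : 0 <= Re (1 - r%:C%C * cis x).
  rewrite ReD ReN ReZ /= subr_ge0; apply: le_trans (_ : r * 1 <= 1); last by rewrite mulr1 ltW.
  by rewrite ler_wpM2l// cos_le1.
have ReV0 x : 0 <= Re (1 - r%:C%C * cis x)^-1 by rewrite ReV divr_ge0 ?sqr_ge0.
have mRe : measurable_fun [set: R] (fun x => Re (1 - r%:C%C * cis x)^-1).
  by case: (cmeasurableV mu).
have ms : measurable_fun [set: R]
    (fun x : R => `|sin x| * (r * normc (1 - r%:C%C * cis x) `^ (- (p + 1)))).
  apply: measurable_funM; last by apply: measurable_funM.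
  apply: measurableT_comp => //; apply: continuous_measurable_fun; exact: continuous_sin.
rewrite -[X in (_ <= X + _)%E]mule1 -(mean_Re_cauchy r01) -ge0_integralZl//; last 3 first.
- exact/measurable_EFinP.
- by move=> x _; rewrite lee_fin.
- by rewrite lee_fin powR_ge0.
rewrite -ge0_integralD//; last 4 first.
- by move=> x _; rewrite -EFinM lee_fin mulr_ge0 ?powR_ge0.
- by apply/measurable_EFinP; apply: measurable_funM.
- by move=> x _; rewrite lee_fin mulr_ge0// mulr_ge0 ?powR_ge0.
- exact/measurable_EFinP.
apply: ge0_le_integral => //.
- by move=> x _; rewrite lee_fin powR_ge0.
- by apply/measurable_EFinP; exact: mn.
- by apply/measurable_EFinP; apply: measurable_funD => //; apply: measurable_funM.
move=> x _; rewrite -EFinM -EFinD lee_fin.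
have n0 := normc_1Bcis_gt0 x r01.
have n1 : 1 - r <= normc (1 - r%:C%C * cis x).
  have := @cauchy_denominator_ge R r%:C%C (cis x); rewrite normcR ger0_norm//.
  by apply => //; rewrite normc_cis.
have nle := normc_le_ReIm (1 - r%:C%C * cis x).
rewrite ReV.
have := ler_wpM2r (powR_ge0 (normc (1 - r%:C%C * cis x)) (- (p + 1))) nle.
have -> : normc (1 - r%:C%C * cis x) * normc (1 - r%:C%C * cis x) `^ (- (p + 1)) =
    normc (1 - r%:C%C * cis x) `^ (- p).
  rewrite -{1}(powRr1 (ltW n0)) -powRD; first by congr (_ `^ _); ring.
  by rewrite (gt_eqF n0) implybT.
move=> h; apply: (le_trans h); rewrite mulrDl; apply: lerD.
  rewrite (ger0_norm (Re0 _)).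
  have -> : normc (1 - r%:C%C * cis x) `^ (- (p + 1)) =
      normc (1 - r%:C%C * cis x) `^ (1 - p) * (normc (1 - r%:C%C * cis x) ^+ 2)^-1.
    rewrite -powR_mulrn ?normc_ge0// -powRN -powRD; first by congr (_ `^ _); ring.
    by rewrite (gt_eqF n0) implybT.
  rewrite [leLHS]mulrCA; apply: ler_wpM2r; first by rewrite divr_ge0 ?sqr_ge0.
  have e s : 0 < s -> s `^ (1 - p) = (s `^ (p - 1))^-1 by move=> s0; rewrite -powRN opprB.
  rewrite !e// lef_pV2 ?posrE ?powR_gt0//.
  by apply: ge0_ler_powR; rewrite ?nnegrE ?normc_ge0 ?subr_ge0// ltW.
rewrite ImD ImN ImZ /= sub0r normrN normrM (ger0_norm r0).
by rewrite mulrAC mulrA mulrAC [r * _]mulrC mulrAC.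
Qed.

End CircleEstimates.

Section CompositionNorm.
Context {R : realType}.
Implicit Types (p t : R) (q g : {poly R[i]}).

(** The constant in the bound of [wcomp t] for [2 <= p]; it is also the density of
    the lower bound for all [p]. *)
Definition kern p t : R := t `^ (p^-1 - 1) / (1 - t) `^ p^-1.

Lemma kern_gt0 p t : 0 < t < 1 -> 0 < kern p t.
Proof. by move=> /andP[t0 t1]; rewrite divr_gt0// powR_gt0// subr_gt0. Qed.

Lemma kern_powR p t : 1 <= p -> 0 < t < 1 -> kern p t `^ p = t `^ (1 - p) / (1 - t).
Proof.
move=> p1 /andP[t0 t1]; have p0 : p != 0 by rewrite gt_eqF// (lt_le_trans _ p1).
have t10 : 0 <= 1 - t by rewrite subr_ge0 ltW.
rewrite /kern -powRN powRM ?powR_ge0// -!powRrM.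
by rewrite mulrBl mul1r mulVf// mulNr mulVf// powR_inv1.
Qed.

Lemma ln_exp_div t : 0 < t -> ln (expR 1 / t) = 1 - ln t.
Proof. by move=> t0; rewrite ln_div ?posrE ?expR_gt0// expRK. Qed.

Lemma kern_le_psi p t : 0 < t < 1 -> kern p t <= psi p t.
Proof.
move=> /andP[t0 t1]; rewrite /psi; case: eqP => [->|_]; last by [].
have t10 : 0 <= 1 - t by rewrite subr_ge0 ltW.
rewrite /kern invr1 subrr powRr0 powRr1// ler_wpM2r ?invr_ge0//.
by rewrite ln_exp_div// lerDl oppr_ge0 ln_le0// ltW.
Qed.

Lemma psi_gt0 p t : 0 < t < 1 -> 0 < psi p t.
Proof. by move=> t01; apply: lt_le_trans (kern_gt0 p t01) (kern_le_psi p t01). Qed.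

Lemma mulr_powR_le (x y p : R) : 1 <= p -> 0 <= x -> 0 <= y ->
  (x + y) `^ p <= 2 `^ p * (x `^ p + y `^ p).
Proof.
move=> p1 x0 y0; have p0 : 0 <= p by apply: le_trans p1.
wlog xy : x y x0 y0 / x <= y.
  by move=> H; case/orP: (le_total x y) => [/H|/H h]; [apply|rewrite addrC [_ `^ _ + _]addrC h].
apply: (@le_trans _ _ ((2 * y) `^ p)).
  by apply: ge0_ler_powR; rewrite ?nnegrE ?addr_ge0 ?mulr_ge0//; lra.
by rewrite powRM// ler_wpM2l ?powR_ge0// lerDr powR_ge0.
Qed.

Lemma cmeasurable_wcomp_cis t q : cmeasurable setT (fun x => wcomp t q (cis x)).
Proof. by apply: cmeasurable_wcomp; exact: cmeasurable_cis. Qed.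

Lemma measurable_mean_integrand (f : R -> R[i]) p : cmeasurable setT f ->
  measurable_fun [set: R] (fun x => (normc (f x) `^ p)%:E).
Proof. by move=> mf; apply/measurable_EFinP; exact: measurable_normc_powR. Qed.

Lemma measurable_wt_sqr t p q : measurable_fun [set: R]
  (fun x => (normc (wt t (cis x)) ^+ 2 * normc q.[phi t (cis x)] `^ p)%:E).
Proof.
apply/measurable_EFinP; apply: measurable_funM.
  apply: measurable_funX; apply: measurable_normc; apply: cmeasurable_wt.
  exact: cmeasurable_cis.
apply: measurable_normc_powR; apply: cmeasurable_horner; apply: cmeasurable_phi.
exact: cmeasurable_cis.
Qed.

Lemma mean_le_wt_sqr p t q (f : R -> R[i]) (c : R) : 1 <= p -> 0 < t < 1 ->
  cmeasurable setT f -> 0 <= c ->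
  (forall x, normc (f x) `^ p <=
     c * (normc (wt t (cis x)) ^+ 2 * normc q.[phi t (cis x)] `^ p)) ->
  (\int[circ]_x (normc (f x) `^ p)%:E <=
   (c / (t * (1 - t)))%:E * \int[circ]_y (normc q.[cis y] `^ p)%:E)%E.
Proof.
move=> p1 t01 mf c0 H; rewrite EFinM -muleA.
apply: le_trans (lee_wpmul2l _ (mean_wt_sqr_le q p1 t01)); last by rewrite lee_fin.
have n0 x : 0 <= normc (wt t (cis x)) ^+ 2 * normc q.[phi t (cis x)] `^ p.
  by rewrite mulr_ge0 ?sqr_ge0 ?powR_ge0.
rewrite -ge0_integralZl//; last 2 first.
- exact: measurable_wt_sqr.
- by move=> x _; rewrite lee_fin.
apply: ge0_le_integral => //.
- by move=> x _; rewrite lee_fin powR_ge0.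
- exact: measurable_mean_integrand.
- apply/measurable_EFinP; apply: measurable_funM => //.
  by apply/measurable_EFinP; exact: measurable_wt_sqr.
- by move=> x _; rewrite -EFinM lee_fin.
Qed.

(** Since [2 <= p], the powers of [wt t] in excess of the square are bounded by
    powers of [t^-1]. *)
Lemma mean_wcomp_le_sharp p t q : 2 <= p -> 0 < t < 1 ->
  (\int[circ]_x (normc (wcomp t q (cis x)) `^ p)%:E <=
   (kern p t `^ p)%:E * \int[circ]_y (normc q.[cis y] `^ p)%:E)%E.
Proof.
move=> p2 t01; have p1 : 1 <= p by lra.
case/andP: (t01) => t0 t1; have t10 : 0 < 1 - t by rewrite subr_gt0.
have -> : kern p t `^ p = t `^ (2 - p) / (t * (1 - t)).
  rewrite kern_powR// (_ : 1 - p = (2 - p) - 1); last by ring.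
  rewrite powRD ?(gt_eqF t0) ?implybT// powR_inv1 ?(ltW t0)//.
  by field; rewrite (gt_eqF t0) (gt_eqF t10).
apply: mean_le_wt_sqr => //; first exact: cmeasurable_wcomp_cis.
  exact: powR_ge0.
move=> x; have c1 : normc (cis x) <= 1 by rewrite normc_cis.
rewrite Normc.normcM powRM ?normc_ge0// mulrA; apply: ler_wpM2r; first exact: powR_ge0.
have w0 : 0 < normc (wt t (cis x)) by rewrite normc_gt0 wt_neq0.
rewrite -powR_mulrn ?normc_ge0// -{1}(subrK 2 p) powRD ?(gt_eqF w0) ?implybT//.
apply: ler_wpM2r; first exact: powR_ge0.
have -> : t `^ (2 - p) = (t^-1) `^ (p - 2).
  by rewrite -[in RHS]powR_inv1 ?(ltW t0)// -powRrM; congr (_ `^ _); ring.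
apply: ge0_ler_powR; rewrite ?nnegrE ?normc_ge0 ?invr_ge0 ?(ltW t0) ?subr_ge0//.
exact: normc_wt_le.
Qed.

(** For a polynomial vanishing at [0] the factor [phi t] compensates the loss
    incurred by the weight when [p < 2]. *)
Lemma mean_wcomp_mulX_le p t g : 1 <= p -> 0 < t < 1 ->
  (\int[circ]_x (normc (wcomp t (g * 'X) (cis x)) `^ p)%:E <=
   (kern p t `^ p)%:E * \int[circ]_y (normc g.[cis y] `^ p)%:E)%E.
Proof.
move=> p1 t01.
case/andP: (t01) => t0 t1; have t10 : 0 < 1 - t by rewrite subr_gt0.
have -> : kern p t `^ p = t `^ (2 - p) / (t * (1 - t)).
  rewrite kern_powR// (_ : 1 - p = (2 - p) - 1); last by ring.
  rewrite powRD ?(gt_eqF t0) ?implybT// powR_inv1 ?(ltW t0)//.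
  by field; rewrite (gt_eqF t0) (gt_eqF t10).
apply: mean_le_wt_sqr => //; first exact: cmeasurable_wcomp_cis.
  exact: powR_ge0.
move=> x; have c1 : normc (cis x) <= 1 by rewrite normc_cis.
have w0 : 0 < normc (wt t (cis x)) by rewrite normc_gt0 wt_neq0.
have -> : normc (wcomp t (g * 'X) (cis x)) =
    t * normc (wt t (cis x)) ^+ 2 * normc g.[phi t (cis x)].
  rewrite /wcomp hornerM hornerX {2}/phi !Normc.normcM normcR gtr0_norm//; ring.
rewrite powRM ?mulr_ge0 ?exprn_ge0 ?normc_ge0 ?(ltW t0)// [leRHS]mulrA.
apply: ler_wpM2r; first exact: powR_ge0.
rewrite powRM ?exprn_ge0 ?normc_ge0 ?(ltW t0)//.
rewrite -powR_mulrn ?normc_ge0// -powRrM.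
have -> : 2 * p = (2 * p - 2) + 2 by ring.
rewrite [in leLHS]powRD ?(gt_eqF w0) ?implybT// mulrA.
apply: ler_wpM2r; first exact: powR_ge0.
have -> : t `^ (2 - p) = t `^ p * (t^-1) `^ (2 * p - 2).
  rewrite -[t^-1]powR_inv1 ?(ltW t0)// -powRrM -powRD; last by rewrite (gt_eqF t0) implybT.
  by congr (_ `^ _); ring.
apply: ler_wpM2l; first exact: powR_ge0.
apply: ge0_ler_powR; rewrite ?nnegrE ?normc_ge0 ?invr_ge0 ?(ltW t0)//; first lra.
exact: normc_wt_le.
Qed.

Lemma powR_1Bp_le_kern p t : 1 <= p -> 0 < t < 1 -> t `^ (1 - p) <= kern p t `^ p.
Proof.
move=> p1 t01; rewrite kern_powR//; case/andP: t01 => t0 t1.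
by rewrite ler_peMr ?powR_ge0// invf_ge1 ?subr_gt0//; lra.
Qed.

(** The image of the constant [1]; for [p = 1] its mean is logarithmic in [t], and
    this is the source of the logarithm in [psi]. *)
Lemma mean_wt_le p : 1 <= p -> exists2 C : R, 0 < C & forall t, 0 < t < 1 ->
  (\int[circ]_x (normc (wt t (cis x)) `^ p)%:E <= (C * psi p t `^ p)%:E)%E.
Proof.
move=> p1; have p0 : 0 < p by lra.
have wE t : (fun x => (normc (wt t (cis x)) `^ p)%:E) =
    (fun x : R => (normc (1 - (1 - t)%:C%C * cis x) `^ (- p))%:E).
  apply/funext => x; rewrite /wt Normc.normcV -powR_inv1 ?normc_ge0// -powRrM.
  by rewrite mulN1r.
have psip t : 0 < t < 1 -> t `^ (1 - p) <= psi p t `^ p.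
  move=> t01; apply: le_trans (powR_1Bp_le_kern p1 t01) _.
  apply: ge0_ler_powR; rewrite ?nnegrE ?(ltW p0) ?(ltW (kern_gt0 _ _)) ?(ltW (psi_gt0 _ _))//.
  exact: kern_le_psi.
have [p1'|p1'] := ltP 1 p.
  exists (1 + (p - 1)^-1) => [|t t01]; first by rewrite addr_gt0// invr_gt0 subr_gt0.
  rewrite wE; have r01 : 0 <= 1 - t < 1 by case/andP: t01 => *; apply/andP; split; lra.
  apply: le_trans (mean_inv_powR_le p1 r01) _.
  apply: le_trans (leeD2l _ (mean_abs_sin_powR_le p1' r01)) _.
  rewrite subKr -EFinD lee_fin -{1}[_ `^ _]mul1r -mulrDl ler_wpM2l ?psip//.
  by rewrite addr_ge0// invr_ge0; lra.
have {p1'} p1' : p = 1 by apply/eqP; rewrite eq_le p1 p1'.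
exists 2 => // t t01; case/andP: (t01) => t0 t1.
rewrite wE; have r01 : 0 <= 1 - t < 1 by apply/andP; split; lra.
apply: le_trans (mean_inv_powR_le p1 r01) _; rewrite p1' (_ : 1 + 1 = 2) //.
rewrite mean_log// subrr powRr0 -EFinD lee_fin powRr1 ?(ltW (psi_gt0 _ _))//.
rewrite /psi eqxx ln_exp_div// subKr ln_div ?posrE//; last lra.
have l1 : ln (1 + (1 - t)) <= 1.
  by apply: le_trans (le_ln1Dx _) _; lra.
have lt0 : ln t <= 0 by rewrite ln_le0// ltW.
have ppi : pi^-1 <= 1 :> R.
  by rewrite invf_le1 ?pi_gt0//; have := @pi_ge2 R; lra.
have pi0 : 0 <= pi^-1 :> R by rewrite invr_ge0 ltW// pi_gt0.
have a : pi^-1 * (ln (1 + (1 - t)) - ln t) <= 1 - ln t.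
  apply: (@le_trans _ _ (pi^-1 * (1 - ln t))); first by rewrite ler_wpM2l//; lra.
  by rewrite ler_piMl//; lra.
apply: (@le_trans _ _ (2 * (1 - ln t))); first lra.
rewrite mulrA ler_peMr//; first by lra.
by rewrite invf_ge1; lra.
Qed.

Lemma integral_circ_cst (c : R) : (\int[circ]_x c%:E = c%:E)%E.
Proof.
by rewrite -[RHS]mule1 -(probability_setT circ) -integral_cst.
Qed.

Lemma mean_horner_ge0 p q : (0 <= \int[circ]_y (normc q.[cis y] `^ p)%:E)%E.
Proof. by apply: integral_ge0 => x _; rewrite lee_fin powR_ge0. Qed.

Lemma normc_horner0_le p q : 1 <= p ->
  ((normc q.[0] `^ p)%:E <= \int[circ]_y (normc q.[cis y] `^ p)%:E)%E.
Proof.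
move=> p1; have n0 : normc (0 : R[i]) < 1 by rewrite Normc.normc0.
apply: le_trans (poisson_powR_le p1 n0 (disc_algebra_poly q) (cmeasurable_horner_cis q)) _.
rewrite le_eqVlt; apply/orP; left; apply/eqP; apply: eq_integral => x _.
by rewrite /poisson Normc.normc0 subr0 normc_cis !expr1n expr0n subr0 invr1 !mulr1.
Qed.

Lemma integral_normc_powRD_le p (f g : R -> R[i]) : 1 <= p ->
  cmeasurable setT f -> cmeasurable setT g ->
  (\int[circ]_x (normc (f x + g x) `^ p)%:E <=
   (2 `^ p)%:E * (\int[circ]_x (normc (f x) `^ p)%:E + \int[circ]_x (normc (g x) `^ p)%:E))%E.
Proof.
move=> p1 mf mg; have p0 : 0 <= p by apply: le_trans p1.
have mf' := measurable_mean_integrand p mf; have mg' := measurable_mean_integrand p mg.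
rewrite -ge0_integralD//; last 2 first.
- by move=> x _; rewrite lee_fin powR_ge0.
- by move=> x _; rewrite lee_fin powR_ge0.
rewrite -ge0_integralZl//; last 2 first.
- exact: emeasurable_funD.
- by move=> x _; rewrite -EFinD lee_fin addr_ge0 ?powR_ge0.
apply: ge0_le_integral => //.
- by move=> x _; rewrite lee_fin powR_ge0.
- by apply: measurable_mean_integrand; exact: cmeasurableD.
- apply/measurable_EFinP; apply: measurable_funM => //.
  by apply: measurable_funD; exact: measurable_normc_powR.
move=> x _; rewrite -EFinD -EFinM lee_fin; apply: le_trans (mulr_powR_le p1 _ _); rewrite ?normc_ge0//.
by apply: ge0_ler_powR; rewrite ?nnegrE ?addr_ge0 ?normc_ge0 ?ler_normcD.
Qed.

(** The polynomial is split into its constant term and a multiple of ['X]; both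
    parts are controlled by its own mean. *)
Lemma mean_wcomp_le p : 1 <= p -> exists2 B : R, 0 < B & forall t q, 0 < t < 1 ->
  (\int[circ]_x (normc (wcomp t q (cis x)) `^ p)%:E <=
   ((B * psi p t) `^ p)%:E * \int[circ]_y (normc q.[cis y] `^ p)%:E)%E.
Proof.
move=> p1; have p0 : 0 < p by lra.
have [C C0 HC] := mean_wt_le p1.
pose D := 2 `^ p * (C + 2 `^ p * 2).
have D0 : 0 < D by rewrite mulr_gt0 ?powR_gt0// addr_gt0// mulr_gt0// powR_gt0.
exists (D `^ p^-1) => [|t q t01]; first exact: powR_gt0.
have psi0 := psi_gt0 p t01; have kern0 := kern_gt0 p t01.
rewrite powRM ?powR_ge0 ?(ltW psi0)// -powRrM mulVf ?gt_eqF// powRr1 ?(ltW D0)//.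
have q0 := normc_horner0_le q p1.
have Q0 := mean_horner_ge0 p q.
move: q0 Q0; elim/poly_ind: q => [|g c _] q0 Q0.
  under eq_integral do rewrite /wcomp horner0 mulr0 Normc.normc0 powR0 ?gt_eqF//.
  by rewrite integral0; apply: mule_ge0 => //; rewrite lee_fin mulr_ge0 ?powR_ge0// ltW.
set Q := (\int[_]_y _)%E in q0 Q0 *.
rewrite !hornerE in q0.
have gQ : (\int[circ]_y (normc g.[cis y] `^ p)%:E <= (2 `^ p * 2)%:E * Q)%E.
  have -> : (\int[circ]_y (normc g.[cis y] `^ p)%:E =
      \int[circ]_y (normc ((g * 'X + c%:P).[cis y] + (- c)) `^ p)%:E)%E.
    apply: eq_integral => y _; rewrite !hornerE addrK Normc.normcM normc_cis mulr1//.
  apply: le_trans (integral_normc_powRD_le p1 (cmeasurable_horner_cis _) (cmeasurable_cst _ _)) _.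
  rewrite EFinM -muleA; apply: lee_wpmul2l; first by rewrite lee_fin powR_ge0.
  rewrite -/Q integral_circ_cst normcN.
  apply: le_trans (leeD2l _ q0) _.
  by rewrite (_ : 2%:E = 1 + 1)%E// ge0_muleDl// !mul1e.
have -> : (\int[circ]_x (normc (wcomp t (g * 'X + c%:P) (cis x)) `^ p)%:E =
    \int[circ]_x (normc (c * wt t (cis x) + wcomp t (g * 'X) (cis x)) `^ p)%:E)%E.
  apply: eq_integral => x _; congr (normc _ `^ p)%:E; rewrite /wcomp hornerD hornerC.
  ring.
have mw : cmeasurable setT (fun x : R => c * wt t (cis x)).
  apply: cmeasurableM; first exact: cmeasurable_cst.
  by apply: cmeasurable_wt; exact: cmeasurable_cis.
apply: le_trans (integral_normc_powRD_le p1 mw (cmeasurable_wcomp_cis t _)) _.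
have kp : kern p t `^ p <= psi p t `^ p.
  apply: ge0_ler_powR; rewrite ?nnegrE ?(ltW p0) ?(ltW kern0) ?(ltW psi0)//.
  exact: kern_le_psi.
have e1 : (\int[circ]_x (normc (c * wt t (cis x)) `^ p)%:E <= (C * psi p t `^ p)%:E * Q)%E.
  have -> : (\int[circ]_x (normc (c * wt t (cis x)) `^ p)%:E =
     (normc c `^ p)%:E * \int[circ]_x (normc (wt t (cis x)) `^ p)%:E)%E.
    rewrite -ge0_integralZl//; last 3 first.
    - by apply: measurable_mean_integrand; apply: cmeasurable_wt; exact: cmeasurable_cis.
    - by move=> x _; rewrite lee_fin powR_ge0.
    - by rewrite lee_fin powR_ge0.
    by apply: eq_integral => x _; rewrite -EFinM Normc.normcM powRM ?normc_ge0.
  rewrite muleC; apply: lee_pmul; last exact: q0; last exact: HC.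
    by apply: integral_ge0 => x _; rewrite lee_fin powR_ge0.
  by rewrite lee_fin powR_ge0.
have e2 : (\int[circ]_x (normc (wcomp t (g * 'X) (cis x)) `^ p)%:E <=
    (2 `^ p * 2 * psi p t `^ p)%:E * Q)%E.
  apply: le_trans (mean_wcomp_mulX_le g p1 t01) _.
  rewrite [(2 `^ p * 2 * _)%R]mulrC EFinM -muleA; apply: lee_pmul; last exact: gQ.
  - by rewrite lee_fin powR_ge0.
  - exact: mean_horner_ge0.
  - by rewrite lee_fin.
apply: le_trans (lee_wpmul2l _ (leeD e1 e2)) _; first by rewrite lee_fin powR_ge0.
rewrite -ge0_muleDl ?lee_fin ?mulr_ge0 ?powR_ge0 ?(ltW C0)// -EFinD muleA -EFinM.
by rewrite -mulrDl /D mulrA.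
Qed.

End CompositionNorm.

(** * The integral representation and the upper bound *)

Section CircleNorm.
Context {R : realType}.
Implicit Types (p r : R) (f g : R -> R[i]) (q : {poly R[i]}).

Definition lpnorm p f : \bar R := ((\int[circ]_x (normc (f x) `^ p)%:E) `^ p^-1)%E.

Lemma lpnorm_ge0 p f : (0 <= lpnorm p f)%E.
Proof. exact: poweR_ge0. Qed.

Lemma integral_mean_lpnorm p (F : R[i] -> R[i]) r :
  cmeasurable setT (fun x => F (circle_pt r x)) ->
  integral_mean p F r = lpnorm p (fun x => F (circle_pt r x)).
Proof. exact: integral_meanE. Qed.

Lemma lpnorm_lnorm p f : lpnorm p f = ('N[circ]_p%:E[EFin \o (fun x => normc (f x))])%E.
Proof.
rewrite unlock /lpnorm; congr (_ `^ _)%E; apply: eq_integral => x _ /=.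
by rewrite ger0_norm ?normc_ge0.
Qed.

Lemma lpnorm_le_normc p f g : 1 <= p -> cmeasurable setT f -> cmeasurable setT g ->
  (forall x, normc (f x) <= normc (g x)) -> (lpnorm p f <= lpnorm p g)%E.
Proof.
move=> p1 mf mg fg; have p0 : 0 < p by lra.
apply: gt0_ler_poweR.
- by rewrite invr_ge0 ltW.
- by rewrite in_itv/= leey andbT; apply: integral_ge0 => x _; rewrite lee_fin powR_ge0.
- by rewrite in_itv/= leey andbT; apply: integral_ge0 => x _; rewrite lee_fin powR_ge0.
apply: ge0_le_integral => //.
- by move=> x _; rewrite lee_fin powR_ge0.
- exact: measurable_mean_integrand.
- exact: measurable_mean_integrand.
by move=> x _; rewrite lee_fin ge0_ler_powR ?nnegrE ?normc_ge0 ?(ltW p0).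
Qed.

Lemma lpnormD p f g : 1 <= p -> cmeasurable setT f -> cmeasurable setT g ->
  (lpnorm p (fun x => f x + g x)%R <= lpnorm p f + lpnorm p g)%E.
Proof.
move=> p1 mf mg.
pose h x : R[i] := (normc (f x) + normc (g x))%:C%C.
have mh : measurable_fun [set: R] (fun x => normc (f x) + normc (g x)).
  by apply: measurable_funD; exact: measurable_normc.
apply: (@le_trans _ _ (lpnorm p h)).
  apply: lpnorm_le_normc => //; first exact: cmeasurableD.
  by move=> x; rewrite normcR ger0_norm ?addr_ge0 ?normc_ge0 ?ler_normcD.
have -> : lpnorm p h = ('N[circ]_p%:E[EFin \o ((fun x => normc (f x)) \+ (fun x => normc (g x)))%R])%E.
  rewrite lpnorm_lnorm; apply: eq_Lnorm => x /=.
  by rewrite normcR ger0_norm ?addr_ge0 ?normc_ge0.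
rewrite !lpnorm_lnorm; apply: minkowski_EFin => //; exact: measurable_normc.
Qed.

Lemma integral_le_lpnorm p f (N : R) : 1 <= p -> 0 <= N ->
  (lpnorm p f <= N%:E)%E ->
  (\int[circ]_x (normc (f x) `^ p)%:E <= (N `^ p)%:E)%E.
Proof.
move=> p1 N0 H; have p0 : 0 < p by lra.
have i0 : (0 <= \int[circ]_x (normc (f x) `^ p)%:E)%E.
  by apply: integral_ge0 => x _; rewrite lee_fin powR_ge0.
have -> : (\int[circ]_x (normc (f x) `^ p)%:E = lpnorm p f `^ p)%E.
  by rewrite /lpnorm -poweRrM mulVf ?gt_eqF// poweRe1.
rewrite -poweR_EFin; apply: gt0_ler_poweR => //; first exact: ltW.
- by rewrite in_itv/= leey andbT lpnorm_ge0.
- by rewrite in_itv/= leey andbT lee_fin.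
Qed.

Lemma lpnorm_le_integral p f (N : R) : 1 <= p -> 0 <= N ->
  (\int[circ]_x (normc (f x) `^ p)%:E <= (N `^ p)%:E)%E ->
  (lpnorm p f <= N%:E)%E.
Proof.
move=> p1 N0 H; have p0 : 0 < p by lra.
have -> : N%:E = (((N `^ p)%:E) `^ p^-1)%E.
  by rewrite poweR_EFin -powRrM mulfV ?gt_eqF// powRr1.
apply: gt0_ler_poweR => //; first by rewrite invr_ge0 ltW.
- by rewrite in_itv/= leey andbT; apply: integral_ge0 => x _; rewrite lee_fin powR_ge0.
- by rewrite in_itv/= leey andbT lee_fin powR_ge0.
Qed.

Lemma lpnorm_le_cst p f (N : R) : 1 <= p -> 0 <= N -> cmeasurable setT f ->
  (forall x, normc (f x) <= N) -> (lpnorm p f <= N%:E)%E.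
Proof.
move=> p1 N0 mf fN; apply: lpnorm_le_integral => //.
rewrite -integral_circ_cst; apply: ge0_le_integral => //.
- by move=> x _; rewrite lee_fin powR_ge0.
- exact: measurable_mean_integrand.
move=> x _; rewrite lee_fin ge0_ler_powR ?nnegrE ?normc_ge0//; lra.
Qed.

Lemma cmeasurable_horner_circle q r : cmeasurable setT (fun x => q.[circle_pt r x]).
Proof. by apply: cmeasurable_horner; exact: cmeasurable_circle_pt. Qed.

Lemma hardy_norm_ge0 p (F : R[i] -> R[i]) : (0 <= hardy_norm p F)%E.
Proof.
apply: le_trans (ereal_sup_ubound _); last first.
  by exists 0 => //; rewrite /= in_itv/= lexx ltr01.
exact: poweR_ge0.
Qed.

Lemma integral_mean_le_hardy p (F : R[i] -> R[i]) r : 0 <= r < 1 ->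
  (integral_mean p F r <= hardy_norm p F)%E.
Proof. by move=> r01; apply: ereal_sup_ubound; exists r => //=; rewrite in_itv/=. Qed.

Lemma horner_lipschitz q : exists2 L : R, 0 < L & forall z w : R[i],
  normc z <= 1 -> normc w <= 1 -> normc (q.[z] - q.[w]) <= L * normc (z - w).
Proof.
exists (1 + \sum_(i < size q) normc q`_i * i%:R).
  by rewrite ltr_wpDr// sumr_ge0// => i _; rewrite mulr_ge0 ?normc_ge0.
move=> z w z1 w1; rewrite !horner_coef -sumrB mulrDl mul1r mulr_suml.
apply: ler_wpDl; first exact: normc_ge0.
elim/big_ind2: _ => [|a b c d ab cd|i _]; first by rewrite Normc.normc0.
  by apply: le_trans (ler_normcD _ _) _; exact: lerD.
rewrite -mulrBr Normc.normcM -mulrA ler_wpM2l ?normc_ge0//.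
by have := normc_exprB_le i z1 w1; rewrite expr1n mulr1.
Qed.

(** A polynomial is uniformly continuous on the closed disc, so its norm may be
    computed on the unit circle. *)
Lemma lpnorm_horner_le p q : 1 <= p ->
  (lpnorm p (fun x => q.[cis x]) <= hardy_norm p (horner q))%E.
Proof.
move=> p1; have [L L0 HL] := horner_lipschitz q.
apply/lee_addgt0Pr => e e0.
pose d := Num.min 1 (e / L).
have d0 : 0 < d by rewrite lt_min ltr01 divr_gt0.
have d1 : d <= 1 by rewrite ge_min lexx.
have dL : L * d <= e by rewrite mulrC -ler_pdivlMr// ge_min lexx orbT.
pose r := 1 - d.
have r01 : 0 <= r < 1 by rewrite /r; apply/andP; split; lra.
have mc := cmeasurable_horner_cis q.
have mr := cmeasurable_horner_circle q r.
have -> : (fun x => q.[cis x]) = (fun x : R => q.[circle_pt r x] + (q.[cis x] - q.[circle_pt r x])).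
  by apply/funext => x; rewrite addrC subrK.
apply: le_trans (lpnormD p1 mr (cmeasurableB mc mr)) _; apply: leeD.
  by rewrite -integral_mean_lpnorm//; exact: integral_mean_le_hardy.
apply: lpnorm_le_cst => //; [exact: ltW|exact: cmeasurableB|move=> x].
apply: le_trans (HL _ _ _ _) _; first by rewrite normc_cis.
  by rewrite normc_circle_pt; case/andP: r01 => r0 r1; rewrite ger0_norm// ltW.
have -> : cis x - circle_pt r x = d%:C%C * cis x.
  by rewrite circle_ptE /r rmorphB rmorph1; ring.
by rewrite Normc.normcM normc_cis mulr1 normcR gtr0_norm.
Qed.

End CircleNorm.

Section NegativeBinomial.
Context {R : realType}.
Implicit Types (x : R[i]) (r : R).

Lemma binomial_step (F : fieldType) (y : F) k N :
  (1 - y) * \sum_(n < N) 'C(n + k.+1, k.+1)%:R * y ^+ n =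
  \sum_(n < N) 'C(n + k, k)%:R * y ^+ n - 'C(N + k, k.+1)%:R * y ^+ N.
Proof.
elim: N => [|N IH]; first by rewrite !big_ord0 bin_small// mul0r subr0 mulr0.
rewrite !big_ord_recr /= mulrDr IH addSn addnS binS natrD exprS; ring.
Qed.

Lemma binomial_partial_le r k N : 0 <= r < 1 ->
  \sum_(n < N) 'C(n + k, k)%:R * r ^+ n <= (1 - r) ^- k.+1.
Proof.
move=> /andP[r0 r1]; have r10 : 0 < 1 - r by lra.
elim: k => [|k IH].
  have H : (1 - r) * \sum_(n < N) r ^+ n <= 1.
    have -> : (1 - r) * \sum_(n < N) r ^+ n = 1 - r ^+ N.
      by apply: oppr_inj; rewrite -mulNr !opprB -subrX1.
    by rewrite gerBl exprn_ge0.
  rewrite expr1 -[leRHS]mulr1 ler_pdivlMl//; apply: le_trans H.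
  rewrite ler_pM2l// le_eqVlt; apply/orP; left; apply/eqP; apply: eq_bigr => n _.
  by rewrite bin0 mul1r.
rewrite exprS invfM ler_pdivlMl//; apply: le_trans IH.
by rewrite binomial_step gerBl mulr_ge0// exprn_ge0.
Qed.

Lemma binomial_geometric_small r k (e : R) : 0 <= r < 1 -> 0 < e ->
  exists N0, forall N, (N0 <= N)%N -> 'C(N + k, k)%:R * r ^+ N <= e.
Proof.
move=> r01 e0; case/andP: (r01) => r0 r1.
pose s := (1 + r) / 2.
have s01 : 0 <= s < 1 by rewrite /s; apply/andP; split; lra.
have s0 : 0 < s by rewrite /s; lra.
have s1 : s < 1 by rewrite /s; lra.
pose M := (1 - s) ^- k.+1.
have M0 : 0 < M by rewrite invr_gt0 exprn_gt0// subr_gt0.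
have rs : 0 <= r / s < 1.
  by rewrite divr_ge0 ?(ltW s0)//= ltr_pdivrMr// mul1r /s; lra.
have [N0 hN0] := geometric_small rs (divr_gt0 e0 M0).
exists N0 => N N0N.
have h1 : 'C(N + k, k)%:R * s ^+ N <= M.
  apply: le_trans (binomial_partial_le k N.+1 s01); rewrite big_ord_recr /= lerDr.
  by rewrite sumr_ge0// => i _; rewrite mulr_ge0// exprn_ge0// ltW.
have -> : 'C(N + k, k)%:R * r ^+ N = ('C(N + k, k)%:R * s ^+ N) * (r / s) ^+ N.
  by rewrite -mulrA -exprMn mulrCA divff ?gt_eqF// mulr1.
apply: (@le_trans _ _ (M * (e / M))); last by rewrite mulrCA divff ?gt_eqF// mulr1.
case/andP: rs => a b; apply: ler_pM => //; rewrite ?exprn_ge0//.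
  by rewrite mulr_ge0// exprn_ge0// ltW.
by apply: le_trans hN0; rewrite ler_wiXn2l// ltW.
Qed.

Lemma binomial_series_uniform r k (e : R) : 0 <= r < 1 -> 0 < e ->
  exists N0, forall N x, (N0 <= N)%N -> normc x <= r ->
    normc (\sum_(n < N) 'C(n + k, k)%:R * x ^+ n - (1 - x) ^- k.+1) <= e.
Proof.
move=> r01; case/andP: (r01) => r0 r1; have r10 : 0 < 1 - r by lra.
have den x : normc x <= r -> 1 - r <= normc (1 - x).
  move=> xr; apply: le_trans (lerB_normc _ _); rewrite Normc.normc1.
  by rewrite lerD2l lerN2.
have ne0 x : normc x <= r -> 1 - x != 0.
  by move=> xr; rewrite -normc_gt0; apply: lt_le_trans (den _ xr).
elim: k e => [|k IH] e e0.
  have [N0 hN0] := binomial_geometric_small 0 r01 (mulr_gt0 e0 r10).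
  exists N0 => N x N0N xr.
  have -> : \sum_(n < N) 'C(n + 0, 0)%:R * x ^+ n - (1 - x) ^- 1 = - (x ^+ N / (1 - x)).
    have S : (1 - x) * \sum_(n < N) 'C(n + 0, 0)%:R * x ^+ n = 1 - x ^+ N.
      under eq_bigr do rewrite bin0 mul1r.
      by apply: oppr_inj; rewrite -mulNr !opprB -subrX1.
    apply: (mulfI (ne0 _ xr)); rewrite mulrBr S expr1 divff ?ne0//.
    by rewrite mulrN mulrCA divff ?ne0// mulr1; ring.
  rewrite normcN Normc.normcM normcX Normc.normcV ler_pdivrMr ?normc_gt0 ?ne0//.
  apply: (@le_trans _ _ (e * (1 - r))); last by rewrite ler_pM2l// den.
  apply: le_trans (hN0 N N0N); rewrite bin0 mul1r.
  by rewrite lerXn2r ?nnegrE ?normc_ge0.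
have e20 : 0 < e * (1 - r) / 2 by rewrite divr_gt0 ?mulr_gt0.
have [N1 hN1] := IH _ e20.
have [N2 hN2] := binomial_geometric_small k.+1 r01 e20.
exists (maxn N1 N2) => N x; rewrite geq_max => /andP[N1N N2N] xr.
have x0 := ne0 _ xr.
have -> : \sum_(n < N) 'C(n + k.+1, k.+1)%:R * x ^+ n - (1 - x) ^- k.+2 =
  ((\sum_(n < N) 'C(n + k, k)%:R * x ^+ n - (1 - x) ^- k.+1) -
    'C(N + k, k.+1)%:R * x ^+ N) / (1 - x).
  apply: (mulfI x0); rewrite mulrBr binomial_step [_ * (_ / _)]mulrCA divff// mulr1.
  rewrite exprS invfM mulrA divff// mul1r; ring.
rewrite Normc.normcM Normc.normcV ler_pdivrMr ?normc_gt0//.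
apply: (@le_trans _ _ (e * (1 - r))); last by rewrite ler_pM2l// den.
apply: le_trans (ler_normcB _ _) _; rewrite [leRHS]splitr; apply: lerD; first exact: hN1.
apply: le_trans (hN2 N N2N).
rewrite Normc.normcM normcX; apply: ler_pM; rewrite ?normc_ge0 ?exprn_ge0 ?normc_ge0//.
  have -> : ('C(N + k, k.+1)%:R : R[i]) = ('C(N + k, k.+1)%:R : R)%:C%C by rewrite rmorph_nat.
  by rewrite normcR normr_nat ler_nat addnS leq_bin2l.
by rewrite lerXn2r ?nnegrE ?normc_ge0.
Qed.

End NegativeBinomial.

Section IntegralRepresentation.
Context {R : realType}.
Context (mu : {finite_measure set R -> \bar R}).
Implicit Types (p r t : R) (q : {poly R[i]}) (z : R[i]).

Local Notation D := (`]0%R, 1%R[%classic : set R).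

Lemma mitv01 : measurable D.
Proof. exact: measurable_itv. Qed.

Lemma itv01P t : D t -> 0 < t < 1.
Proof. by rewrite /= in_itv. Qed.

Lemma cvg_normcP (u : nat -> R[i]) (v : R[i]) :
  (u : nat -> R[i]^o) @ \oo --> (v : R[i]^o) <->
  forall e : R, 0 < e -> exists N0, forall N, (N0 <= N)%N -> normc (u N - v) <= e.
Proof.
split=> [cv e e0|H].
  have e0' : (0 : R[i]) < e%:C%C by rewrite ltcR.
  have /cvgrPdist_le /(_ _ e0') [N0 _ hN0] := cv.
  exists N0 => N N0N; have := hN0 N N0N.
  by rewrite /= distrC normr_normc lecR.
apply/cvgrPdist_le => e e0.
have [eI e0'] : Im e = 0 /\ 0 < Re e by move: e0; rewrite ltcE => /andP[/eqP].
have [N0 hN0] := H _ e0'; exists N0 => // N N0N.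
have := hN0 N N0N; rewrite distrC normr_normc /=.
have -> : e = (Re e)%:C%C by apply: eqcP.
by rewrite lecR.
Qed.

Lemma cint_real (h : R -> R) : cint mu D (fun t => (h t)%:C%C) = (\int[mu]_(t in D) h t)%:C%C.
Proof. by apply: eqcP => //=; rewrite Rintegral_cst ?mul0r//; exact: mitv01. Qed.

Lemma cmeasurable_wcomp_pair d (T : measurableType d) (f : T -> R) (g : T -> R[i]) q :
  measurable_fun setT f -> cmeasurable setT g ->
  cmeasurable setT (fun u => wcomp (f u) q (g u)).
Proof.
move=> mf mg; have mw : cmeasurable setT (fun u => wt (f u) (g u)).
  apply: cmeasurableV; apply: cmeasurableB; first exact: cmeasurable_cst.
  apply: cmeasurableM => //; apply: cmeasurable_real; exact: measurable_funB.
by apply: cmeasurableM => //; apply: cmeasurable_horner; apply: cmeasurableM.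
Qed.

Lemma cmeasurable_wcomp_time q z (A : set R) : cmeasurable A (fun t => wcomp t q z).
Proof.
have [m1 m2] : cmeasurable setT (fun t => wcomp t q z).
  by apply: cmeasurable_wcomp_pair => //; exact: cmeasurable_cst.
by split; exact: measurable_funTS.
Qed.

Lemma normc_wt_disc t z : 0 < t < 1 -> normc z < 1 ->
  normc (wt t z) <= (1 - normc z)^-1.
Proof.
move=> /andP[t0 t1] z1; rewrite Normc.normcV lef_pV2 ?posrE ?subr_gt0//; last first.
  by rewrite normc_gt0 wt_denominator_neq0 ?t0// ltW.
apply: le_trans (lerB_normc _ _); rewrite Normc.normc1 lerD2l lerN2.
rewrite Normc.normcM normcR ger0_norm ?subr_ge0 ?(ltW t1)//.
by rewrite ler_piMl ?normc_ge0//; lra.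
Qed.

Lemma normc_wcomp_le q z : normc z < 1 -> exists2 M : R, 0 <= M &
  forall t, 0 < t < 1 -> normc (wcomp t q z) <= M.
Proof.
move=> z1; have [M M0 qM] := horner_bound q.
have d0 : 0 <= (1 - normc z)^-1 by rewrite invr_ge0 subr_ge0 ltW.
exists ((1 - normc z)^-1 * M) => [|t t01]; first by rewrite mulr_ge0// ltW.
rewrite Normc.normcM; apply: ler_pM; rewrite ?normc_ge0 ?normc_wt_disc//.
by apply: qM; apply: normc_phi_le => //; exact: ltW.
Qed.

Lemma cintegrable_wcomp q z : normc z < 1 -> cintegrable mu D (fun t => wcomp t q z).
Proof.
move=> z1; have [M M0 HM] := normc_wcomp_le q z1.
apply: (@bounded_cintegrable _ _ _ mu _ mitv01 _ M); first exact: cmeasurable_wcomp_time.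
by move=> t /itv01P; exact: HM.
Qed.

Lemma cintegrable_moment k n :
  cintegrable mu D (fun t => (t ^+ k * (1 - t) ^+ n)%:C%C).
Proof.
apply: (@bounded_cintegrable _ _ _ mu _ mitv01 _ 1).
  apply: cmeasurable_real; apply: measurable_funM; first exact: measurable_funX.
  by apply: measurable_funX; exact: measurable_funB.
move=> t /itv01P/andP[t0 t1]; rewrite normcR.
have t10 : 0 <= 1 - t by lra.
rewrite ger0_norm ?mulr_ge0 ?exprn_ge0 ?(ltW t0)//.
by rewrite mulr_ile1 ?exprn_ge0 ?exprn_ile1 ?(ltW t0) ?(ltW t1)//; lra.
Qed.

Definition Gamma_coef q n : R[i] := \sum_(k < size q) (gamma_entry mu n k)%:C%C * q`_k.

(** The sum over [n] is uniform in [t], by the binomial series, so that it may be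
    exchanged with the integral. *)
Lemma Gamma_series q z (e : R) : normc z < 1 -> 0 < e ->
  exists N0, forall N, (N0 <= N)%N ->
    normc (\sum_(n < N) Gamma_coef q n * z ^+ n - cint mu D (fun t => wcomp t q z)) <= e.
Proof.
move=> z1 e0; have r01 : 0 <= normc z < 1 by rewrite normc_ge0.
pose S : R := \sum_(k < size q) normc q`_k.
have S0 : 0 <= S by apply: sumr_ge0 => k _; exact: normc_ge0.
pose m := fine (mu D).
have m0 : 0 <= m by exact: fine_ge0.
pose d := e / (S * m + 1).
have d0 : 0 < d by rewrite divr_gt0// ltr_wpDl// mulr_ge0.
have /choice[f hf] : forall k, exists N0, forall N x, (N0 <= N)%N -> normc x <= normc z ->
    normc (\sum_(n < N) 'C(n + k, k)%:R * x ^+ n - (1 - x) ^- k.+1) <= d.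
  by move=> k; exact: binomial_series_uniform.
exists (\max_(k < size q) f k) => N N0N.
pose h (n k : nat) : R -> R[i] := fun t =>
  ('C(n + k, k)%:R * q`_k * z ^+ n) * (t ^+ k * (1 - t) ^+ n)%:C%C.
have ih n k : cintegrable mu D (h n k).
  by apply: cintegrableZ; [exact: mitv01|exact: cintegrable_moment].
have ih1 n : cintegrable mu D (fun t => \sum_(k < size q) h n k t).
  by apply: (cint_sum mitv01 (index_enum _) _).1 => k; exact: ih.
have ih2 : cintegrable mu D (fun t => \sum_(n < N) \sum_(k < size q) h n k t).
  by apply: (cint_sum mitv01 (index_enum _) _).1 => k; exact: ih1.
have -> : \sum_(n < N) Gamma_coef q n * z ^+ n =
    cint mu D (fun t => \sum_(n < N) \sum_(k < size q) h n k t).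
  rewrite (cint_sum mitv01 (index_enum _) (fun i : 'I_N => ih1 i)).2.
  apply: eq_bigr => n _.
  rewrite (cint_sum mitv01 (index_enum _) (fun k : 'I_(size q) => ih n k)).2.
  rewrite /Gamma_coef mulr_suml; apply: eq_bigr => k _.
  rewrite /h (cintZ mitv01 _ (cintegrable_moment k n)).
  rewrite cint_real /gamma_entry rmorphM /= rmorph_nat; ring.
have iw := cintegrable_wcomp q z1.
have -> (a b : R[i]) : a - b = a + (-1) * b by rewrite mulN1r.
rewrite -(cintZ mitv01 (-1) iw).
have iw' := cintegrableZ mitv01 (-1) iw.
rewrite -(cintD mitv01 ih2 iw').
have Se : d * S * m <= e.
  rewrite /d -mulrA mulrAC ler_pdivrMr ?ltr_wpDl ?mulr_ge0//.
  by rewrite ler_pM2l// lerDl.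
apply: le_trans Se; apply: normc_cint_bounded; first exact: mitv01.
  apply: cmeasurableD.
    apply: cmeasurable_sum => n; apply: cmeasurable_sum => k.
    apply: cmeasurableM; first exact: cmeasurable_cst.
    apply: cmeasurable_real; apply: measurable_funM; first exact: measurable_funX.
    by apply: measurable_funX; exact: measurable_funB.
  by apply: cmeasurableM; [exact: cmeasurable_cst|exact: cmeasurable_wcomp_time].
move=> t /itv01P t01; case/andP: (t01) => t0 t1.
pose x := (1 - t)%:C%C * z.
have xz : normc x <= normc z.
  by rewrite Normc.normcM normc_1B// ler_piMl ?normc_ge0//; lra.
have -> : \sum_(n < N) \sum_(k < size q) h n k t + -1 * wcomp t q z =
    \sum_(k < size q) q`_k * t%:C%C ^+ k *
      (\sum_(n < N) 'C(n + k, k)%:R * x ^+ n - (1 - x) ^- k.+1).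
  rewrite /wcomp horner_coef mulrA mulr_sumr exchange_big /= -big_split /=.
  apply: eq_bigr => k _; rewrite mulrBr mulr_sumr; congr (_ + _).
    by apply: eq_bigr => n _; rewrite /h /x rmorphM !rmorphXn /= exprMn; ring.
  rewrite /phi -/(wt t z) /wt -/x exprMn -exprVn exprS exprVn; ring.
rewrite mulrC mulr_suml.
elim/big_ind2: _ => [|a b c d' ab cd|k _]; first by rewrite Normc.normc0.
  by apply: le_trans (ler_normcD _ _) _; exact: lerD.
rewrite Normc.normcM; apply: ler_pM; rewrite ?normc_ge0//.
  rewrite Normc.normcM normcX normcR ger0_norm ?(ltW t0)//.
  by rewrite ler_piMr ?normc_ge0// exprn_ile1 ?(ltW t0) ?(ltW t1).
by apply: hf => //; apply: leq_trans N0N; exact: leq_bigmax.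
Qed.

Lemma Gamma_polyE q z : normc z < 1 ->
  Gamma_poly mu q z = cint mu D (fun t => wcomp t q z).
Proof.
move=> z1; rewrite /Gamma_poly /power_series_sum; apply: (@cvg_lim R[i]^o).
  exact: norm_hausdorff.
apply/cvg_normcP => e e0; have [N0 hN0] := Gamma_series q z1 e0.
by exists N0 => N N0N; rewrite /series /= big_mkord; exact: hN0.
Qed.

Lemma normc_Gamma_le q z : normc z < 1 ->
  normc (Gamma_poly mu q z) <= \int[mu]_(t in D) normc (wcomp t q z).
Proof.
move=> z1; rewrite Gamma_polyE//; apply: normc_cint_le; first exact: mitv01.
  exact: cintegrable_wcomp.
have [M M0 HM] := normc_wcomp_le q z1.
apply: (@bounded_normc_integrable _ _ _ mu _ mitv01 _ M).
  exact: cmeasurable_wcomp_time.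
by move=> t /itv01P; exact: HM.
Qed.

End IntegralRepresentation.

Section UpperBound.
Context {R : realType}.
Context (mu : {finite_measure set R -> \bar R}).
Implicit Types (p r t : R) (q : {poly R[i]}) (z : R[i]).

Local Notation D := (`]0%R, 1%R[%classic : set R).

Lemma cmeasurable_cvg (f_ : nat -> R -> R[i]) (f : R -> R[i]) :
  (forall n, cmeasurable setT (f_ n)) ->
  (forall x e, 0 < e -> exists N0, forall N, (N0 <= N)%N -> normc (f_ N x - f x) <= e) ->
  cmeasurable setT f.
Proof.
move=> mf cv; split.
  apply: (@measurable_fun_cvg _ _ _ setT (fun n x => Re (f_ n x))) => //.
    by move=> n; case: (mf n).
  move=> x _; apply/cvgrPdist_le => e e0; have [N0 hN0] := cv x e e0.
  exists N0 => // N N0N; apply: le_trans (hN0 N N0N); rewrite normcBC.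
  by rewrite -ReN -ReD normr_Re_le.
apply: (@measurable_fun_cvg _ _ _ setT (fun n x => Im (f_ n x))) => //.
  by move=> n; case: (mf n).
move=> x _; apply/cvgrPdist_le => e e0; have [N0 hN0] := cv x e e0.
exists N0 => // N N0N; apply: le_trans (hN0 N N0N); rewrite normcBC.
by rewrite -ImN -ImD normr_Im_le.
Qed.

Lemma cmeasurable_Gamma q r : 0 <= r < 1 ->
  cmeasurable setT (fun x => Gamma_poly mu q (circle_pt r x)).
Proof.
move=> /andP[r0 r1].
apply: (@cmeasurable_cvg (fun N x => \sum_(n < N) Gamma_coef mu q n * circle_pt r x ^+ n)).
  move=> N; apply: cmeasurable_sum => n; apply: cmeasurableM.
    exact: cmeasurable_cst.
  by apply: cmeasurableX; exact: cmeasurable_circle_pt.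
move=> x e e0; have z1 : normc (circle_pt r x) < 1 by rewrite normc_circle_pt ger0_norm.
by rewrite Gamma_polyE//; exact: Gamma_series.
Qed.

(** Minkowski's inequality for the integral over [t], in the form of Jensen's
    inequality for the measure of density [K], where [K t] bounds the norm of
    [wcomp t]. *)
Lemma Gamma_mean_le p (K : R -> R) (I : R) q r :
  1 <= p -> 0 <= r < 1 -> measurable_fun setT K -> (forall t, 0 < t < 1 -> 0 < K t) ->
  mu.-integrable D (fun t => (K t)%:E) -> \int[mu]_(t in D) K t <= I -> 0 < I ->
  (forall t, 0 < t < 1 -> (\int[circ]_x (normc (wcomp t q (cis x)) `^ p)%:E <=
     (K t `^ p)%:E * \int[circ]_x (normc q.[cis x] `^ p)%:E)%E) ->
  (\int[circ]_x (normc (Gamma_poly mu q (circle_pt r x)) `^ p)%:E <=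
     (I `^ p)%:E * \int[circ]_x (normc q.[cis x] `^ p)%:E)%E.
Proof.
move=> p1 r01 mK K0 iK KI I0 HK; set Q := (\int[_]_x _)%E in HK *.
have Q0 : (0 <= Q)%E by exact: mean_horner_ge0.
case/andP: (r01) => r0 r1; have p0 : 0 < p by lra.
have z1 x : normc (circle_pt r x) < 1 by rewrite normc_circle_pt ger0_norm.
pose f (u : measurableTypeR R * R) : R :=
  normc (wcomp u.2 q (circle_pt r u.1)) `^ p * K u.2 `^ (1 - p).
pose F (u : measurableTypeR R * R) : \bar R := (\1_D u.2 * f u)%:E.
have f0 u : 0 <= f u by rewrite mulr_ge0 ?powR_ge0.
have mf : measurable_fun setT f.
  apply: measurable_funM.
    apply: measurable_normc_powR; apply: cmeasurable_wcomp_pair => //.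
    by apply: cmeasurable_comp => //; exact: cmeasurable_circle_pt.
  by apply: measurable_fun_powR; exact: (measurableT_comp mK measurable_snd).
have mF : measurable_fun setT F.
  apply/measurable_EFinP; apply: measurable_funM => //.
  exact: (measurableT_comp (f := \1_D : R -> R)).
have F0 u : (0 <= F u)%E by rewrite lee_fin mulr_ge0.
have FE x : (\int[mu]_t F (x, t) = \int[mu]_(t in D) (f (x, t))%:E)%E.
  rewrite [RHS]integral_mkcond; apply: eq_integral => t _.
  rewrite /F patchE indicE; case: ifPn => _; first by rewrite mul1r.
  by rewrite mul0r.
have point x : ((normc (Gamma_poly mu q (circle_pt r x)) `^ p)%:E <=
    (I `^ (p - 1))%:E * \int[mu]_t F (x, t))%E.
  have [M M0 HM] := normc_wcomp_le q (z1 x).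
  pose h t := normc (wcomp t q (circle_pt r x)) / K t.
  have hK t : D t -> h t * K t = normc (wcomp t q (circle_pt r x)).
    by move=> /itv01P t01; rewrite /h divfK// gt_eqF// K0.
  have mw : measurable_fun D (fun t => normc (wcomp t q (circle_pt r x))).
    by apply: measurable_normc; exact: cmeasurable_wcomp_time.
  have iw : mu.-integrable D (fun t => (normc (wcomp t q (circle_pt r x)))%:E).
    apply: (@bounded_normc_integrable _ _ _ mu _ mitv01 _ M).
      exact: cmeasurable_wcomp_time.
    by move=> t /itv01P; exact: HM.
  have eI : \int[mu]_(t in D) (h t * K t) = \int[mu]_(t in D) normc (wcomp t q (circle_pt r x)).
    by apply: eq_Rintegral => t /set_mem Dt; rewrite hK.
  apply: (@le_trans _ _ (((\int[mu]_(t in D) (h t * K t)) `^ p)%R%:E)).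
    rewrite lee_fin eI ge0_ler_powR ?(ltW p0) ?nnegrE ?normc_ge0 ?normc_Gamma_le//.
    by apply: Rintegral_ge0 => t _; exact: normc_ge0.
  rewrite FE.
  have -> : (\int[mu]_(t in D) (f (x, t))%:E = \int[mu]_(t in D) (h t `^ p * K t)%:E)%E.
    apply: eq_integral => t /set_mem /itv01P t01; congr (_%:E); rewrite /f /h /=.
    have Kt := K0 t t01.
    rewrite powRM ?normc_ge0 ?invr_ge0 ?(ltW Kt)// -mulrA; congr (_ * _).
    rewrite -[(K t)^-1]powR_inv1 ?(ltW Kt)// -powRrM -[X in _ = _ * X](powRr1 (ltW Kt)).
    rewrite -powRD; first by congr (_ `^ _); ring.
    by rewrite (gt_eqF Kt) implybT.
  apply: weighted_jensen => //.
  - by apply: measurable_funM => //; apply: measurable_fun_inv; exact: measurable_funTS.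
  - by move=> t /itv01P t01; rewrite divr_ge0 ?normc_ge0 ?ltW ?K0.
  - by move=> t /itv01P t01; rewrite ltW ?K0.
  - apply: eq_integrable iw; first exact: mitv01.
    by move=> t /set_mem Dt; rewrite hK.
apply: (@le_trans _ _ ((I `^ (p - 1))%:E * \int[circ]_x \int[mu]_t F (x, t))%E).
  rewrite -ge0_integralZl//; last 3 first.
  - exact: measurable_fun_fubini_tonelli_F.
  - by move=> x _; exact: integral_ge0.
  - by rewrite lee_fin powR_ge0.
  apply: ge0_le_integral => //.
  - by move=> x _; rewrite lee_fin powR_ge0.
  - by apply: measurable_mean_integrand; exact: cmeasurable_Gamma.
  - by apply: measurable_funeM; exact: measurable_fun_fubini_tonelli_F.
rewrite fubini_tonelli//.
have inner t : (\int[circ]_x F (x, t) <= (\1_D t * K t)%:E * Q)%E.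
  rewrite /F /f /= indicE; case: (boolP (t \in D)) => [tD|_]; last first.
    by under eq_integral do rewrite mul0r; rewrite integral0 mul0r mul0e.
  have t01 : 0 < t < 1 by apply: itv01P; exact: set_mem.
  have Kt := K0 t t01.
  under eq_integral do rewrite mul1r mulrC EFinM.
  have mw : cmeasurable setT (fun x => wcomp t q (circle_pt r x)).
    by apply: cmeasurable_wcomp; exact: cmeasurable_circle_pt.
  rewrite ge0_integralZl//; last 3 first.
  - exact: measurable_mean_integrand.
  - by move=> x _; rewrite lee_fin powR_ge0.
  - by rewrite lee_fin powR_ge0.
  have step := le_trans (mean_radius_le p1 r01 (disc_algebra_wcomp q t01)
    (cmeasurable_wcomp_cis t q) mw) (HK t t01).
  apply: le_trans (lee_wpmul2l _ step) _; first by rewrite lee_fin powR_ge0.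
  rewrite muleA -EFinM mul1r -powRD; last by rewrite (gt_eqF Kt) implybT.
  by rewrite subrK powRr1// ltW.
have -> : ((I `^ p)%:E * Q = (I `^ (p - 1))%:E * (I%:E * Q))%E.
  rewrite muleA -EFinM; congr (_%:E * _)%E.
  by rewrite -[X in _ * X](powRr1 (ltW I0)) -powRD ?subrK// (gt_eqF I0) implybT.
apply: lee_wpmul2l; first by rewrite lee_fin powR_ge0.
have m1K : measurable_fun setT (fun t => (\1_D t * K t)%:E).
  apply/measurable_EFinP; apply: measurable_funM => //.
have p1K t : (0 <= (\1_D t * K t)%:E)%E.
  rewrite lee_fin indicE; case: (boolP (t \in D)) => [tD|_]; last by rewrite mul0r.
  by rewrite mul1r ltW// K0//; apply: itv01P; exact: set_mem.
apply: (@le_trans _ _ (\int[mu]_t ((\1_D t * K t)%:E * Q))%E).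
  apply: ge0_le_integral => //.
  - by move=> t _; exact: integral_ge0.
  - exact: measurable_fun_fubini_tonelli_G.
  - by under eq_fun do rewrite muleC; exact: measurable_funeM.
rewrite ge0_integralZr//; apply: lee_wpmul2r => //.
have -> : (\int[mu]_t (\1_D t * K t)%:E = \int[mu]_(t in D) (K t)%:E)%E.
  rewrite [RHS]integral_mkcond; apply: eq_integral => t _.
  by rewrite patchE indicE; case: ifPn => _; rewrite ?mul1r ?mul0r.
have fK := integrable_fin_num mitv01 iK.
by rewrite -(fineK fK) lee_fin.
Qed.

(** The integral of [K] may vanish, namely for [mu = 0]; hence the positive [I]
    above it. *)
Lemma hardy_norm_Gamma_le p (K : R -> R) (I : R) q :
  1 <= p -> measurable_fun setT K -> (forall t, 0 < t < 1 -> 0 < K t) ->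
  mu.-integrable D (fun t => (K t)%:E) -> \int[mu]_(t in D) K t <= I -> 0 < I ->
  (forall t, 0 < t < 1 -> (\int[circ]_x (normc (wcomp t q (cis x)) `^ p)%:E <=
     (K t `^ p)%:E * \int[circ]_x (normc q.[cis x] `^ p)%:E)%E) ->
  (hardy_norm p (Gamma_poly mu q) <= I%:E * hardy_norm p (horner q))%E.
Proof.
move=> p1 mK K0 iK KI I0 HK; have p0 : 0 < p by lra.
rewrite [leLHS]/hardy_norm; apply: ub_ereal_sup => y [r].
rewrite /= in_itv/= => r01 <- {y}.
rewrite integral_mean_lpnorm; last exact: cmeasurable_Gamma.
apply: (@le_trans _ _ (I%:E * lpnorm p (fun x => q.[cis x]))%E); last first.
  by apply: lee_wpmul2l; [rewrite lee_fin ltW|exact: lpnorm_horner_le].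
have H := Gamma_mean_le p1 r01 mK K0 iK KI I0 HK.
have Q0 := mean_horner_ge0 p q.
have -> : (I%:E * lpnorm p (fun x => q.[cis x]) =
    ((I `^ p)%:E * \int[circ]_x (normc q.[cis x] `^ p)%:E) `^ p^-1)%E.
  rewrite poweRM ?lee_fin ?powR_ge0// poweR_EFin -powRrM mulfV ?gt_eqF//.
  by rewrite powRr1 ?(ltW I0).
apply: gt0_ler_poweR => //; first by rewrite invr_ge0 ltW.
- by rewrite in_itv/= leey andbT; apply: integral_ge0 => x _; rewrite lee_fin powR_ge0.
- by rewrite in_itv/= leey andbT; apply: mule_ge0 => //; rewrite lee_fin powR_ge0.
Qed.

End UpperBound.

Section UpperBoundKernels.
Context {R : realType}.
Implicit Types (mu : {finite_measure set R -> \bar R}) (p t : R) (q : {poly R[i]}).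

Local Notation D := (`]0%R, 1%R[%classic : set R).

Lemma measurable_kern p : measurable_fun setT (@kern R p).
Proof.
apply: measurable_funM; first exact: measurable_fun_powR.
apply: measurable_fun_inv; apply: measurable_fun_powR; exact: measurable_funB.
Qed.

Lemma measurable_psi p : measurable_fun setT (@psi R p).
Proof.
rewrite /psi; case: eqP => [_|_]; last exact: measurable_kern.
apply: measurable_funM; last first.
  by apply: measurable_fun_inv; exact: measurable_funB.
apply: (measurableT_comp (@measurable_ln R)).
by apply: measurable_funM => //; exact: measurable_fun_inv.
Qed.

Lemma integrable_of_le mu (K : R -> R) (I : R) : measurable_fun setT K ->
  (forall t, 0 < t < 1 -> 0 < K t) -> (\int[mu]_(t in D) (K t)%:E <= I%:E)%E ->
  mu.-integrable D (fun t => (K t)%:E) /\ \int[mu]_(t in D) K t <= I.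
Proof.
move=> mK K0 KI.
have iK : mu.-integrable D (fun t => (K t)%:E).
  apply/integrableP; split.
    by apply/measurable_EFinP; exact: measurable_funTS.
  rewrite (_ : integral _ _ _ = (\int[mu]_(t in D) (K t)%:E)%E).
    exact: le_lt_trans KI (ltry _).
  by apply: eq_integral => t /set_mem/itv01P t01; rewrite gee0_abs// lee_fin ltW ?K0.
split=> //; rewrite -lee_fin /Rintegral fineK//.
exact: (integrable_fin_num mitv01 iK).
Qed.

Lemma Gamma_psi_le p : 1 <= p -> exists2 B : R, 0 < B & forall mu (I : R) q, 0 < I ->
  (\int[mu]_(t in D) (psi p t)%:E <= I%:E)%E ->
  (hardy_norm p (Gamma_poly mu q) <= (B * I)%:E * hardy_norm p (horner q))%E.
Proof.
move=> p1; have [B B0 HB] := mean_wcomp_le p1.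
exists B => // mu I q I0 psiI.
have [ip pI] := integrable_of_le (measurable_psi p) (psi_gt0 p) psiI.
have mB : measurable_fun setT (fun t => B * psi p t).
  by apply: measurable_funM => //; exact: measurable_psi.
apply: (@hardy_norm_Gamma_le _ mu p _ _ q p1 mB) => //.
- by move=> t t01; rewrite mulr_gt0 ?psi_gt0.
- have := integrableZl mitv01 B ip; apply: eq_integrable; first exact: mitv01.
  by move=> t _.
- by rewrite RintegralZl// ler_pM2l.
- by rewrite mulr_gt0.
- by move=> t t01; exact: HB.
Qed.

Lemma Gamma_kern_le p : 2 <= p -> forall mu (I : R) q, 0 < I ->
  (\int[mu]_(t in D) (kern p t)%:E <= I%:E)%E ->
  (hardy_norm p (Gamma_poly mu q) <= I%:E * hardy_norm p (horner q))%E.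
Proof.
move=> p2 mu I q I0 kI; have p1 : 1 <= p by lra.
have [ip pI] := integrable_of_le (measurable_kern p) (kern_gt0 p) kI.
apply: (@hardy_norm_Gamma_le _ mu p _ _ q p1 (measurable_kern p)) => //.
- exact: kern_gt0.
- by move=> t t01; exact: mean_wcomp_le_sharp.
Qed.

End UpperBoundKernels.

(** * Test functions for the lower bound *)

Section RatioOfTestFunctions.
Context {R : realType}.
Implicit Types (a c t rho eta : R) (z w : R[i]).

Lemma Re_1B_gt0 rho z : 0 <= rho <= 1 -> normc z < 1 -> 0 < Re (1 - rho%:C%C * z).
Proof.
move=> /andP[r0 r1] z1; rewrite ReD ReN ReZ /= subr_gt0.
apply: le_lt_trans z1; apply: le_trans (ler_norm _) _.
rewrite normrM (ger0_norm r0); apply: le_trans (normr_Re_le z).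
by rewrite ler_piMl.
Qed.

Lemma Im_clog_1B_ge0 rho z : 0 <= rho <= 1 -> normc z < 1 -> Im z <= 0 ->
  0 <= Im (clog (1 - rho%:C%C * z)).
Proof.
move=> r01 z1 z0; have /andP[r0 _] := r01.
rewrite Im_clog -(@atan0 R); apply: le_atan; apply: divr_ge0.
  by rewrite ImD ImN ImZ /= add0r -mulrN mulr_ge0// oppr_ge0.
by rewrite ltW ?Re_1B_gt0.
Qed.

Lemma Im_clog_1B_le0 rho z : 0 <= rho <= 1 -> normc z < 1 -> 0 <= Im z ->
  Im (clog (1 - rho%:C%C * z)) <= 0.
Proof.
move=> r01 z1 z0; have /andP[r0 _] := r01.
rewrite Im_clog -(@atan0 R); apply: le_atan; apply: mulr_le0_ge0.
  by rewrite ImD ImN ImZ /= add0r oppr_le0 mulr_ge0.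
by rewrite invr_ge0 ltW ?Re_1B_gt0.
Qed.

(** Both arguments have the sign of [- Im z]. *)
Lemma Im_clog_1B_sub rho rho' z : 0 <= rho <= 1 -> 0 <= rho' <= 1 -> normc z < 1 ->
  `|Im (clog (1 - rho%:C%C * z)) - Im (clog (1 - rho'%:C%C * z))| <= pi / 2.
Proof.
move=> r01 r01' z1.
have := normr_Im_clog (1 - rho%:C%C * z); have := normr_Im_clog (1 - rho'%:C%C * z).
rewrite !ltr_norml ler_norml => /andP[h1 h2] /andP[h3 h4].
have [z0|/ltW z0] := leP (Im z) 0.
  have := Im_clog_1B_ge0 r01 z1 z0; have := Im_clog_1B_ge0 r01' z1 z0; lra.
have := Im_clog_1B_le0 r01 z1 z0; have := Im_clog_1B_le0 r01' z1 z0; lra.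
Qed.

Lemma Re_wt_gt0 t z : 0 < t < 1 -> normc z < 1 -> 0 < Re (wt t z).
Proof.
move=> t01 z1; rewrite ReV divr_gt0//.
  by apply: Re_1B_gt0 => //; lra.
by rewrite exprn_gt0// normc_gt0 wt_denominator_neq0// ltW.
Qed.

Lemma cpowN z a : cpow z (- a) * cpow z a = 1.
Proof.
rewrite /cpow -cexpD -mulrDl -rmorphD addNr /= mul0r; exact: cexp0.
Qed.

(** The quotient of [wt t * (f \o phi t)] by [f], for the test function
    [f z = (1 - rho z)^(-a)]. *)
Definition test_ratio a rho t z : R[i] :=
  cexp (clog (wt t z) + a%:C%C *
    (clog (1 - rho%:C%C * z) - clog (1 - rho%:C%C * phi t z))).

Lemma test_ratioE a rho t z : 0 < t < 1 -> normc z < 1 ->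
  wt t z * cpow (1 - rho%:C%C * phi t z) (- a) =
  cpow (1 - rho%:C%C * z) (- a) * test_ratio a rho t z.
Proof.
move=> t01 z1; rewrite /cpow /test_ratio -cexpD.
rewrite -[X in X * _](cexp_clog (Re_wt_gt0 t01 z1)) -cexpD; congr cexp.
rewrite rmorphN /=; ring.
Qed.

Lemma Im_clogZ c z : 0 < c -> Im (clog (c%:C%C * z)) = Im (clog z).
Proof.
move=> c0; rewrite !Im_clog ReZ ImZ; congr atan.
by rewrite -mulf_div divff ?mul1r// gt_eqF.
Qed.

(** The argument of the quotient is an affine function of [a], so that it suffices
    to look at [a = 0] and [a = 1]; in the second case it is the
    quotient of two numbers [1 - s z] with [0 <= s <= 1], up to a positive factor. *)
Lemma Re_test_ratio_ge0 a rho t z : 0 <= a <= 1 -> 0 <= rho < 1 -> 0 < t < 1 ->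
  normc z < 1 -> 0 <= Re (test_ratio a rho t z).
Proof.
move=> /andP[a0 a1] /andP[r0 r1] t01 z1; case/andP: (t01) => t0 t1.
rewrite Re_cexp mulr_ge0 ?expR_ge0//.
set w := clog (wt t z); set u := clog (1 - _); set v := clog (1 - _).
have -> : Im (w + a%:C%C * (u - v)) = (1 - a) * Im w + a * (Im w + Im u - Im v).
  rewrite ImD ImZ ImD ImN; ring.
have hw := normr_Im_clog (wt t z).
have r01 : 0 <= rho <= 1 by rewrite r0 ltW.
have rt : 0 < 1 - rho * t by nra.
(* [1 - rho * phi t z] is [wt t z] times [1 - (1 - t) z - rho t], and the latter is
   a positive multiple of [1 - s z]. *)
pose s := (1 - t) / (1 - rho * t).
have s01 : 0 <= s <= 1.
  by rewrite /s divr_ge0 ?(ltW rt) ?subr_ge0 ?(ltW t1)//= ler_pdivrMr// mul1r; nra.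
have Rw := Re_wt_gt0 t01 z1.
have p1 : normc (phi t z) < 1 by exact: normc_phi_lt1.
have Rv := Re_1B_gt0 r01 p1.
have Rs := Re_1B_gt0 s01 z1.
have wz : 1 - (1 - t)%:C%C * z != 0 by rewrite wt_denominator_neq0// ltW.
have sE : (1 - rho * t)%:C%C * (1 - s%:C%C * z) = 1 - (1 - t)%:C%C * z - (rho * t)%:C%C :> R[i].
  have srt : (1 - rho * t) * s = 1 - t by rewrite /s mulrC divfK// gt_eqF.
  rewrite -srt !(rmorphM, rmorphB, rmorph1) /=; ring.
have Rb : 0 < Re (1 - (1 - t)%:C%C * z - (rho * t)%:C%C).
  by rewrite -sE ReZ mulr_gt0.
have vE : 1 - rho%:C%C * phi t z = wt t z * (1 - (1 - t)%:C%C * z - (rho * t)%:C%C).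
  have wV : wt t z * (1 - (1 - t)%:C%C * z) = 1 by rewrite mulVf.
  rewrite mulrBr wV /phi rmorphM /=; ring.
have key : Im w + Im u - Im v = Im u - Im (clog (1 - s%:C%C * z)).
  rewrite /v vE clogM//; last by rewrite -vE.
  rewrite -sE ImD -/w Im_clogZ//; ring.
have := Im_clog_1B_sub r01 s01 z1; rewrite -/u -key.
move: hw; rewrite -/w ltr_norml !ler_norml => /andP[h1 h2] /andP[h3 h4].
by apply: cos_ge0_pihalf; nra.
Qed.

(** * The quotient near the point 1 *)

(** At [z = 1] the weight is [t^-1]. *)
Lemma normc_wtB t z : 0 < t < 1 -> normc z < 1 ->
  normc (wt t z - t^-1%:C%C) <= normc (1 - z) / t ^+ 2.
Proof.
move=> t01 z1; case/andP: (t01) => t0 t1.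
have tn : t%:C%C != 0 :> R[i] by rewrite -normc_gt0 normcR gtr0_norm.
have wz : 1 - (1 - t)%:C%C * z != 0 by rewrite wt_denominator_neq0// ltW.
have -> : wt t z - t^-1%:C%C = ((1 - t)%:C%C * (z - 1)) * (wt t z * t^-1%:C%C).
  move: wz; rewrite /wt fmorphV rmorphB /= => wz; field.
  by rewrite tn.
rewrite !Normc.normcM (normcBC z).
have h1 := normc_wt_le t01 (ltW z1).
rewrite normc_1B// normcR gtr0_norm ?invr_gt0//.
have -> : normc (1 - z) / t ^+ 2 = 1 * normc (1 - z) * (t^-1 / t).
  by field; rewrite gt_eqF.
apply: ler_pM; rewrite ?mulr_ge0 ?normc_ge0 ?invr_ge0 ?(ltW t0)//; first lra.
  by apply: ler_wpM2r; rewrite ?normc_ge0//; lra.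
by apply: ler_wpM2r; rewrite ?invr_ge0 ?(ltW t0).
Qed.

(** The rate [eta] controls both [1 - z] and the ratio of [1 - rho] to [1 - z]. *)
Lemma normc_quotientB t rho z eta (L := t / (1 - t)) : 0 < t < 1 -> normc z < 1 ->
  0 <= rho < 1 -> 0 < eta -> normc (1 - z) <= eta -> 1 - rho <= eta * (1 - normc z) ->
  eta <= (1 - t) / 8 ->
  normc ((1 - rho%:C%C * z) / (1 - rho%:C%C * phi t z) - L%:C%C) <=
    eta * (8 * (1 + L + t^-1) / (1 - t)).
Proof.
move=> t01 z1 /andP[r0 r1] e0 ze re et; case/andP: (t01) => t0 t1.
have L0 : 0 <= L by rewrite divr_ge0// ltW// subr_gt0.
set u := 1 - _; set v := 1 - _; set d := normc (1 - z) in ze *.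
have zd : 1 - normc z <= d.
  by have := lerB_normc 1 z; rewrite Normc.normc1.
have rd : 1 - rho <= eta * d by apply: le_trans re _; rewrite ler_pM2l.
have d0 : 0 < d by apply: lt_le_trans zd; rewrite subr_gt0.
have wn := wt_neq0 t01 (ltW z1).
(* The lower bound for [v] is [rho] times [1 - phi t z], minus [1 - rho], which
   [eta <= (1 - t) / 8] makes negligible. *)
have vE : v = (1 - rho)%:C%C + rho%:C%C * ((1 - t)%:C%C * (1 - z) * wt t z).
  by rewrite -one_sub_phi ?(ltW z1)// /v rmorphB /=; ring.
have uE : u = (1 - rho)%:C%C + rho%:C%C * (1 - z).
  by rewrite /u rmorphB /=; ring.
have w2 : 2^-1 <= normc (wt t z).
  rewrite Normc.normcV lef_pV2 ?posrE//; last first.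
    by rewrite normc_gt0 wt_denominator_neq0// ltW.
  apply: le_trans (ler_normcB _ _) _; rewrite Normc.normc1 Normc.normcM normc_1B//.
  have : (1 - t) * normc z <= 1 * 1 by apply: ler_pM; rewrite ?normc_ge0//; lra.
  lra.
have r2 : 2^-1 <= rho.
  have : eta * d <= 8^-1 * 2.
    apply: ler_pM; rewrite ?(ltW e0) ?(ltW d0)//; first by lra.
    apply: le_trans (ler_normcB _ _) _; rewrite Normc.normc1; lra.
  lra.
have vd : (1 - t) * d / 8 <= normc v.
  have -> : v = rho%:C%C * ((1 - t)%:C%C * (1 - z) * wt t z) - (rho - 1)%:C%C.
    rewrite vE !rmorphB /=; ring.
  apply: le_trans (lerB_normc _ _).
  rewrite !Normc.normcM normc_1B// !normcR (ger0_norm r0) -/d distrC ger0_norm; last lra.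
  have h : 2^-1 * ((1 - t) * d * 2^-1) <= rho * ((1 - t) * d * normc (wt t z)).
    apply: ler_pM => //; first by rewrite !mulr_ge0//; lra.
    by rewrite ler_pM2l// mulr_gt0//; lra.
  have : eta * d <= (1 - t) / 8 * d by rewrite ler_pM2r.
  lra.
have v0 : 0 < normc v by apply: lt_le_trans vd; rewrite !mulr_gt0//; lra.
have vn : v != 0 by rewrite -normc_gt0.
have -> : u / v - L%:C%C = (u - L%:C%C * v) / v by rewrite [RHS]mulrBl mulfK.
rewrite Normc.normcM Normc.normcV ler_pdivrMr//.
have Lt : L%:C%C * (1 - t)%:C%C = t%:C%C :> R[i].
  by rewrite -rmorphM /= /L divfK// gt_eqF// subr_gt0.
have tV : t%:C%C * t^-1%:C%C = 1 :> R[i] by rewrite -rmorphM /= mulfV// gt_eqF.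
have -> : u - L%:C%C * v = (1 - rho)%:C%C * (1 - L%:C%C) -
    rho%:C%C * (1 - z) * (t%:C%C * (wt t z - t^-1%:C%C)).
  rewrite uE vE [t%:C%C * (_ - _)]mulrBr tV -Lt; ring.
apply: le_trans (ler_normcB _ _) _.
have n1L : normc (1 - L%:C%C) <= 1 + L.
  by apply: le_trans (ler_normcB _ _) _; rewrite Normc.normc1 normcR ger0_norm.
have A1 : normc ((1 - rho)%:C%C * (1 - L%:C%C)) <= eta * d * (1 + L).
  rewrite Normc.normcM; apply: ler_pM; rewrite ?normc_ge0// normcR ger0_norm//; lra.
have A2 : normc (rho%:C%C * (1 - z) * (t%:C%C * (wt t z - t^-1%:C%C))) <= eta * d * t^-1.
  rewrite !Normc.normcM !normcR (ger0_norm r0) (ger0_norm (ltW t0)) -/d.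
  have -> : eta * d * t^-1 = 1 * d * (t * (eta / t ^+ 2)) by field; rewrite gt_eqF.
  apply: ler_pM; rewrite ?mulr_ge0 ?normc_ge0 ?(ltW d0) ?(ltW t0)//.
    by rewrite ler_pM2r// ltW.
  rewrite ler_pM2l//; apply: le_trans (normc_wtB t01 z1) _.
  by rewrite ler_pM2r// invr_gt0 exprn_gt0.
apply: (@le_trans _ _ (eta * d * (1 + L + t^-1))).
  by rewrite [leRHS]mulrDr; exact: lerD.
have -> : eta * d * (1 + L + t^-1) = eta * (8 * (1 + L + t^-1) / (1 - t)) * ((1 - t) * d / 8).
  have t1n : 1 - t != 0 by rewrite gt_eqF// subr_gt0.
  by move: (1 + L + t^-1) => c; field.
have t10 : 0 <= 1 - t by lra.
by apply: ler_wpM2l => //; rewrite !mulr_ge0 ?addr_ge0 ?invr_ge0 ?(ltW e0) ?(ltW t0).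
Qed.

(** The weight tends to [t^-1], and the quotient of [1 - rho z] by
    [1 - rho * phi t z] to the positive number [t / (1 - t)], so that the logarithms
    converge as well. *)
Lemma cvg_Re_test_ratio a t (z_ : nat -> R[i]) (rho_ : nat -> R) : 0 < t < 1 ->
  (forall n, normc (z_ n) < 1) -> (forall n, 0 <= rho_ n < 1) ->
  (forall n, normc (1 - z_ n) <= n.+1%:R^-1) ->
  (forall n, 1 - rho_ n <= n.+1%:R^-1 * (1 - normc (z_ n))) ->
  Re (test_ratio a (rho_ n) t (z_ n)) @[n --> \oo] --> t `^ (a - 1) / (1 - t) `^ a.
Proof.
move=> t01 z1 r01 zn rn; case/andP: (t01) => t0 t1.
pose L := t / (1 - t).
have L0 : 0 < L by rewrite divr_gt0// subr_gt0.
have h0 : (n.+1%:R^-1 : R) @[n --> \oo] --> (0 : R) by exact: cvg_harmonic.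
have cvgK (y_ : nat -> R) (y K : R) :
    (\forall n \near \oo, `|y_ n - y| <= n.+1%:R^-1 * K) -> y_ n @[n --> \oo] --> y.
  move=> yK; have hK : (n.+1%:R^-1 * K : R) @[n --> \oo] --> (0 : R).
    by rewrite -[X in _ --> X](mul0r K); apply: cvgMl.
  apply/cvgrPdist_le => e e0; have /cvgrPdist_le/(_ _ e0) hK' := hK.
  near=> n; rewrite distrC; apply: (@le_trans _ _ (n.+1%:R^-1 * K)); first by near: n.
  apply: le_trans (ler_norm _) _; rewrite -normrN -sub0r; near: n; exact: hK'.
pose w n := wt t (z_ n).
pose x n := (1 - (rho_ n)%:C%C * z_ n) / (1 - (rho_ n)%:C%C * phi t (z_ n)).
have wB n : normc (w n - t^-1%:C%C) <= n.+1%:R^-1 * t ^- 2.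
  apply: le_trans (normc_wtB t01 (z1 n)) _.
  by rewrite ler_pM2r ?invr_gt0 ?exprn_gt0.
have [N hN] : exists N, forall n, (N <= n)%N -> n.+1%:R^-1 <= (1 - t) / 8.
  have d0 : 0 < (1 - t) / 8 by lra.
  have /cvgrPdist_le/(_ _ d0) [N _ HN] := h0.
  by exists N => n Nn; have := HN n Nn; rewrite /= sub0r normrN ger0_norm.
pose K := 8 * (1 + L + t^-1) / (1 - t).
have xB n : (N <= n)%N -> normc (x n - L%:C%C) <= n.+1%:R^-1 * K.
  by move=> Nn; apply: normc_quotientB => //; exact: hN.
have nB (b : R) (u : R[i]) : 0 <= b -> `|normc u - b| <= normc (u - b%:C%C).
  move=> b0; rewrite -{1}(ger0_norm b0) -(normcR b) ler_norml lerB_normc andbT.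
  by rewrite lerNl opprB normcBC; exact: lerB_normc.
have cRew : Re (w n) @[n --> \oo] --> t^-1.
  apply: (cvgK _ _ (t ^- 2)); apply: nearW => n; apply: le_trans (wB n).
  by apply: le_trans (normr_Re_le _); rewrite ReD ReN.
have cImw : Im (w n) @[n --> \oo] --> 0.
  apply: (cvgK _ _ (t ^- 2)); apply: nearW => n; apply: le_trans (wB n).
  by apply: le_trans (normr_Im_le _); rewrite ImD ImN.
have cnw : normc (w n) @[n --> \oo] --> t^-1.
  apply: (cvgK _ _ (t ^- 2)); apply: nearW => n; apply: le_trans (wB n).
  by apply: nB; rewrite invr_ge0 ltW.
have nearN : \forall n \near \oo, (N <= n)%N by exists N.
have cRex : Re (x n) @[n --> \oo] --> L.
  apply: (cvgK _ _ K); near=> n; have Nn : (N <= n)%N by near: n.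
  apply: le_trans (xB _ Nn); apply: le_trans (normr_Re_le _); by rewrite ReD ReN.
have cImx : Im (x n) @[n --> \oo] --> 0.
  apply: (cvgK _ _ K); near=> n; have Nn : (N <= n)%N by near: n.
  apply: le_trans (xB _ Nn); apply: le_trans (normr_Im_le _); by rewrite ImD ImN.
have cnx : normc (x n) @[n --> \oo] --> L.
  apply: (cvgK _ _ K); near=> n; have Nn : (N <= n)%N by near: n.
  apply: le_trans (xB _ Nn); by apply: nB; exact: ltW.
have clogc (y_ : nat -> R[i]) (b : R) : 0 < b -> Re (y_ n) @[n --> \oo] --> b ->
    Im (y_ n) @[n --> \oo] --> 0 -> normc (y_ n) @[n --> \oo] --> b ->
    (Re (clog (y_ n)) @[n --> \oo] --> ln b) /\ (Im (clog (y_ n)) @[n --> \oo] --> 0).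
  move=> b0 cR cI cn; split.
    exact: (continuous_cvg _ (continuous_ln b0) cn).
  under eq_fun do rewrite Im_clog.
  rewrite -atan0; apply: (continuous_cvg _ (@continuous_atan _ 0)).
  rewrite -[X in _ --> X](mul0r b^-1); apply: cvgM => //.
  by apply: cvgV => //; rewrite gt_eqF.
have tV0 : 0 < t^-1 by rewrite invr_gt0.
have [clw iw] := clogc w _ tV0 cRew cImw cnw.
have [clx ix] := clogc x _ L0 cRex cImx cnx.
have -> : t `^ (a - 1) / (1 - t) `^ a = expR (ln t^-1 + a * ln L) * cos (0 + a * 0).
  rewrite mulr0 addr0 cos0 mulr1.
  have t10 : 0 < 1 - t by rewrite subr_gt0.
  rewrite /L lnM ?posrE ?invr_gt0// !lnV ?posrE//.
  rewrite /powR !gt_eqF// -expRN -expRD; congr expR; ring.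
have cE : expR (Re (clog (w n)) + a * Re (clog (x n))) *
    cos (Im (clog (w n)) + a * Im (clog (x n))) @[n --> \oo] -->
    expR (ln t^-1 + a * ln L) * cos (0 + a * 0).
  apply: cvgM.
    apply: (continuous_cvg _ (@continuous_expR _ _)).
    by apply: cvgD => //; exact: cvgMr.
  apply: (continuous_cvg _ (@continuous_cos _ _)).
  by apply: cvgD => //; exact: cvgMr.
apply: cvg_trans cE; apply: near_eq_cvg.
have Rex0 : \forall n \near \oo, 0 < Re (x n) by exact: cvgr_gt cRex _ L0.
near=> n.
have x0 : 0 < Re (x n) by near: n.
have rr : 0 <= rho_ n <= 1 by have /andP[-> /ltW] := r01 n.
have Rv : 0 < Re (1 - (rho_ n)%:C%C * phi t (z_ n)).
  by apply: Re_1B_gt0 => //; exact: normc_phi_lt1.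
have uE : 1 - (rho_ n)%:C%C * z_ n = (1 - (rho_ n)%:C%C * phi t (z_ n)) * x n.
  by rewrite /x [RHS]mulrC divfK// clog_neq0.
have Ru : 0 < Re (1 - (rho_ n)%:C%C * z_ n) by exact: Re_1B_gt0.
have clE : clog (1 - (rho_ n)%:C%C * z_ n) =
    clog (x n) + clog (1 - (rho_ n)%:C%C * phi t (z_ n)).
  by rewrite uE clogM// -?uE// addrC.
by rewrite /test_ratio clE addrK Re_cexp ReD ImD ReZ ImZ.
Unshelve. all: by end_near.
Qed.

End RatioOfTestFunctions.

(** * The lower bound *)

Section TestFunctionIntegral.
Context {R : realType}.
Context (mu : {finite_measure set R -> \bar R}).
Implicit Types (a p t rho eta : R) (z w : R[i]).

Local Notation D := (`]0%R, 1%R[%classic : set R).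

Lemma cmeasurable_test_ratio a rho z (A : set R) :
  cmeasurable A (fun t => test_ratio a rho t z).
Proof.
suff [h1 h2] : cmeasurable setT (fun t => test_ratio a rho t z).
  by split; exact: measurable_funTS.
have mw : cmeasurable setT (fun t => wt t z).
  apply: cmeasurableV; apply: cmeasurableB; first exact: cmeasurable_cst.
  apply: cmeasurableM; last exact: cmeasurable_cst.
  by apply: cmeasurable_real; exact: measurable_funB.
apply: cmeasurable_cexp; apply: cmeasurableD; first exact: cmeasurable_clog.
apply: cmeasurableM; first exact: cmeasurable_cst.
apply: cmeasurableB; first exact: cmeasurable_cst.
apply: cmeasurable_clog; apply: cmeasurableB; first exact: cmeasurable_cst.
apply: cmeasurableM; first exact: cmeasurable_cst.
by apply: cmeasurableM => //; exact: cmeasurable_real.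
Qed.

Lemma normc_test_ratio_le a rho z : 0 <= rho < 1 -> normc z < 1 ->
  exists M : R, forall t, 0 < t < 1 -> normc (test_ratio a rho t z) <= M.
Proof.
move=> r01 z1; have [M M0 HM] := disc_algebra_bound (disc_algebra_cpow (- a) r01).
exists ((1 - normc z)^-1 * M * normc (cpow (1 - rho%:C%C * z) a)) => t t01.
have -> : test_ratio a rho t z = wt t z * cpow (1 - rho%:C%C * phi t z) (- a) *
    cpow (1 - rho%:C%C * z) a.
  by rewrite test_ratioE// mulrAC cpowN mul1r.
rewrite 2!Normc.normcM; apply: ler_pM; rewrite ?mulr_ge0 ?normc_ge0//.
apply: ler_pM; rewrite ?normc_ge0//; first exact: normc_wt_disc.
by apply: HM; apply: normc_phi_le => //; exact: ltW.
Qed.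

Lemma cintegrable_test_ratio a rho z : 0 <= rho < 1 -> normc z < 1 ->
  cintegrable mu D (fun t => test_ratio a rho t z).
Proof.
move=> r01 z1; have [M HM] := normc_test_ratio_le a r01 z1.
apply: (@bounded_cintegrable _ _ _ mu _ mitv01 _ M); first exact: cmeasurable_test_ratio.
by move=> t /itv01P; exact: HM.
Qed.

(** By Fatou's lemma: otherwise there would be points tending to [1] along which
    the integrals remain below [kappa], whereas the integrands are nonnegative
    and tend to [kern p]. *)
Lemma test_ratio_region p (kappa : R) : 1 <= p ->
  (kappa%:E < \int[mu]_(t in D) (kern p t)%:E)%E ->
  exists2 eta : R, 0 < eta <= 2^-1 & forall z rho, normc z < 1 -> normc (1 - z) <= eta ->
    0 <= rho < 1 -> 1 - rho <= eta * (1 - normc z) ->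
    kappa <= \int[mu]_(t in D) Re (test_ratio p^-1 rho t z).
Proof.
move=> p1 kI; apply: contrapT => H.
have p01 : 0 <= p^-1 <= 1 by rewrite invr_ge0 invf_le1; lra.
have /choice[f Hf] : forall n, exists u : R[i] * R,
    [/\ normc u.1 < 1, normc (1 - u.1) <= n.+2%:R^-1, 0 <= u.2 < 1,
        1 - u.2 <= n.+2%:R^-1 * (1 - normc u.1) &
        \int[mu]_(t in D) Re (test_ratio p^-1 u.2 t u.1) <= kappa].
  move=> n; apply: contrapT => Hn; apply: H; exists n.+2%:R^-1.
    by rewrite invr_gt0 ltr0n/= lef_pV2 ?posrE// ler_nat.
  move=> z rho z1 zn r01 rn; rewrite leNgt; apply/negP => lt; apply: Hn.
  by exists (z, rho); split=> //=; exact: ltW.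
pose g n t := Re (test_ratio p^-1 (f n).2 t (f n).1).
have nn n : n.+2%:R^-1 <= n.+1%:R^-1 :> R by rewrite lef_pV2 ?posrE// ler_nat.
have lim t : D t -> (limn_einf (fun n => (g n t)%:E) = (kern p t)%:E)%E.
  move=> /itv01P t01; apply: (cvg_limn_einf_sup _).1.
  apply: cvg_EFin; first exact: nearW.
  apply: cvg_Re_test_ratio => // n; have [h1 h2 h3 h4 _] := Hf n => //.
    by apply: le_trans h2 _.
  by apply: le_trans h4 _; apply: ler_wpM2r => //; rewrite subr_ge0 ltW.
have mg n : measurable_fun D (fun t => (g n t)%:E).
  by apply/measurable_EFinP; have [] := cmeasurable_test_ratio p^-1 (f n).2 (f n).1 D.
have g0 n t : D t -> (0 <= (g n t)%:E)%E.
  move=> /itv01P t01; rewrite lee_fin; have [h1 _ h3 _ _] := Hf n.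
  exact: Re_test_ratio_ge0.
have := fatou mu mitv01 mg g0.
rewrite (_ : (\int[mu]_(t in D) _)%E = (\int[mu]_(t in D) (kern p t)%:E)%E); last first.
  by apply: eq_integral => t /set_mem; exact: lim.
apply/negP; rewrite -ltNge; apply: le_lt_trans kI.
rewrite limn_einf_lim; apply: lime_le; first exact: is_cvg_einfs.
apply: nearW => n; apply: (@le_trans _ _ (\int[mu]_(t in D) (g n t)%:E)%E).
  by apply: ereal_inf_lbound; exists n => //=.
have [h1 h2 h3 h4 h5] := Hf n.
have [ig _] := cintegrable_test_ratio p^-1 h3 h1.
by rewrite -[leLHS]fineK ?lee_fin//; exact: (integrable_fin_num mitv01 ig).
Qed.

(** On the region just found, the integral operator multiplies the test function
    by at least [kappa]; this survives polynomial approximation. *)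
Lemma normc_Gamma_test_ge p (kappa e rho : R) (S : {poly R[i]}) z : 0 < p ->
  0 <= rho < 1 -> normc z < 1 -> 0 <= e ->
  (forall w, normc w <= 1 -> normc (cpow (1 - rho%:C%C * w) (- p^-1) - S.[w]) <= e) ->
  kappa <= \int[mu]_(t in D) Re (test_ratio p^-1 rho t z) ->
  kappa * normc (cpow (1 - rho%:C%C * z) (- p^-1)) - e / (1 - normc z) * fine (mu D) <=
    normc (Gamma_poly mu S z).
Proof.
move=> p0 r01 z1 e0 Se kI; set f := fun w => cpow (1 - rho%:C%C * w) (- p^-1) in Se *.
have ir := cintegrable_test_ratio p^-1 r01 z1.
have iS := cintegrable_wcomp mu S z1.
have ifr := cintegrableZ mitv01 (f z) ir.
have id : cintegrable mu D (fun t => f z * test_ratio p^-1 rho t z + (-1) * wcomp t S z).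
  by apply: cintegrableD => //; exact: cintegrableZ.
have dB : normc (cint mu D (fun t => f z * test_ratio p^-1 rho t z + (-1) * wcomp t S z)) <=
    e / (1 - normc z) * fine (mu D).
  apply: normc_cint_bounded; first exact: mitv01.
    apply: cmeasurableD; apply: cmeasurableM; try exact: cmeasurable_cst.
      exact: cmeasurable_test_ratio.
    exact: cmeasurable_wcomp_time.
  move=> t /itv01P t01; rewrite -test_ratioE// mulN1r -mulrBr Normc.normcM mulrC.
  apply: ler_pM; rewrite ?normc_ge0//; last exact: normc_wt_disc.
  by apply: Se; apply: normc_phi_le => //; exact: ltW.
move: dB; rewrite (cintD mitv01 ifr (cintegrableZ mitv01 _ iS)).
rewrite (cintZ mitv01 _ ir) (cintZ mitv01 _ iS) -Gamma_polyE// mulN1r => dB.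
have hr : kappa * normc (f z) <= normc (f z * cint mu D (fun t => test_ratio p^-1 rho t z)).
  rewrite (Normc.normcM (f z)) [leRHS]mulrC; apply: ler_wpM2r; first exact: normc_ge0.
  by apply: le_trans kI _; exact: (Re_le_normc (cint _ _ _)).
have := lerB_normc (f z * cint mu D (fun t => test_ratio p^-1 rho t z)) (Gamma_poly mu S z).
lra.
Qed.

End TestFunctionIntegral.

Section CauchyMean.
Context {R : realType}.
Implicit Types (r s rho eta x : R).

(** The [p]-th power of the norm of the test function. *)
Definition cauchy_mean s : R := \int[circ]_x (normc (1 - s%:C%C * cis x))^-1.

Lemma normc_1Bcis_ge s x : 0 <= s < 1 -> 1 - s <= normc (1 - s%:C%C * cis x).
Proof.
move=> /andP[s0 s1]; apply: le_trans (lerB_normc _ _).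
by rewrite Normc.normc1 Normc.normcM normcR normc_cis mulr1 ger0_norm.
Qed.

Lemma cmeasurable_1Bcis s : cmeasurable setT (fun x => 1 - s%:C%C * cis x : R[i]).
Proof.
apply: cmeasurableB; first exact: cmeasurable_cst.
by apply: cmeasurableM; [exact: cmeasurable_cst|exact: cmeasurable_cis].
Qed.

Lemma measurable_cauchy_integrand s :
  measurable_fun setT (fun x => (normc (1 - s%:C%C * cis x))^-1).
Proof. by apply: measurable_fun_inv; apply: measurable_normc; exact: cmeasurable_1Bcis. Qed.

Lemma cauchy_integrand_le s x : 0 <= s < 1 ->
  (normc (1 - s%:C%C * cis x))^-1 <= (1 - s)^-1.
Proof.
move=> s01; rewrite lef_pV2 ?posrE ?normc_1Bcis_gt0 ?normc_1Bcis_ge//.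
by rewrite subr_gt0; case/andP: s01.
Qed.

Lemma integrable_cauchy_integrand s : 0 <= s < 1 ->
  circ.-integrable setT (fun x => ((normc (1 - s%:C%C * cis x))^-1)%:E).
Proof.
move=> s01; apply: (@integrable_circ _ _ (1 - s)^-1).
  exact: measurable_cauchy_integrand.
by move=> x; rewrite ger0_norm ?invr_ge0 ?normc_ge0// cauchy_integrand_le.
Qed.

Lemma cauchy_mean_ge s : 0 <= s < 1 ->
  pi^-1 * ln ((1 + s) / (1 - s)) <= cauchy_mean s.
Proof.
move=> s01; case/andP: (s01) => s0 s1.
rewrite -lee_fin -mean_log// /cauchy_mean EFin_Rintegral_circ; last exact: integrable_cauchy_integrand.
have mi : measurable_fun [set: R] (fun x => ((normc (1 - s%:C%C * cis x))^-1)%:E).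
  by apply/measurable_EFinP; exact: measurable_cauchy_integrand.
apply: ge0_le_integral => //.
- by move=> x _; rewrite lee_fin !mulr_ge0 ?powR_ge0.
- apply/measurable_EFinP; apply: measurable_funM.
    by apply: measurableT_comp => //; apply: continuous_measurable_fun; exact: continuous_sin.
  apply: measurable_funM => //; apply: measurable_normc_powR; exact: cmeasurable_1Bcis.
move=> x _; rewrite lee_fin.
have n0 := normc_1Bcis_gt0 x s01.
have sn : s * `|sin x| <= normc (1 - s%:C%C * cis x).
  apply: le_trans (normr_Im_le _).
  by rewrite ImD ImN ImZ /= add0r normrN normrM (ger0_norm s0).
rewrite powRN powR_mulrn ?normc_ge0//; set m := normc _ in n0 sn *.
have -> : `|sin x| * (s * (m ^+ 2)^-1) = (s * `|sin x|) / m * m^-1.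
  by field; rewrite gt_eqF.
by rewrite ler_piMl ?invr_ge0 ?(ltW n0)// ler_pdivrMr// mul1r.
Qed.

(** [1 / A - 1 / B] is at most [|A - B| / |A B|], and the mean of the square of the
    Cauchy kernel is explicit. *)
Lemma cauchy_mean_le_add s rho : 0 <= s <= rho -> rho < 1 ->
  cauchy_mean rho <= cauchy_mean s +
    (rho - s) / 2 * ((1 - rho ^+ 2)^-1 + (1 - s ^+ 2)^-1).
Proof.
move=> /andP[s0 sr] r1; have s1 : s < 1 by exact: le_lt_trans r1.
have s01 : 0 <= s < 1 by rewrite s0.
have r01 : 0 <= rho < 1 by rewrite r1 (le_trans s0).
pose G u (x : R) := (normc (1 - u%:C%C * cis x) ^+ 2)^-1.
have mG u : measurable_fun setT (G u).
  apply: measurable_fun_inv; apply: measurable_funX; apply: measurable_normc.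
  exact: cmeasurable_1Bcis.
have iG u : 0 <= u < 1 -> circ.-integrable setT (fun x => (G u x)%:E).
  move=> u01; apply: (@integrable_circ _ _ ((1 - u)^-1 ^+ 2)) => // x.
  rewrite ger0_norm ?invr_ge0 ?exprn_ge0 ?normc_ge0// /G -exprVn.
  by rewrite lerXn2r ?nnegrE ?invr_ge0 ?normc_ge0 ?cauchy_integrand_le// subr_ge0; lra.
have EG u : 0 <= u < 1 -> \int[circ]_x G u x = (1 - u ^+ 2)^-1.
  move=> u01; apply: EFin_inj; rewrite EFin_Rintegral_circ; last exact: iG.
  rewrite integral_inv_sqr; last by rewrite Normc.normc1 normcR ger0_norm; lra.
  by rewrite Normc.normc1 normcR expr1n ger0_norm//; case/andP: u01.
rewrite -(EG _ s01) -(EG _ r01) -RintegralD//; [|exact: iG|exact: iG].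
have iGG : circ.-integrable setT (fun x => (G rho x + G s x)%:E).
  by have := integrableD measurableT (iG _ r01) (iG _ s01); apply: eq_integrable.
rewrite -RintegralZl// -RintegralD//; last 2 first.
- exact: integrable_cauchy_integrand.
- by have := integrableZl measurableT ((rho - s) / 2) iGG; apply: eq_integrable.
apply: le_Rintegral => //.
- exact: integrable_cauchy_integrand.
- have i1 := integrableZl measurableT ((rho - s) / 2) iGG.
  by have := integrableD measurableT (integrable_cauchy_integrand s01) i1; apply: eq_integrable.
move=> x _; rewrite /G -!exprVn.
have A0 := normc_1Bcis_gt0 x r01; have B0 := normc_1Bcis_gt0 x s01.
set A := normc _ in A0 *; set B := normc _ in B0 *.
have BA : B - A <= rho - s.
  apply: le_trans (lerB_normc _ _) _.
  have -> : 1 - s%:C%C * cis x - (1 - rho%:C%C * cis x) = (rho - s)%:C%C * cis x.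
    rewrite rmorphB /=; ring.
  by rewrite Normc.normcM normcR normc_cis mulr1 ger0_norm// subr_ge0.
have h : A^-1 = B^-1 + (B - A) * (A^-1 * B^-1) by field; rewrite !gt_eqF.
rewrite {1}h lerD2l; apply: (@le_trans _ _ ((rho - s) * (A^-1 * B^-1))).
  by apply: ler_wpM2r => //; rewrite mulr_ge0 ?invr_ge0 ?ltW.
rewrite -mulrA; apply: ler_wpM2l; first by rewrite subr_ge0.
have := sqr_ge0 (A^-1 - B^-1); rewrite sqrrB; lra.
Qed.

End CauchyMean.

Section LowerBound.
Context {R : realType}.
Context (mu : {finite_measure set R -> \bar R}).
Implicit Types (p r eta kappa rho s C d : R) (q : {poly R[i]}) (z w : R[i]).

Local Notation D := (`]0%R, 1%R[%classic : set R).

Lemma hardy_norm_horner_le p q : 1 <= p ->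
  (hardy_norm p (horner q) <= lpnorm p (fun x => q.[cis x]))%E.
Proof.
move=> p1; apply: ub_ereal_sup => y [r]; rewrite /= in_itv/= => r01 <- {y}.
rewrite integral_mean_lpnorm; last exact: cmeasurable_horner_circle.
have i0 (f : R -> R[i]) : (0 <= \int[circ]_x (normc (f x) `^ p)%:E)%E.
  by apply: integral_ge0 => x _; rewrite lee_fin powR_ge0.
apply: gt0_ler_poweR.
- by rewrite invr_ge0; lra.
- by rewrite in_itv/= leey andbT.
- by rewrite in_itv/= leey andbT.
- apply: mean_radius_le => //; first exact: disc_algebra_poly.
    exact: cmeasurable_horner_cis.
  exact: cmeasurable_horner_circle.
Qed.

Lemma normc_test_powR p rho w : 1 <= p -> 0 <= rho < 1 -> normc w <= 1 ->
  normc (cpow (1 - rho%:C%C * w) (- p^-1)) `^ p = (normc (1 - rho%:C%C * w))^-1.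
Proof.
move=> p1 /andP[r0 r1] w1; rewrite normc_cpow; last first.
  by rewrite cauchy_denominator_neq0// normcR ger0_norm.
by rewrite -powRrM mulNr mulVf ?powR_inv1 ?normc_ge0// gt_eqF//; lra.
Qed.

Lemma normc_test_ge p rho w : 1 <= p -> 0 <= rho < 1 -> normc w <= 1 ->
  2^-1 <= normc (cpow (1 - rho%:C%C * w) (- p^-1)).
Proof.
move=> p1 /andP[r0 r1] w1.
have w0 : 1 - rho%:C%C * w != 0 by rewrite cauchy_denominator_neq0// normcR ger0_norm.
have w2 : normc (1 - rho%:C%C * w) <= 2.
  apply: le_trans (ler_normcB _ _) _; rewrite Normc.normc1 Normc.normcM normcR ger0_norm//.
  have : rho * normc w <= 1 * 1 by apply: ler_pM; rewrite ?normc_ge0// ltW.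
  lra.
rewrite normc_cpow// powRN lef_pV2 ?posrE ?powR_gt0 ?normc_gt0//.
apply: (@le_trans _ _ (2 `^ p^-1)).
  by apply: ge0_ler_powR; rewrite ?nnegrE ?normc_ge0 ?invr_ge0//; lra.
rewrite -[leRHS]powRr1//; apply: ler_powR; rewrite ?invf_le1//; lra.
Qed.

(** Testing the operator on the test function of parameter [rho], and looking at
    the circle of radius [r] only, gives an inequality between two Cauchy means
    that tend to infinity at the same rate. *)
Lemma cauchy_mean_test_le p C kappa d eta r (rho := 1 - eta * (1 - r)) :
  1 <= p -> 0 <= C -> 0 < d <= kappa -> 0 < eta <= 2^-1 -> 0 <= r < 1 ->
  (forall q, (hardy_norm p (Gamma_poly mu q) <= C%:E * hardy_norm p (horner q))%E) ->
  (forall z, normc z = r -> normc (1 - z) <= eta ->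
     kappa <= \int[mu]_(t in D) Re (test_ratio p^-1 rho t z)) ->
  (kappa - d) `^ p * (cauchy_mean (rho * r) - 2 / eta) <=
    (C * (1 + d)) `^ p * cauchy_mean rho.
Proof.
move=> p1 C0 /andP[d0 dk] /andP[e0 e2] /andP[r0 r1] HC Hk.
have p0 : 0 < p by lra.
have r01 : 0 <= rho < 1 by rewrite /rho; nra.
case/andP: (r01) => rho0 rho1.
have s01 : 0 <= rho * r < 1 by nra.
pose f w := cpow (1 - rho%:C%C * w) (- p^-1).
have f2 w : normc w <= 1 -> 2^-1 <= normc (f w) by exact: normc_test_ge.
pose m := fine (mu D).
have m0 : 0 <= m by exact: fine_ge0.
(* Small enough for the error to be at most [d / 2], both for [S] itself and after
   division by [1 - r] and integration; recall that [2^-1 <= normc (f w)]. *)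
pose e := d * (1 - r) / (2 * (m + 1)).
have m1 : 0 < 2 * (m + 1) by lra.
have eps0 : 0 < e by rewrite divr_gt0// mulr_gt0//; lra.
have ed : e <= d / 2.
  rewrite ler_pdivrMr//; have -> : d / 2 * (2 * (m + 1)) = d * (m + 1) by field.
  by rewrite ler_pM2l//; lra.
have em : e / (1 - r) * m <= d / 2.
  have -> : e / (1 - r) * m = d / 2 * (m / (m + 1)).
    by rewrite /e; field; rewrite !gt_eqF//; lra.
  rewrite ler_piMr//; first lra.
  by rewrite ler_pdivrMr; lra.
have [S HS] := disc_algebra_cpow (- p^-1) r01 eps0.
have S1 w : normc w <= 1 -> normc S.[w] <= (1 + d) * normc (f w).
  move=> w1; have h1 := f2 w w1; have h2 := HS w w1.
  have h3 := lerB_normc S.[w] (f w); rewrite normcBC in h3.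
  have h4 : d * 2^-1 <= d * normc (f w) by rewrite ler_pM2l.
  move: h2 h3; rewrite -/(f w); lra.
have G1 z : normc z = r -> normc (1 - z) <= eta ->
    (kappa - d) * normc (f z) <= normc (Gamma_poly mu S z).
  move=> zr ze; have z1 : normc z < 1 by rewrite zr.
  have h1 := normc_Gamma_test_ge p0 r01 z1 (ltW eps0) HS (Hk z zr ze).
  have h2 := f2 z (ltW z1).
  have h4 : d * 2^-1 <= d * normc (f z) by rewrite ler_pM2l.
  move: h1; rewrite zr -/m -/(f z); lra.
pose N := cauchy_mean rho.
have N0 : 0 <= N by apply: Rintegral_ge0 => x _; rewrite invr_ge0 normc_ge0.
have mS : cmeasurable setT (fun x => S.[cis x]) by exact: cmeasurable_horner_cis.
have mG : cmeasurable setT (fun x => Gamma_poly mu S (circle_pt r x)).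
  by apply: cmeasurable_Gamma; rewrite r0.
have lS : (lpnorm p (fun x => S.[cis x]) <= ((1 + d) * N `^ p^-1)%:E)%E.
  apply: lpnorm_le_integral => //; first by rewrite mulr_ge0 ?powR_ge0//; lra.
  rewrite powRM ?powR_ge0//; last lra.
  rewrite -powRrM mulVf ?gt_eqF// powRr1// EFinM /N /cauchy_mean.
  rewrite EFin_Rintegral_circ; last exact: integrable_cauchy_integrand.
  rewrite -ge0_integralZl//; last 3 first.
  - by apply/measurable_EFinP; exact: measurable_cauchy_integrand.
  - by move=> x _; rewrite lee_fin invr_ge0 normc_ge0.
  - by rewrite lee_fin powR_ge0.
  apply: ge0_le_integral => //.
  - by move=> x _; rewrite lee_fin powR_ge0.
  - exact: measurable_mean_integrand.
  - apply/measurable_EFinP; apply: measurable_funM => //.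
    exact: measurable_cauchy_integrand.
  move=> x _; rewrite -EFinM lee_fin.
  have c1 : normc (cis x : R[i]) <= 1 by rewrite normc_cis.
  rewrite -(normc_test_powR p1 r01 c1) -powRM ?normc_ge0//; last lra.
  by apply: ge0_ler_powR; rewrite ?nnegrE ?mulr_ge0 ?normc_ge0 ?S1//; lra.
have lG : (lpnorm p (fun x => Gamma_poly mu S (circle_pt r x)) <=
    (C * (1 + d) * N `^ p^-1)%:E)%E.
  rewrite -integral_mean_lpnorm//.
  apply: le_trans (integral_mean_le_hardy _ _ _) _; first by rewrite r0.
  apply: le_trans (HC S) _.
  rewrite -mulrA EFinM; apply: lee_wpmul2l; first by rewrite lee_fin.
  exact: le_trans (hardy_norm_horner_le _ p1) lS.
have iG : (\int[circ]_x (normc (Gamma_poly mu S (circle_pt r x)) `^ p)%:E <=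
    ((C * (1 + d)) `^ p * N)%:E)%E.
  have cd0 : 0 <= C * (1 + d) by rewrite mulr_ge0//; lra.
  have := integral_le_lpnorm p1 _ lG.
  rewrite powRM ?powR_ge0// -powRrM mulVf ?gt_eqF// powRr1//.
  by apply; rewrite mulr_ge0 ?powR_ge0.
rewrite mulrBr lerBlDr -lee_fin EFinD.
apply: (@le_trans _ _ (\int[circ]_x (normc (Gamma_poly mu S (circle_pt r x)) `^ p)%:E +
   ((kappa - d) `^ p * (2 / eta))%:E)%E); last by apply: leeD.
rewrite -(integral_circ_cst ((kappa - d) `^ p * (2 / eta))).
have k0 : 0 <= (kappa - d) `^ p * (2 / eta).
  by rewrite mulr_ge0 ?powR_ge0// divr_ge0// ltW.
rewrite -ge0_integralD//; last 2 first.
- by move=> x _; rewrite lee_fin powR_ge0.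
- exact: measurable_mean_integrand.
rewrite EFinM /cauchy_mean EFin_Rintegral_circ; last exact: integrable_cauchy_integrand.
rewrite -ge0_integralZl//; last 3 first.
- by apply/measurable_EFinP; exact: measurable_cauchy_integrand.
- by move=> x _; rewrite lee_fin invr_ge0 normc_ge0.
- by rewrite lee_fin powR_ge0.
apply: ge0_le_integral => //.
- by move=> x _; rewrite mule_ge0// lee_fin ?powR_ge0// invr_ge0 normc_ge0.
- apply/measurable_EFinP; apply: measurable_funM => //.
  exact: measurable_cauchy_integrand.
- by apply: emeasurable_funD => //; exact: measurable_mean_integrand.
move=> x _; rewrite -EFinM -EFinD lee_fin.
have zr : normc (circle_pt r x) = r by rewrite normc_circle_pt ger0_norm.
have sE : 1 - (rho * r)%:C%C * cis x = 1 - rho%:C%C * circle_pt r x :> R[i].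
  by rewrite circle_ptE mulrA -rmorphM.
have B0 := normc_1Bcis_gt0 x s01.
(* Away from [1] the left-hand side is at most a constant, as then
   [eta / 2 <= normc (1 - rho r cis x)]. *)
have [near1|far] := leP (normc (1 - circle_pt r x)) eta.
  apply: (@le_trans _ _ (normc (Gamma_poly mu S (circle_pt r x)) `^ p)); last by rewrite lerDl.
  have z1 : normc (circle_pt r x) <= 1 by rewrite zr ltW.
  rewrite sE -(normc_test_powR p1 r01 z1) -powRM ?normc_ge0//; last lra.
  by apply: ge0_ler_powR; rewrite ?nnegrE ?mulr_ge0 ?normc_ge0 ?G1//; lra.
apply: (@le_trans _ _ ((kappa - d) `^ p * (2 / eta))); last by rewrite lerDr powR_ge0.
apply: ler_wpM2l; first exact: powR_ge0.
rewrite -(invf_div eta 2) lef_pV2 ?posrE ?divr_gt0//.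
have -> : 1 - (rho * r)%:C%C * cis x = (1 - circle_pt r x) - (- ((1 - rho) * r))%:C%C * cis x :> R[i].
  have gen (x1 y1 : R) (c : R[i]) :
      1 - (x1 * y1)%:C%C * c = 1 - y1%:C%C * c - (- ((1 - x1) * y1))%:C%C * c.
    rewrite rmorphN !rmorphM rmorphB /=; ring.
  by rewrite circle_ptE; exact: gen.
apply: le_trans (lerB_normc _ _).
have rr : (1 - rho) * r = eta * ((1 - r) * r) by rewrite /rho; ring.
have r2 : 0 <= (1 - r) * r <= 2^-1 by clear -r0 r1; nra.
have e3 : 0 <= eta * ((1 - r) * r) <= eta * 2^-1.
  by case/andP: r2 => ? ?; rewrite mulr_ge0 ?(ltW e0)// ler_pM2l.
rewrite Normc.normcM normcR normc_cis mulr1 normrN rr.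
by case/andP: e3 => ? ?; rewrite ger0_norm//; lra.
Qed.

(** The choice of [rho] makes [rho - rho r] and [1 - rho] comparable. *)
Lemma cauchy_mean_le_inv eta r (rho := 1 - eta * (1 - r)) :
  0 < eta <= 2^-1 -> 0 <= r < 1 -> cauchy_mean rho <= cauchy_mean (rho * r) + eta^-1.
Proof.
move=> /andP[e0 e2] /andP[r0 r1].
have k01 : 0 < eta * (1 - r) <= 2^-1 by nra.
pose k := eta * (1 - r); have rhoE : rho = 1 - k by [].
have rho01 : 2^-1 <= rho < 1 by rewrite /rho; lra.
have sr : 0 <= rho * r <= rho by move: rho01; move: (rho) => y; nra.
apply: le_trans (cauchy_mean_le_add sr _) _; first by lra.
rewrite lerD2l.
have sk : (rho * r) ^+ 2 <= rho ^+ 2 by rewrite lerXn2r ?nnegrE; lra.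
have kk : k <= 1 - rho ^+ 2 by rewrite rhoE; move: k01; rewrite -/k; move: (k) => y; nra.
have k0 : 0 < k by case/andP: k01.
have k1 : (1 - rho ^+ 2)^-1 <= k^-1 by rewrite lef_pV2 ?posrE; lra.
have k2 : (1 - (rho * r) ^+ 2)^-1 <= k^-1 by rewrite lef_pV2 ?posrE; lra.
have s1r : rho - rho * r <= 1 - r by move: rho01; move: (rho) => y; nra.
apply: (@le_trans _ _ ((1 - r) / 2 * (k^-1 + k^-1))).
  apply: ler_pM; rewrite ?addr_ge0 ?invr_ge0//; try lra.
rewrite le_eqVlt; apply/orP; left; apply/eqP; rewrite /k.
by field; rewrite !gt_eqF// subr_gt0.
Qed.

(** The comparison of Cauchy means forces [kappa <= C] as [r] tends to [1]. *)
Lemma kern_integral_le p C : 1 <= p -> 0 <= C ->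
  (forall q, (hardy_norm p (Gamma_poly mu q) <= C%:E * hardy_norm p (horner q))%E) ->
  (\int[mu]_(t in D) (kern p t)%:E <= C%:E)%E.
Proof.
move=> p1 C0 HC; rewrite leNgt; apply/negP => CI.
have [kappa Ck kI] : exists2 kappa : R, C < kappa & (kappa%:E < \int[mu]_(t in D) (kern p t)%:E)%E.
  move: CI; case: (\int[mu]_(t in D) _)%E => [x|_|//].
    by rewrite lte_fin => Cx; exists ((C + x) / 2); rewrite ?lte_fin; lra.
  by exists (C + 1); rewrite ?ltry//; lra.
have [eta e01 Heta] := test_ratio_region p1 kI.
case/andP: (e01) => e0 e2.
(* With this [d] one has [C (1 + d) < kappa - d]. *)
pose d := (kappa - C) / (2 * (C + 1)).
have d0 : 0 < d by rewrite divr_gt0//; lra.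
have dE : d * (C + 1) = (kappa - C) / 2 by rewrite /d; field; lra.
have dk : d <= kappa by nra.
pose A := (kappa - d) `^ p; pose B := (C * (1 + d)) `^ p.
have BA : B < A.
  have p0 : 0 < p by lra.
  by apply: gt0_ltr_powR; rewrite ?nnegrE ?mulr_ge0//; nra.
have B0 : 0 <= B by exact: powR_ge0.
(* The bound for [cauchy_mean (rho * r)] found below is [(2 A + B) / (eta (A - B))];
   the radius is chosen so that the mean exceeds it. *)
pose M := pi * ((2 * A + B) / (eta * (A - B)) + 1).
have M0 : 0 <= M.
  rewrite mulr_ge0 ?pi_ge0// addr_ge0// divr_ge0//; first lra.
  by rewrite mulr_ge0; lra.
pose r := 1 - expR (- M) / 2.
have x0 := expR_gt0 (- M).
have x1 : expR (- M) <= 1 by rewrite expR_le1 oppr_le0.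
have r01 : 0 <= r < 1 by rewrite /r; lra.
have step := @cauchy_mean_test_le p C kappa d eta r p1 C0 _ e01 r01 HC.
pose rho := 1 - eta * (1 - r).
have rho01 : 0 <= rho < 1 by rewrite /rho; nra.
have s01 : 0 <= rho * r < 1 by nra.
have {}step : A * (cauchy_mean (rho * r) - 2 / eta) <= B * cauchy_mean rho.
  apply: step; first by rewrite d0.
  move=> z zr ze; have z1 : normc z < 1 by rewrite zr; lra.
  apply: Heta => //; rewrite zr /rho; lra.
have sM : M < pi * cauchy_mean (rho * r) + 1.
  have h1 := cauchy_mean_ge s01.
  have h2 : M <= ln ((1 + rho * r) / (1 - rho * r)).
    rewrite -[leLHS]expRK ler_ln ?posrE ?expR_gt0//; last first.
      by rewrite divr_gt0//; lra.
    rewrite ler_pdivlMr; last lra.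
    have rE : 1 - rho * r = expR (- M) / 2 * (1 + eta * r) by rewrite /rho /r; ring.
    have : expR M * (1 - rho * r) = (1 + eta * r) / 2.
      rewrite rE mulrA mulrA expRxMexpNx_1; ring.
    nra.
  have h3 : M <= pi * cauchy_mean (rho * r).
    by apply: le_trans h2 _; rewrite -ler_pdivrMl ?pi_gt0.
  lra.
have grow : cauchy_mean rho <= cauchy_mean (rho * r) + eta^-1 by exact: cauchy_mean_le_inv.
have {}step : (A - B) * cauchy_mean (rho * r) <= (2 * A + B) / eta.
  have : B * cauchy_mean rho <= B * (cauchy_mean (rho * r) + eta^-1) by rewrite ler_wpM2l.
  lra.
have AB : 0 < A - B by lra.
have : cauchy_mean (rho * r) <= (2 * A + B) / (eta * (A - B)).
  rewrite -(ler_pM2l AB); apply: le_trans step _.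
  by rewrite le_eqVlt; apply/orP; left; apply/eqP; field; rewrite !gt_eqF//; lra.
rewrite -(ler_pM2l (pi_gt0 R)) => fin.
by move: sM; rewrite /M mulrDr mulr1; have := pi_ge2 R; lra.
Qed.

End LowerBound.

(** * The logarithmic lower bound *)

Section LogarithmicLowerBound.
Context {R : realType}.
Context (mu : {finite_measure set R -> \bar R}).
Implicit Types (C r t x : R).

Local Notation D := (`]0%R, 1%R[%classic : set R).

Lemma wcomp1 t (z : R[i]) : wcomp t 1 z = wt t z.
Proof. by rewrite /wcomp hornerC mulr1. Qed.

Lemma Im_wt t r x : 0 < t < 1 -> 0 <= r < 1 ->
  Im (wt t (circle_pt r x)) =
    sin x * ((1 - t) * r * normc (1 - ((1 - t) * r)%:C%C * cis x) `^ (- 2)).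
Proof.
move=> t01 r01.
have -> : wt t (circle_pt r x) = (1 - ((1 - t) * r)%:C%C * cis x)^-1.
  by rewrite /wt circle_ptE mulrA -rmorphM.
rewrite ImV ImD ImN ImZ [Im (cis x)]/= [Im 1]/=.
rewrite powRN powR_mulrn ?normc_ge0//; ring.
Qed.

(** The imaginary part of [wt t z] has the sign of [Im z], so that there is no
    cancellation in the integral over [t]. *)
Lemma normc_Gamma1_ge r x : 0 <= r < 1 ->
  \int[mu]_(t in D) (`|sin x| *
      ((1 - t) * r * normc (1 - ((1 - t) * r)%:C%C * cis x) `^ (- 2))) <=
    normc (Gamma_poly mu 1 (circle_pt r x)).
Proof.
move=> r01; have /andP[r0 r1] := r01.
have z1 : normc (circle_pt r x) < 1 by rewrite normc_circle_pt ger0_norm.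
rewrite Gamma_polyE//; apply: le_trans (normr_Im_le _) => /=.
have [iRe iIm] := cintegrable_wcomp mu 1 z1.
have e t : D t -> Im (wcomp t 1 (circle_pt r x)) =
    sin x * ((1 - t) * r * normc (1 - ((1 - t) * r)%:C%C * cis x) `^ (- 2)).
  by move=> /itv01P t01; rewrite wcomp1 Im_wt.
have [s0|/ltW s0] := leP 0 (sin x).
  apply: le_trans (ler_norm _); rewrite le_eqVlt; apply/orP; left; apply/eqP.
  by apply: eq_Rintegral => t /set_mem Dt; rewrite e// ger0_norm.
rewrite -[leRHS]normrN; apply: le_trans (ler_norm _).
rewrite -[leRHS]mulN1r -(@RintegralZl _ _ _ mu D (fun t => Im (wcomp t 1 (circle_pt r x))) (-1) mitv01 iIm).
rewrite le_eqVlt; apply/orP; left; apply/eqP.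
by apply: eq_Rintegral => t /set_mem Dt; rewrite e// ler0_norm// mulN1r mulNr.
Qed.

(** Tonelli's theorem and [mean_log]. *)
Lemma log_integral_radius_le C r : 0 <= r < 1 ->
  (hardy_norm 1 (Gamma_poly mu 1) <= C%:E)%E ->
  (\int[mu]_(t in D) (pi^-1 * - ln (1 - (1 - t) * r))%:E <= C%:E)%E.
Proof.
move=> r01 HC; have /andP[r0 r1] := r01.
pose f (u : measurableTypeR R * R) : R :=
  `|sin u.1| * ((1 - u.2) * r * normc (1 - ((1 - u.2) * r)%:C%C * cis u.1) `^ (- 2)).
pose F (u : measurableTypeR R * R) : \bar R := (\1_D u.2 * f u)%:E.
have mG : cmeasurable setT (fun x => Gamma_poly mu 1 (circle_pt r x)) by exact: cmeasurable_Gamma.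
have m2 : measurable_fun setT (fun u : measurableTypeR R * R => (1 - u.2) * r).
  by apply: measurable_funM => //; apply: measurable_funB.
have mf : measurable_fun setT f.
  apply: measurable_funM.
    apply: measurableT_comp => //; apply: measurableT_comp => //.
    by apply: continuous_measurable_fun; exact: continuous_sin.
  apply: measurable_funM => //; apply: measurable_normc_powR.
  apply: cmeasurableB; first exact: cmeasurable_cst.
  apply: cmeasurableM; first exact: cmeasurable_real.
  by apply: cmeasurable_comp => //; exact: cmeasurable_cis.
have mF : measurable_fun setT F.
  apply/measurable_EFinP; apply: measurable_funM => //.
  exact: (measurableT_comp (f := \1_D : R -> R)).
have F0 u : (0 <= F u)%E.
  rewrite lee_fin indicE; case: (boolP (u.2 \in D)) => [uD|_]; last by rewrite mul0r.
  have /andP[u0 u1] : 0 < u.2 < 1 by apply: itv01P; exact: set_mem.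
  by rewrite mul1r !mulr_ge0 ?powR_ge0//; lra.
have FE x : (\int[mu]_t F (x, t) = \int[mu]_(t in D) (f (x, t))%:E)%E.
  rewrite [RHS]integral_mkcond; apply: eq_integral => t _.
  rewrite /F patchE indicE; case: ifPn => _; first by rewrite mul1r.
  by rewrite mul0r.
have EC : (\int[circ]_x (normc (Gamma_poly mu 1 (circle_pt r x)))%:E <= C%:E)%E.
  have := le_trans (integral_mean_le_hardy 1 (Gamma_poly mu 1) r01) HC.
  rewrite integral_mean_lpnorm// /lpnorm invr1 poweRe1; last first.
    by apply: integral_ge0 => x _; rewrite lee_fin powR_ge0.
  by under eq_integral do rewrite powRr1 ?normc_ge0//.
apply: le_trans EC.
apply: (@le_trans _ _ (\int[circ]_x \int[mu]_t F (x, t))%E); last first.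
  apply: ge0_le_integral => //.
  - by move=> x _; exact: integral_ge0.
  - exact: measurable_fun_fubini_tonelli_F.
  - by apply/measurable_EFinP; apply: measurable_normc.
  move=> x _; rewrite FE.
  have [M HM] : exists M : R, forall t, D t -> `|f (x, t)| <= M.
    exists ((1 - r) ^- 2) => t /itv01P /andP[t0 t1].
    have s01 : 0 <= (1 - t) * r < 1 by nra.
    rewrite /f /= !normrM normr_id.
    have n0 := normc_1Bcis_gt0 x s01.
    rewrite powRN powR_mulrn ?normc_ge0// normfV (ger0_norm (x := _ ^+ 2)) ?exprn_ge0 ?normc_ge0//.
    have h1 : `|sin x| * (`|1 - t| * `|r|) <= 1.
      rewrite mulr_ile1 ?mulr_ge0//.
        by rewrite ler_norml sin_geN1 sin_le1.
      by case/andP: s01 => h1 h2; rewrite -normrM ger0_norm// ltW.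
    have h2 : (normc (1 - ((1 - t) * r)%:C%C * cis x) ^+ 2)^-1 <= (1 - r) ^- 2.
      rewrite lef_pV2 ?posrE ?exprn_gt0 ?subr_gt0//.
      rewrite lerXn2r ?nnegrE ?normc_ge0 ?subr_ge0 ?(ltW r1)//.
      by apply: le_trans (normc_1Bcis_ge x s01); nra.
    rewrite mulrA -[leRHS]mul1r; apply: ler_pM => //; rewrite ?mulr_ge0 ?invr_ge0 ?exprn_ge0 ?normc_ge0//.
  have iF : mu.-integrable D (fun t => (f (x, t))%:E).
    apply: (@bounded_integrable _ _ _ mu _ mitv01 _ M) => //.
    by apply: measurable_funTS; apply: (measurableT_comp mf).
  rewrite -[leLHS]fineK; last exact: (integrable_fin_num mitv01 iF).
  by rewrite lee_fin; exact: normc_Gamma1_ge.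
rewrite fubini_tonelli// integral_mkcond; apply: ge0_le_integral => //.
- move=> t _; rewrite patchE; case: ifPn => // tD; rewrite lee_fin.
  have /andP[t0 t1] : 0 < t < 1 by apply: itv01P; exact: set_mem.
  rewrite mulr_ge0 ?invr_ge0 ?pi_ge0// oppr_ge0 ln_le0//; nra.
- apply/(measurable_restrictT _ mitv01)/measurable_EFinP; apply: measurable_funM => //.
  apply: measurableT_comp => //; apply: (measurableT_comp (@measurable_ln R)).
  by apply: measurable_funB => //; apply: measurable_funM => //; exact: measurable_funB.
- exact: measurable_fun_fubini_tonelli_G.
move=> t _; rewrite patchE; case: ifPn => [tD|_]; last exact: integral_ge0.
have /andP[t0 t1] : 0 < t < 1 by apply: itv01P; exact: set_mem.
have s01 : 0 <= (1 - t) * r < 1 by nra.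
rewrite /F /= indicE tD; under eq_integral do rewrite mul1r.
rewrite /f /= mean_log// lee_fin ler_pM2l ?invr_gt0 ?pi_gt0//.
case/andP: s01; move: ((1 - t) * r) => s s0 s1.
have d0 : 0 < 1 - s by rewrite subr_gt0.
rewrite -lnV ?posrE// ler_ln ?posrE ?invr_gt0 ?divr_gt0//; last by lra.
by rewrite ler_peMl ?invr_ge0 ?(ltW d0)// lerDl.
Qed.

Lemma log_integral_le C : (hardy_norm 1 (Gamma_poly mu 1) <= C%:E)%E ->
  (\int[mu]_(t in D) (- ln t)%:E <= (pi * C)%:E)%E.
Proof.
move=> HC; pose r n : R := 1 - n.+1%:R^-1.
have r01 n : 0 <= r n < 1.
  by rewrite /r subr_ge0 invf_le1 ?ltr0n// ler1n/= ltrBlDr ltrDl invr_gt0.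
have lim t : D t -> (limn_einf (fun n => (- ln (1 - (1 - t) * r n))%:E) = (- ln t)%:E)%E.
  move=> /itv01P/andP[t0 t1]; apply: (cvg_limn_einf_sup _).1.
  apply: cvg_EFin; first exact: nearW.
  apply: cvgN; apply: (continuous_cvg _ (continuous_ln t0)).
  rewrite [X in _ --> X](_ : t = 1 - (1 - t) * (1 - 0)); last by ring.
  apply: cvgB; first exact: cvg_cst.
  apply: cvgMr; apply: cvgB; first exact: cvg_cst.
  exact: cvg_harmonic.
have mg n : measurable_fun D (fun t => (- ln (1 - (1 - t) * r n))%:E).
  apply/measurable_EFinP; apply: measurableT_comp => //.
  apply: measurable_funTS; apply: (measurableT_comp (@measurable_ln R)).
  by apply: measurable_funB => //; apply: measurable_funM => //; exact: measurable_funB.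
have g0 n t : D t -> (0 <= (- ln (1 - (1 - t) * r n))%:E)%E.
  move=> /itv01P/andP[t0 t1]; have /andP[h1 h2] := r01 n.
  by rewrite lee_fin oppr_ge0 ln_le0//; nra.
have := fatou mu mitv01 mg g0.
rewrite (_ : (\int[mu]_(t in D) _)%E = (\int[mu]_(t in D) (- ln t)%:E)%E); last first.
  by apply: eq_integral => t /set_mem; exact: lim.
move=> h; apply: le_trans h _.
rewrite limn_einf_lim; apply: lime_le; first exact: is_cvg_einfs.
apply: nearW => n; apply: (@le_trans _ _ (\int[mu]_(t in D) (- ln (1 - (1 - t) * r n))%:E)%E).
  by apply: ereal_inf_lbound; exists n => //=.
have := log_integral_radius_le (r01 n) HC.
under eq_integral do rewrite EFinM.
rewrite ge0_integralZl//; last 2 first.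
- by move=> t; exact: g0.
- by rewrite lee_fin invr_ge0 pi_ge0.
move=> h; rewrite EFinM; apply: le_trans (lee_wpmul2l _ h); last by rewrite lee_fin pi_ge0.
by rewrite muleA -EFinM mulfV ?gt_eqF ?pi_gt0// mul1e.
Qed.

End LogarithmicLowerBound.

Section PsiLowerBound.
Context {R : realType}.
Implicit Types (mu : {finite_measure set R -> \bar R}) (p C t : R) (q : {poly R[i]}).

Local Notation D := (`]0%R, 1%R[%classic : set R).

(** The kernel dominates for [2^-1 <= t], the logarithm for [t <= 2^-1]. *)
Lemma psi1_le t : 0 < t < 1 -> psi 1 t <= 2 * kern 1 t + 2 * - ln t.
Proof.
move=> /andP[t0 t1]; rewrite /psi eqxx ln_exp_div// /kern invr1 subrr powRr0 powRr1; last lra.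
have l0 : 0 <= - ln t by rewrite oppr_ge0 ln_le0// ltW.
have i1 : 1 <= (1 - t)^-1 by rewrite invf_ge1//; lra.
have [t2|t2] := leP t 2^-1.
  have i2 : (1 - t)^-1 <= 2 by rewrite invf_ple ?posrE//; lra.
  have : - ln t * (1 - t)^-1 <= - ln t * 2 by rewrite ler_wpM2l.
  lra.
have l1 : - ln t <= 1.
  rewrite -lnV ?posrE// -[leRHS](expRK 1) ler_ln ?posrE ?expR_gt0 ?invr_gt0//.
  apply: (@le_trans _ _ 2); last by have := expR_ge1Dx (1 : R); lra.
  by rewrite invf_ple ?posrE// ltW.
have : - ln t * (1 - t)^-1 <= 1 * (1 - t)^-1 by rewrite ler_wpM2r//; lra.
lra.
Qed.

(** For [p = 1] the two tests are combined: singular functions at [1] account for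
    the factor [(1 - t)^-1], the constant [1] for the logarithm. *)
Lemma psi_integral_le p : 1 <= p -> exists2 A : R, 0 < A & forall mu C, 0 <= C ->
  (forall q, (hardy_norm p (Gamma_poly mu q) <= C%:E * hardy_norm p (horner q))%E) ->
  (A%:E * \int[mu]_(t in D) (psi p t)%:E <= C%:E)%E.
Proof.
move=> p1; have [p1E|pn1] := eqVneq p 1; last first.
  exists 1 => // mu C C0 HC; rewrite mul1e.
  have := kern_integral_le p1 C0 HC.
  by rewrite (_ : psi p = kern p)//; apply/funext => t; rewrite /psi (negbTE pn1).
have P0 : 0 < 2 + 2 * pi :> R by have := pi_gt0 R; lra.
exists (2 + 2 * pi)^-1 => [|mu C C0 HC]; first by rewrite invr_gt0.
have kC := kern_integral_le p1 C0 HC.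
subst p.
have lC : (\int[mu]_(t in D) (- ln t)%:E <= (pi * C)%:E)%E.
  apply: log_integral_le; apply: le_trans (HC 1) _.
  rewrite -[leRHS]mule1; apply: lee_wpmul2l; first by rewrite lee_fin.
  apply: le_trans (hardy_norm_horner_le _ p1) _; apply: lpnorm_le_cst => //.
    exact: cmeasurable_horner_cis.
  by move=> x; rewrite hornerC Normc.normc1.
have ml : measurable_fun D (fun t : R => (- ln t)%:E).
  by apply/measurable_EFinP; apply: measurableT_comp => //; apply: measurable_funTS; exact: measurable_ln.
have mk : measurable_fun D (fun t => (kern 1 t)%:E).
  by apply/measurable_EFinP; apply: measurable_funTS; exact: measurable_kern.
have k0 t : D t -> (0 <= (kern 1 t)%:E)%E by move=> /itv01P t01; rewrite lee_fin ltW ?kern_gt0.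
have l0 (t : R) : D t -> (0 <= (- ln t)%:E)%E.
  by move=> /itv01P /andP[t0 t1]; rewrite lee_fin oppr_ge0 ln_le0// ltW.
have : (\int[mu]_(t in D) (psi 1 t)%:E <=
    2%:E * \int[mu]_(t in D) (kern 1 t)%:E + 2%:E * \int[mu]_(t in D) (- ln t)%:E)%E.
  rewrite -!ge0_integralZl//; try exact: mitv01.
  rewrite -ge0_integralD//; last 4 first.
  - by move=> t Dt; apply: mule_ge0 => //; exact: k0.
  - exact: measurable_funeM.
  - by move=> t Dt; apply: mule_ge0 => //; exact: l0.
  - exact: measurable_funeM.
  apply: ge0_le_integral => //.
  - by move=> t /itv01P t01; rewrite lee_fin ltW ?psi_gt0.
  - by apply/measurable_EFinP; apply: measurable_funTS; exact: measurable_psi.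
  - by apply: emeasurable_funD; exact: measurable_funeM.
  by move=> t /itv01P t01; rewrite -!EFinM -EFinD lee_fin; exact: psi1_le.
move=> h; have {}h : (\int[mu]_(t in D) (psi 1 t)%:E <= ((2 + 2 * pi) * C)%:E)%E.
  apply: le_trans h _; have -> : ((2 + 2 * pi) * C)%:E = (2%:E * C%:E + 2%:E * (pi * C)%:E)%E.
    by rewrite -!EFinM -EFinD; congr (_%:E); ring.
  by apply: leeD; apply: lee_wpmul2l.
apply: le_trans (lee_wpmul2l _ h) _; first by rewrite lee_fin invr_ge0 ltW.
by rewrite -EFinM mulrA mulVf ?mul1r// gt_eqF.
Qed.

End PsiLowerBound.

(** * Power series with bounded means *)

Section PowerSeries.
Context {R : realType}.
Implicit Types (a c : nat -> R[i]) (F f : R[i] -> R[i]) (p r e M : R) (z : R[i]).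

Definition sums_to a F := forall z, normc z < 1 -> forall e, 0 < e ->
  exists N0, forall N, (N0 <= N)%N -> normc (\sum_(n < N) a n * z ^+ n - F z) <= e.

Lemma analytic_on_discP f : analytic_on_disc f <-> exists a, sums_to a f.
Proof.
split=> -[a ha]; exists a.
  move=> z /unit_discE z1; have /cvg_normcP h := ha z z1 => e e0.
  have [N0 hN0] := h e e0; exists N0 => N NN.
  by have := hN0 N NN; rewrite /series /= big_mkord.
move=> z /unit_discE z1; apply/cvg_normcP => e e0; have [N0 hN0] := ha z z1 e e0.
by exists N0 => N NN; rewrite /series /= big_mkord; exact: hN0.
Qed.

Lemma sum_normc_le I (s : seq I) (P : pred I) (x : I -> R[i]) :
  normc (\sum_(i <- s | P i) x i) <= \sum_(i <- s | P i) normc (x i).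
Proof.
elim/big_rec2: _ => [|i y z _ h]; first by rewrite Normc.normc0.
by apply: le_trans (ler_normcD _ _) _; rewrite lerD2l.
Qed.

Lemma power_series_tail_le a M (x : R) N K z : 0 <= x < 1 -> normc z <= 1 -> 0 <= M ->
  (forall n, (N <= n)%N -> normc (a n * z ^+ n) <= M * x ^+ n) ->
  normc (\sum_(n < N + K) a n * z ^+ n - \sum_(n < N) a n * z ^+ n) <=
    M * (x ^+ N / (1 - x)).
Proof.
move=> x01 z1 M0 H; rewrite big_split_ord /= [X in normc X]addrAC subrr add0r.
apply: le_trans (sum_normc_le _ _ _) _.
apply: (@le_trans _ _ (\sum_(i < K) M * x ^+ (N + i))).
  by apply: ler_sum => i _; apply: H; exact: leq_addr.
rewrite -mulr_sumr; apply: ler_wpM2l => //.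
under eq_bigr do rewrite exprD.
rewrite -mulr_sumr; apply: ler_wpM2l; first by rewrite exprn_ge0//; case/andP: x01.
have := binomial_partial_le 0 K x01; rewrite expr1.
by under eq_bigr do rewrite bin0 mul1r.
Qed.

(** The terms at a point of modulus between [r] and [1] are bounded, which
    dominates the series on the disc of radius [r] by a geometric one. *)
Lemma sums_to_uniform a F r e : sums_to a F -> 0 <= r < 1 -> 0 < e ->
  exists N0, forall N z, (N0 <= N)%N -> normc z <= r ->
    normc (\sum_(n < N) a n * z ^+ n - F z) <= e.
Proof.
move=> aF /andP[r0 r1] e0; pose s := (1 + r) / 2.
have rs : r < s by rewrite /s; lra.
have s1 : s < 1 by rewrite /s; lra.
have s0 : 0 < s by exact: le_lt_trans rs.
have s1' : normc (s%:C%C : R[i]) < 1 by rewrite normcR gtr0_norm.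
have [N1 hN1] := aF _ s1' 1 ltr01.
have term n : (N1 <= n)%N -> normc (a n) * s ^+ n <= 2.
  move=> Nn; have h1 := hN1 n Nn; have h2 := hN1 n.+1 (leq_trans Nn (leqnSn n)).
  rewrite -[X in _ * X](_ : normc (s%:C%C ^+ n) = _); last by rewrite normcX normcR gtr0_norm.
  rewrite -Normc.normcM.
  have -> : a n * s%:C%C ^+ n = (\sum_(m < n.+1) a m * s%:C%C ^+ m - F s%:C%C) -
      (\sum_(m < n) a m * s%:C%C ^+ m - F s%:C%C).
    by rewrite big_ord_recr /=; ring.
  apply: le_trans (ler_normcB _ _) _; lra.
pose x := r / s.
have x01 : 0 <= x < 1 by rewrite /x divr_ge0 ?(ltW s0)//= ltr_pdivrMr// mul1r.
have d0 : 0 < e * (1 - x) / 4 by rewrite divr_gt0// mulr_gt0// subr_gt0; case/andP: x01.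
have [N2 hN2] := geometric_small x01 d0.
exists (maxn N1 N2) => N z; rewrite geq_max => /andP[N1N N2N] zr.
have z1 : normc z < 1 by exact: le_lt_trans r1.
have e20 : 0 < e / 2 by rewrite divr_gt0.
have [N3 hN3] := aF z z1 _ e20.
have h3 := hN3 (N + N3)%N (leq_addl _ _).
have h4 : normc (\sum_(n < N + N3) a n * z ^+ n - \sum_(n < N) a n * z ^+ n) <=
    2 * (x ^+ N / (1 - x)).
  apply: power_series_tail_le => //; first exact: ltW.
  move=> n Nn; have := term n (leq_trans N1N Nn) => tn.
  rewrite Normc.normcM normcX; apply: (@le_trans _ _ (normc (a n) * r ^+ n)).
    by apply: ler_wpM2l; rewrite ?normc_ge0// lerXn2r ?nnegrE ?normc_ge0.
  have -> : r = s * x by rewrite /x mulrC divfK// gt_eqF.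
  by rewrite exprMn mulrA ler_wpM2r ?exprn_ge0//; case/andP: x01.
have h5 : 2 * (x ^+ N / (1 - x)) <= e / 2.
  case/andP: x01 => x0 x1; rewrite mulrA ler_pdivrMr ?subr_gt0//.
  have h : x ^+ N <= e * (1 - x) / 4.
    by apply: le_trans hN2; rewrite ler_wiXn2l// ltW.
  lra.
have -> : \sum_(n < N) a n * z ^+ n - F z = (\sum_(n < N + N3) a n * z ^+ n - F z) -
   (\sum_(n < N + N3) a n * z ^+ n - \sum_(n < N) a n * z ^+ n) by ring.
apply: le_trans (ler_normcB _ _) _; lra.
Qed.

Lemma cmeasurable_sums_to a F r : sums_to a F -> 0 <= r < 1 ->
  cmeasurable setT (fun x => F (circle_pt r x)).
Proof.
move=> aF /andP[r0 r1].
apply: (@cmeasurable_cvg _ (fun N x => \sum_(n < N) a n * circle_pt r x ^+ n)).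
  move=> N; apply: cmeasurable_sum => n; apply: cmeasurableM.
    exact: cmeasurable_cst.
  by apply: cmeasurableX; exact: cmeasurable_circle_pt.
by move=> x e e0; apply: aF => //; rewrite normc_circle_pt ger0_norm.
Qed.

Lemma cint_conj (f : R -> R[i]) : cintegrable circ setT f ->
  cint circ setT (fun x => (f x)^*%C) = (cint circ setT f)^*%C.
Proof.
move=> [iR iI]; apply: eqcP.
  by rewrite /cint /=; apply: eq_Rintegral => x _; case: (f x).
rewrite /cint /= -mulN1r -(RintegralZl _ _ iI)//.
by apply: eq_Rintegral => x _; rewrite mulN1r; case: (f x).
Qed.

Lemma cint_cis_conj m n :
  cint circ setT (fun x => cis x ^+ m * (cis x ^+ n)^*%C) = (m == n)%:R :> R[i].
Proof.
have cjE k l x : cis x ^+ (k + l) * (cis x ^+ l)^*%C = cis x ^+ k :> R[i].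
  by rewrite exprD -mulrA mulcJ normcX normc_cis !expr1n; exact: mulr1.
have [mn|nm] := leqP n m.
  have [k ->] : exists k, m = (k + n)%N by exists (m - n)%N; rewrite subnK.
  under eq_cint do rewrite cjE.
  case: k => [|k]; first by rewrite add0n eqxx; under eq_cint do rewrite expr0; exact: cint_circ1.
  by rewrite cint_cis -[X in _ == X]add0n eqn_add2r.
have [k ->] : exists k, n = (k.+1 + m)%N.
  by exists (n - m).-1; rewrite prednK ?subn_gt0// subnK// ltnW.
transitivity (cint circ setT (fun x => ((cis x ^+ k.+1)^*%C : R[i]))).
  apply: eq_cint => x _; rewrite -(cjE k.+1 m) conjcM conjcK mulrC; congr (_ * _).
rewrite cint_conj ?cint_cis ?conjc0.
  by rewrite -[X in X == _]add0n eqn_add2r.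
apply: (@cintegrable_circ _ _ 1); first by apply: cmeasurableX; exact: cmeasurable_cis.
by move=> x; rewrite normcX normc_cis expr1n.
Qed.

Lemma mean_le_lpnorm p (f : R -> R[i]) M : 1 <= p -> cmeasurable setT f ->
  (forall x, normc (f x) <= M) -> ((\int[circ]_x normc (f x))%:E <= lpnorm p f)%E.
Proof.
move=> p1 mf fM; have p0 : 0 < p by lra.
have i1 : circ.-integrable setT (fun x : R => (1 : R)%:E).
  by apply: (@integrable_circ _ _ 1) => // x; rewrite normr1.
have if_ : circ.-integrable setT (fun x => (normc (f x))%:E).
  apply: (@integrable_circ _ _ M); first exact: measurable_normc.
  by move=> x; rewrite ger0_norm ?normc_ge0.
have I0 : 0 <= \int[circ]_x normc (f x) by apply: Rintegral_ge0 => x _; exact: normc_ge0.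
have := @weighted_jensen _ _ _ circ setT p 1 (fun=> 1) (fun x => normc (f x)).
move=> /(_ measurableT p1 ltr01 (measurable_normc mf)).
move=> /(_ (fun x _ => normc_ge0 _) (fun _ _ => ler01) i1).
have -> : (fun x => (normc (f x) * 1)%:E) = (fun x => (normc (f x))%:E).
  by apply/funext => x; rewrite mulr1.
move=> /(_ if_); rewrite Rintegral_cst// mul1r circ_setT => /(_ (lexx _)).
rewrite powR1 mul1e => h.
have -> : (\int[circ]_x normc (f x))%:E =
    (((\int[circ]_x (normc (f x) * 1)) `^ p)%:E `^ p^-1)%E.
  rewrite poweR_EFin -powRrM mulfV ?gt_eqF// powRr1; last by under eq_Rintegral do rewrite mulr1.
  by under [in RHS]eq_Rintegral do rewrite mulr1.
rewrite /lpnorm; apply: gt0_ler_poweR.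
- by rewrite invr_ge0 ltW.
- by rewrite in_itv/= leey andbT lee_fin powR_ge0.
- by rewrite in_itv/= leey andbT; apply: integral_ge0 => x _; rewrite lee_fin powR_ge0.
- apply: le_trans h _; rewrite le_eqVlt; apply/orP; left; apply/eqP.
  by apply: eq_integral => x _; rewrite mulr1.
Qed.

(** The coefficient is the mean of [q] against the conjugate of a power of
    [cis x]. *)
Lemma normc_coef_le p (q : {poly R[i]}) n : 1 <= p ->
  ((normc q`_n)%:E <= lpnorm p (fun x => q.[cis x]))%E.
Proof.
move=> p1; have [M M0 HM] := horner_bound q.
have qM x : normc q.[cis x] <= M by apply: HM; rewrite normc_cis.
have mq : cmeasurable setT (fun x => q.[cis x]) by exact: cmeasurable_horner_cis.
have mqc : cmeasurable setT (fun x => q.[cis x] * (cis x ^+ n)^*%C).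
  by apply: cmeasurableM => //; apply: cmeasurable_conj; apply: cmeasurableX; exact: cmeasurable_cis.
have nE x : normc (q.[cis x] * (cis x ^+ n)^*%C) = normc q.[cis x].
  by rewrite Normc.normcM normcJ normcX normc_cis expr1n mulr1.
apply: le_trans (mean_le_lpnorm p1 mq qM).
have ii k : cintegrable circ setT (fun x => cis x ^+ k * (cis x ^+ n)^*%C : R[i]).
  apply: (@cintegrable_circ _ _ 1).
    apply: cmeasurableM; first by apply: cmeasurableX; exact: cmeasurable_cis.
    by apply: cmeasurable_conj; apply: cmeasurableX; exact: cmeasurable_cis.
  by move=> x; rewrite Normc.normcM normcJ !normcX normc_cis !expr1n mulr1.
have -> : q`_n = cint circ setT (fun x => q.[cis x] * (cis x ^+ n)^*%C).
  transitivity (cint circ setT (fun x => \sum_(k < size q) q`_k * (cis x ^+ k * (cis x ^+ n)^*%C))).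
    rewrite (cint_sum measurableT (index_enum _) (fun k : 'I_(size q) =>
      cintegrableZ measurableT q`_k (ii k))).2.
    under eq_bigr do rewrite (cintZ measurableT _ (ii _)) cint_cis_conj.
    have [nq|qn] := ltnP n (size q).
      rewrite (bigD1 (Ordinal nq)) //= eqxx mulr1 big1 ?addr0// => k kn.
      by rewrite (_ : (k : nat) == n = false) ?mulr0//; apply: contraNF kn => /eqP kE; apply/eqP/val_inj.
    rewrite nth_default// big1// => k _.
    by rewrite (_ : (k : nat) == n = false) ?mulr0//; apply/negbTE; rewrite neq_ltn (leq_trans (ltn_ord k) qn).
  by apply: eq_cint => x _; rewrite horner_coef mulr_suml; apply: eq_bigr => k _; rewrite mulrA.
rewrite lee_fin; apply: le_trans (normc_cint_le _ _ _) _ => //.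
- by apply: (@cintegrable_circ _ _ M) => // x; rewrite nE.
- apply: (@integrable_circ _ _ M); first exact: measurable_normc.
  by move=> x; rewrite nE ger0_norm ?normc_ge0.
- by rewrite le_eqVlt; apply/orP; left; apply/eqP; apply: eq_Rintegral => x _; rewrite nE.
Qed.

(** Cauchy's estimate, on circles whose radius tends to [1]; the partial sums of the
    series, which are polynomials, converge uniformly on each of them. *)
Lemma normc_taylor_le p a F M n : 1 <= p -> sums_to a F -> 0 <= M ->
  (hardy_norm p F <= M%:E)%E -> normc (a n) <= M.
Proof.
move=> p1 aF M0 FM.
have step r : 0 <= r < 1 -> normc (a n) * r ^+ n <= M.
  move=> r01; have /andP[r0 r1] := r01; apply/ler_addgt0Pr => e e0.
  have [N0 hN0] := sums_to_uniform aF r01 e0.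
  pose N := maxn N0 n.+1.
  pose P : {poly R[i]} := \poly_(k < N) (a k * r%:C%C ^+ k).
  have PE x : P.[cis x] = \sum_(k < N) a k * circle_pt r x ^+ k.
    by rewrite horner_poly; apply: eq_bigr => k _; rewrite circle_ptE exprMn mulrA.
  have Pn : P`_n = a n * r%:C%C ^+ n by rewrite coef_poly leq_maxr.
  have -> : normc (a n) * r ^+ n = normc P`_n.
    by rewrite Pn Normc.normcM normcX normcR ger0_norm.
  rewrite -lee_fin; apply: le_trans (normc_coef_le P n p1) _.
  have mF := cmeasurable_sums_to aF r01.
  have mP : cmeasurable setT (fun x => P.[cis x]) by exact: cmeasurable_horner_cis.
  have -> : (fun x => P.[cis x]) = (fun x => F (circle_pt r x) + (P.[cis x] - F (circle_pt r x))).
    by apply/funext => x; rewrite addrC subrK.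
  have mPF : cmeasurable setT (fun x => P.[cis x] - F (circle_pt r x)) by exact: cmeasurableB.
  apply: le_trans (lpnormD p1 mF mPF) _; rewrite EFinD; apply: leeD.
    apply: le_trans FM; rewrite -integral_mean_lpnorm//.
    exact: integral_mean_le_hardy.
  apply: lpnorm_le_cst => //; first exact: ltW.
  move=> x; rewrite PE; apply: hN0; first exact: leq_maxl.
  by rewrite normc_circle_pt ger0_norm.
rewrite leNgt; apply/negP => lt.
have h : (normc (a n) * (1 - k.+1%:R^-1) ^+ n : R) @[k --> \oo] --> normc (a n) * (1 - 0) ^+ n.
  apply: cvgMr; apply: (continuous_cvg _ (@exprn_continuous _ n _)).
  by apply: cvgB; [exact: cvg_cst|exact: cvg_harmonic].
rewrite subr0 expr1n mulr1 in h.
have : normc (a n) <= M.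
  rewrite -(cvg_lim _ h)//; apply: limr_le; first by apply/cvg_ex; eexists; exact: h.
  apply: nearW => k; apply: step.
  by rewrite subr_ge0 invf_le1 ?ltr0n// ler1n/= ltrBlDr ltrDl invr_gt0.
by rewrite leNgt lt.
Qed.

Lemma power_series_value_le a F M z N : sums_to a F -> 0 <= M ->
  (forall n, normc (a n) <= M) -> normc z < 1 ->
  normc (F z - \sum_(n < N) a n * z ^+ n) <= M * (normc z ^+ N / (1 - normc z)).
Proof.
move=> aF M0 aM z1; apply/ler_addgt0Pr => e e0.
have [N0 hN0] := aF z z1 e e0.
have h := hN0 (N + N0)%N (leq_addl _ _).
have h2 : normc (\sum_(n < N + N0) a n * z ^+ n - \sum_(n < N) a n * z ^+ n) <=
    M * (normc z ^+ N / (1 - normc z)).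
  apply: power_series_tail_le => //; [by rewrite normc_ge0|exact: ltW|].
  by move=> n _; rewrite Normc.normcM normcX ler_wpM2r ?exprn_ge0 ?normc_ge0.
have -> : F z - \sum_(n < N) a n * z ^+ n =
  (\sum_(n < N + N0) a n * z ^+ n - \sum_(n < N) a n * z ^+ n) -
  (\sum_(n < N + N0) a n * z ^+ n - F z) by ring.
apply: le_trans (ler_normcB _ _) _; exact: lerD.
Qed.

End PowerSeries.

(** * Limits along an ultrafilter *)

Section UltraLimit.
Context {R : realType} (U : set_system nat) {UU : UltraFilter U}.
Context (oU : \oo `<=` U).
Implicit Types (x y : nat -> R[i]) (l c : R[i]) (e M : R).

Definition is_ulim x l := forall e, 0 < e -> U [set j | normc (x j - l) <= e].

Lemma ultra_ex (A : set nat) : U A -> exists j, A j.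
Proof. exact: (@filter_ex _ U (@ultra_proper _ _ UU) A). Qed.

(** By compactness of an interval there is a cluster point, and an ultrafilter
    converges to each of its cluster points. *)
Lemma real_ulim_exists (y : nat -> R) M : (forall j, `|y j| <= M) ->
  exists l : R, forall e, 0 < e -> U [set j | `|y j - l| <= e].
Proof.
move=> yM; have := @segment_compact R (- M) M (y @ U) _.
case=> [|l [_ cl]].
  rewrite /nbhs/= (_ : y @^-1` _ = setT); first exact: filterT.
  by apply/seteqP; split=> // j _; rewrite /preimage /= in_itv/= -ler_norml.
exists l => e e0; have [//|nU] := in_ultra_setVsetC [set j | `|y j - l| <= e] UU.
have b : nbhs l (ball l e) by exact: nbhsx_ballx.
have yn : (y @ U) (y @` (~` [set j | `|y j - l| <= e])).
  by rewrite /nbhs/=; apply: (@filterS _ U _ _ _ _ nU) => j nj; exists j.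
have [_ [[j nj <-]]] := cl _ _ yn b.
by rewrite /ball/= distrC => lt; exfalso; apply: nj => /=; exact: ltW.
Qed.

Lemma ulim_exists x M : (forall j, normc (x j) <= M) -> exists l, is_ulim x l.
Proof.
move=> xM.
have [a ha] := @real_ulim_exists (fun j => Re (x j)) M
  (fun j => le_trans (normr_Re_le _) (xM j)).
have [b hb] := @real_ulim_exists (fun j => Im (x j)) M
  (fun j => le_trans (normr_Im_le _) (xM j)).
exists (a +i* b)%C => e e0; have e2 : 0 < e / 2 by rewrite divr_gt0.
apply: filterS (filterI (ha _ e2) (hb _ e2)) => j [/= h1 h2].
apply: le_trans (normc_le_ReIm _) _; rewrite ReD ReN ImD ImN /=; lra.
Qed.

Lemma ulim_unique x l c : is_ulim x l -> is_ulim x c -> l = c.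
Proof.
move=> xl xc; apply/eqP; rewrite -subr_eq0 -normc_eq0; apply/eqP/le_anti.
rewrite normc_ge0 andbT; apply/ler_addgt0Pr => e e0; rewrite add0r.
have e2 : 0 < e / 2 by rewrite divr_gt0.
have [j [/= h1 h2]] := ultra_ex (filterI (xl _ e2) (xc _ e2)).
have -> : l - c = (x j - c) - (x j - l) by ring.
apply: le_trans (ler_normcB _ _) _; lra.
Qed.

Lemma ulimD x y l c : is_ulim x l -> is_ulim y c -> is_ulim (fun j => x j + y j) (l + c).
Proof.
move=> xl yc e e0; have e2 : 0 < e / 2 by rewrite divr_gt0.
apply: filterS (filterI (xl _ e2) (yc _ e2)) => j [/= h1 h2].
rewrite opprD addrACA; apply: le_trans (ler_normcD _ _) _; lra.
Qed.

Lemma ulimZ x l c : is_ulim x l -> is_ulim (fun j => c * x j) (c * l).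
Proof.
move=> xl e e0; have c0 : 0 < normc c + 1 by rewrite ltr_wpDl ?normc_ge0.
have ec : 0 < e / (normc c + 1) by rewrite divr_gt0.
apply: filterS (xl _ ec) => j /= h; rewrite -mulrBr Normc.normcM.
apply: (@le_trans _ _ ((normc c + 1) * (e / (normc c + 1)))); last by rewrite mulrC divfK// gt_eqF.
by apply: ler_pM; rewrite ?normc_ge0// lerDl.
Qed.

Lemma ulim_cvg x l : (forall e, 0 < e -> exists N, forall j, (N <= j)%N -> normc (x j - l) <= e) ->
  is_ulim x l.
Proof. by move=> H e e0; apply: oU; have [N hN] := H e e0; exists N. Qed.

Lemma ulim_le x l c M : is_ulim x l -> (forall j, normc (x j - c) <= M) -> normc (l - c) <= M.
Proof.
move=> xl xM; apply/ler_addgt0Pr => e e0; have [j /= h] := ultra_ex (xl e e0).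
have -> : l - c = (x j - c) - (x j - l) by ring.
by apply: le_trans (ler_normcB _ _) _; exact: lerD.
Qed.

Lemma ulim_sum_small (x : nat -> nat -> R[i]) (l : nat -> R[i]) N e :
  (forall n, is_ulim (x n) (l n)) -> 0 < e ->
  U [set j | \sum_(n < N) normc (x n j - l n) <= e].
Proof.
move=> xl; elim: N e => [|N IH] e e0.
  by apply: filterS filterT => j _ /=; rewrite big_ord0 ltW.
have e2 : 0 < e / 2 by rewrite divr_gt0.
apply: filterS (filterI (IH _ e2) (xl N _ e2)) => j [/= h1 h2].
rewrite big_ord_recr /=; lra.
Qed.

End UltraLimit.

(** * Extension from polynomials to the Hardy space *)

Section Extension.
Context {R : realType} (mu : {finite_measure set R -> \bar R}) (p C : R).
Context (U : set_system nat) {UU : UltraFilter U} (oU : \oo `<=` U).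
Context (p1 : 1 <= p) (C0 : 0 <= C).
Context (HC : forall q, (hardy_norm p (Gamma_poly mu q) <= C%:E * hardy_norm p (horner q))%E).
Implicit Types (f g : R[i] -> R[i]) (q : {poly R[i]}) (z : R[i]) (e H r : R) (j n : nat).

Lemma sums_to_Gamma q : sums_to (Gamma_coef mu q) (Gamma_poly mu q).
Proof. by move=> z z1 e e0; rewrite Gamma_polyE//; exact: Gamma_series. Qed.

Lemma sums_to_horner q : sums_to (fun n => q`_n) (horner q).
Proof.
move=> z _ e e0; exists (size q) => N Nq.
suff -> : \sum_(n < N) q`_n * z ^+ n = q.[z] by rewrite subrr Normc.normc0 ltW.
by rewrite (horner_coef_wide _ Nq).
Qed.

Lemma Gamma_poly_linear c q1 q2 z : normc z < 1 ->
  Gamma_poly mu (c *: q1 + q2) z = c * Gamma_poly mu q1 z + Gamma_poly mu q2 z.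
Proof.
move=> z1; rewrite !Gamma_polyE//.
have i1 := cintegrable_wcomp mu q1 z1; have i2 := cintegrable_wcomp mu q2 z1.
rewrite -(cintZ mitv01 c i1) -(cintD mitv01 (cintegrableZ mitv01 c i1) i2).
by apply: eq_cint => t _; rewrite /wcomp hornerD hornerZ; ring.
Qed.

Lemma hardy_norm_horner_sup q e : 0 <= e -> (forall z, normc z <= 1 -> normc q.[z] <= e) ->
  (hardy_norm p (horner q) <= e%:E)%E.
Proof.
move=> e0 qe; apply: le_trans (hardy_norm_horner_le _ p1) _.
apply: lpnorm_le_cst => //; first exact: cmeasurable_horner_cis.
by move=> x; apply: qe; rewrite normc_cis.
Qed.

Lemma Gamma_coef_le q M n : 0 <= M -> (hardy_norm p (horner q) <= M%:E)%E ->
  normc (Gamma_coef mu q n) <= C * M.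
Proof.
move=> M0 qM; apply: (normc_taylor_le n p1 (sums_to_Gamma q)); first exact: mulr_ge0.
by apply: le_trans (HC q) _; rewrite EFinM; apply: lee_wpmul2l; rewrite ?lee_fin.
Qed.

Lemma Gamma_value_le q M z : 0 <= M -> (hardy_norm p (horner q) <= M%:E)%E ->
  normc z < 1 -> normc (Gamma_poly mu q z) <= C * M / (1 - normc z).
Proof.
move=> M0 qM z1.
have := power_series_value_le 0 (sums_to_Gamma q) (mulr_ge0 C0 M0) _ z1.
by rewrite big_ord0 subr0 expr0 mul1r; apply => n; exact: Gamma_coef_le.
Qed.

Definition radius j : R := 1 - j.+1%:R^-1.

Lemma radius01 j : 0 <= radius j < 1.
Proof. by rewrite /radius subr_ge0 invf_le1 ?ltr0n// ler1n/= ltrBlDr ltrDl invr_gt0. Qed.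

(** A polynomial approximation of the dilation of [f] by [radius j]; any one will
    do, as two of them differ by a polynomial that is uniformly small. *)
Definition approx f j : {poly R[i]} := xget 0 [set q | forall z, normc z <= 1 ->
  normc (q.[z] - f ((radius j)%:C%C * z)) <= j.+1%:R^-1].

Lemma normc_dilation j z : normc z <= 1 -> normc ((radius j)%:C%C * z) <= radius j.
Proof.
have /andP[r0 r1] := radius01 j; move=> z1.
by rewrite Normc.normcM normcR ger0_norm// ler_piMr.
Qed.

Lemma approxP f j z : analytic_on_disc f -> normc z <= 1 ->
  normc ((approx f j).[z] - f ((radius j)%:C%C * z)) <= j.+1%:R^-1.
Proof.
move=> /analytic_on_discP[a af] z1; rewrite /approx; case: xgetP => [q _ /(_ z z1)//|/(_ _) nex].
have r01 := radius01 j; have e0 : 0 < j.+1%:R^-1 :> R by rewrite invr_gt0.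
have [N hN] := sums_to_uniform af r01 e0.
exfalso; apply: (nex (\poly_(k < N) (a k * (radius j)%:C%C ^+ k))) => w w1.
rewrite horner_poly; under eq_bigr do rewrite -mulrA -exprMn.
by apply: hN => //; exact: normc_dilation.
Qed.

Lemma hardy_norm_approx f j H : analytic_on_disc f -> (hardy_norm p f <= H%:E)%E ->
  (hardy_norm p (horner (approx f j)) <= (H + j.+1%:R^-1)%:E)%E.
Proof.
move=> af fH; have r01 := radius01 j; apply: le_trans (hardy_norm_horner_le _ p1) _.
have /analytic_on_discP[a sf] := af.
have mf := cmeasurable_sums_to sf r01.
have mq : cmeasurable setT (fun x => (approx f j).[cis x]) by exact: cmeasurable_horner_cis.
have -> : (fun x => (approx f j).[cis x]) = (fun x => f (circle_pt (radius j) x) +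
    ((approx f j).[cis x] - f (circle_pt (radius j) x))).
  by apply/funext => x; rewrite addrC subrK.
have md := cmeasurableB mq mf.
apply: le_trans (lpnormD p1 mf md) _; rewrite EFinD; apply: leeD.
  by apply: le_trans fH; rewrite -integral_mean_lpnorm//; exact: integral_mean_le_hardy.
apply: lpnorm_le_cst => // x; rewrite circle_ptE; apply: approxP => //.
by rewrite normc_cis.
Qed.

Lemma hardyP f : hardy p f -> exists2 H : R, 0 <= H & hardy_norm p f = H%:E.
Proof.
case=> _ fy; exists (fine (hardy_norm p f)); first by rewrite fine_ge0// hardy_norm_ge0.
by rewrite fineK// ge0_fin_numE// hardy_norm_ge0.
Qed.

(** The limit exists because the values at [z] are bounded: they are controlled by
    the norms of the approximations. *)
Definition extension f z : R[i] :=
  xget 0 [set l | is_ulim U (fun j => Gamma_poly mu (approx f j) z) l].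

Lemma approx_bound f j : hardy p f ->
  exists2 M : R, 0 <= M & forall j, (hardy_norm p (horner (approx f j)) <= M%:E)%E.
Proof.
move=> hf; have [H H0 fH] := hardyP hf; exists (H + 1) => [|k]; first by rewrite addr_ge0.
apply: le_trans (hardy_norm_approx k _ _) _; [by case: hf|by rewrite fH|].
by rewrite lee_fin lerD2l invf_le1 ?ltr0n// ler1n.
Qed.

Lemma ulim_extension f z : hardy p f -> normc z < 1 ->
  is_ulim U (fun j => Gamma_poly mu (approx f j) z) (extension f z).
Proof.
move=> hf z1; rewrite /extension; case: xgetP => [l _ //|nex].
have [M M0 HM] := approx_bound 0 hf.
have [l hl] := @ulim_exists R U UU (fun j => Gamma_poly mu (approx f j) z) (C * M / (1 - normc z))
  (fun j => Gamma_value_le M0 (HM j) z1).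
by exfalso; exact: (nex l).
Qed.

(** The coefficients of the images converge as well, and the tails of their power
    series are uniformly small, which makes the extension analytic. *)
Lemma extension_coef f : hardy p f -> exists c : nat -> R[i],
  (forall n, is_ulim U (fun j => Gamma_coef mu (approx f j) n) (c n)) /\
  sums_to c (extension f).
Proof.
move=> hf; have [M M0 HM] := approx_bound 0 hf.
have cM n j : normc (Gamma_coef mu (approx f j) n) <= C * M by exact: Gamma_coef_le.
have /choice[c hc] : forall n, exists l,
    is_ulim U (fun j => Gamma_coef mu (approx f j) n) l.
  by move=> n; exact: ulim_exists (cM n).
exists c; split=> // z z1 e e0.
have d0 : 0 < e * (1 - normc z) / (C * M + 1).
  by rewrite divr_gt0 ?mulr_gt0 ?subr_gt0// ltr_wpDl// mulr_ge0.
have z01 : 0 <= normc z < 1 by rewrite normc_ge0.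
have [N0 hN0] := geometric_small z01 d0.
exists N0 => N N0N; rewrite normcBC.
have us : is_ulim U (fun j => \sum_(n < N) Gamma_coef mu (approx f j) n * z ^+ n)
    (\sum_(n < N) c n * z ^+ n).
  elim: (N) => [|k IH].
    by apply: (ulim_cvg oU) => d d1; exists 0%N => j _; rewrite !big_ord0 subrr Normc.normc0 ltW.
  rewrite big_ord_recr /=; under [X in is_ulim _ X]eq_fun do rewrite big_ord_recr /=.
  apply: ulimD => //; rewrite mulrC; under [X in is_ulim _ X]eq_fun do rewrite mulrC.
  by apply: ulimZ.
have ud : is_ulim U (fun j => Gamma_poly mu (approx f j) z +
      (-1) * \sum_(n < N) Gamma_coef mu (approx f j) n * z ^+ n)
    (extension f z + (-1) * \sum_(n < N) c n * z ^+ n).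
  by apply: ulimD; [exact: ulim_extension|exact: ulimZ].
suff : normc (extension f z + (-1) * \sum_(n < N) c n * z ^+ n - 0) <= e.
  by rewrite subr0 mulN1r.
apply: (ulim_le ud) => j; rewrite subr0 mulN1r.
apply: le_trans (power_series_value_le N (sums_to_Gamma _) (mulr_ge0 C0 M0) (fun n => cM n j) z1) _.
rewrite mulrA ler_pdivrMr ?subr_gt0//.
have CM1 : 0 < C * M + 1 by rewrite ltr_wpDl// mulr_ge0.
have h : normc z ^+ N <= e * (1 - normc z) / (C * M + 1).
  by apply: le_trans hN0; rewrite ler_wiXn2l ?normc_ge0// ltW.
apply: (@le_trans _ _ ((C * M + 1) * (e * (1 - normc z) / (C * M + 1)))).
  by apply: ler_pM; rewrite ?mulr_ge0 ?exprn_ge0 ?normc_ge0// lerDl.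
by rewrite mulrC divfK// gt_eqF.
Qed.

(** On a fixed circle the images are uniformly close to their limit for arbitrarily
    large indices, and their norms are under control. *)
Lemma hardy_norm_extension f H : hardy p f -> 0 <= H -> (hardy_norm p f <= H%:E)%E ->
  (hardy_norm p (extension f) <= (C * H)%:E)%E.
Proof.
move=> hf H0 fH; have [c [hc sc]] := extension_coef hf.
have [M M0 HM] := approx_bound 0 hf.
have cM n j : normc (Gamma_coef mu (approx f j) n) <= C * M by exact: Gamma_coef_le.
have CM0 : 0 <= C * M by exact: mulr_ge0.
have cn n : normc (c n) <= C * M.
  by rewrite -[c n]subr0; apply: (ulim_le (hc n)) => j; rewrite subr0.
apply: ub_ereal_sup => y [r]; rewrite /= in_itv/= => r01 <- {y}.
have /andP[r0 r1] := r01.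
have mT := cmeasurable_sums_to sc r01.
rewrite integral_mean_lpnorm//; apply/lee_addgt0Pr => e e0.
have C1 : 0 < C + 1 by rewrite ltr_wpDl.
pose d := e / (C + 1).
have d0 : 0 < d by rewrite divr_gt0.
have CM1 : 0 < 4 * (C * M + 1) by rewrite mulr_gt0// ltr_wpDl.
have t0 : 0 < d * (1 - r) / (4 * (C * M + 1)).
  by rewrite divr_gt0// mulr_gt0// subr_gt0.
have [N hN] := geometric_small r01 t0.
have tail : C * M * (r ^+ N / (1 - r)) <= d / 4.
  rewrite mulrA ler_pdivrMr ?subr_gt0//.
  apply: (@le_trans _ _ ((C * M + 1) * (d * (1 - r) / (4 * (C * M + 1))))).
    by apply: ler_pM; rewrite ?exprn_ge0// lerDl.
  by rewrite le_eqVlt; apply/orP; left; apply/eqP; field; rewrite gt_eqF// ltr_wpDl.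
have [J hJ] : exists J, forall j, (J <= j)%N -> j.+1%:R^-1 <= d.
  have h0 : (n.+1%:R^-1 : R) @[n --> \oo] --> (0 : R) by exact: cvg_harmonic.
  have /cvgrPdist_le/(_ _ d0) [J _ HJ] := h0.
  by exists J => n Jn; have := HJ n Jn; rewrite /= sub0r normrN ger0_norm.
have d2 : 0 < d / 2 by rewrite divr_gt0.
have UJ : U [set j | (J <= j)%N] by apply: oU; exists J.
have [j [/= sumj Jj]] := ultra_ex (filterI (ulim_sum_small N hc d2) UJ).
pose F := Gamma_poly mu (approx f j).
have mF : cmeasurable setT (fun x => F (circle_pt r x)) by exact: cmeasurable_Gamma.
have FT x : normc (extension f (circle_pt r x) - F (circle_pt r x)) <= d.
  set z := circle_pt r x; have zr : normc z = r by rewrite normc_circle_pt ger0_norm.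
  have z1 : normc z < 1 by rewrite zr.
  have h1 := power_series_value_le N sc CM0 cn z1.
  have h2 := power_series_value_le N (sums_to_Gamma (approx f j)) CM0 (fun n => cM n j) z1.
  rewrite zr in h1 h2.
  have h3 : normc (\sum_(n < N) Gamma_coef mu (approx f j) n * z ^+ n -
      \sum_(n < N) c n * z ^+ n) <= d / 2.
    apply: le_trans sumj; rewrite -sumrB; apply: le_trans (sum_normc_le _ _ _) _.
    apply: ler_sum => n _; rewrite -mulrBl Normc.normcM normcX zr.
    by rewrite ler_piMr ?normc_ge0// exprn_ile1// ltW.
  have -> : extension f z - F z = (extension f z - \sum_(n < N) c n * z ^+ n) -
    (F z - \sum_(n < N) Gamma_coef mu (approx f j) n * z ^+ n) -
    (\sum_(n < N) Gamma_coef mu (approx f j) n * z ^+ n - \sum_(n < N) c n * z ^+ n) by ring.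
  apply: le_trans (ler_normcB _ _) _.
  have := ler_normcB (extension f z - \sum_(n < N) c n * z ^+ n)
    (F z - \sum_(n < N) Gamma_coef mu (approx f j) n * z ^+ n).
  lra.
have -> : (fun x => extension f (circle_pt r x)) =
    (fun x => F (circle_pt r x) + (extension f (circle_pt r x) - F (circle_pt r x))).
  by apply/funext => x; rewrite addrC subrK.
have md := cmeasurableB mT mF.
apply: le_trans (lpnormD p1 mF md) _.
have dE : C * d + d = e by rewrite /d; field; rewrite gt_eqF.
apply: (@le_trans _ _ ((C * (H + d))%:E + d%:E)%E); last first.
  by rewrite -!EFinD lee_fin mulrDr; lra.
apply: leeD; last by apply: lpnorm_le_cst => //; exact: ltW.
rewrite -integral_mean_lpnorm//; apply: le_trans (integral_mean_le_hardy _ _ r01) _.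
apply: le_trans (HC _) _; rewrite EFinM; apply: lee_wpmul2l; first by rewrite lee_fin.
apply: le_trans (hardy_norm_approx j _ fH) _; first by case: hf.
by rewrite lee_fin lerD2l hJ.
Qed.

(** The limit depends only on the approximations up to uniformly small errors;
    hence the linearity of the extension and its agreement with [Gamma_poly]. *)
Lemma ulim_Gamma_eq (q1 q2 : nat -> {poly R[i]}) (K : R) z l : normc z < 1 -> 0 <= K ->
  (forall j w, normc w <= 1 -> normc ((q1 j).[w] - (q2 j).[w]) <= K * j.+1%:R^-1) ->
  is_ulim U (fun j => Gamma_poly mu (q2 j) z) l ->
  is_ulim U (fun j => Gamma_poly mu (q1 j) z) l.
Proof.
move=> z1 K0 q12 h2.
have small : is_ulim U (fun j => Gamma_poly mu ((-1) *: q2 j + q1 j) z) 0.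
  apply: (ulim_cvg oU) => e e0.
  have A0 : 0 <= C * K / (1 - normc z).
    by rewrite divr_ge0 ?mulr_ge0// subr_ge0 ltW.
  have d0 : 0 < e / (C * K / (1 - normc z) + 1) by rewrite divr_gt0// ltr_wpDl.
  have h0 : (n.+1%:R^-1 : R) @[n --> \oo] --> (0 : R) by exact: cvg_harmonic.
  have /cvgrPdist_le/(_ _ d0) [J _ HJ] := h0.
  exists J => n Jn; have := HJ n Jn; rewrite /= sub0r normrN ger0_norm// => hn.
  rewrite subr0; apply: (@le_trans _ _ (C * (K * n.+1%:R^-1) / (1 - normc z))).
    apply: Gamma_value_le => //; first by rewrite mulr_ge0.
    apply: hardy_norm_horner_sup; first by rewrite mulr_ge0.
    by move=> w w1; rewrite hornerD hornerZ mulN1r addrC; exact: q12.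
  have -> : C * (K * n.+1%:R^-1) / (1 - normc z) = C * K / (1 - normc z) * n.+1%:R^-1 by ring.
  apply: (@le_trans _ _ ((C * K / (1 - normc z) + 1) * (e / (C * K / (1 - normc z) + 1)))).
    by apply: ler_pM => //; rewrite lerDl.
  by rewrite mulrC divfK// gt_eqF// ltr_wpDl.
have -> : (fun j => Gamma_poly mu (q1 j) z) =
    (fun j => Gamma_poly mu ((-1) *: q2 j + q1 j) z + Gamma_poly mu (q2 j) z).
  by apply/funext => j; rewrite Gamma_poly_linear//; ring.
by rewrite -[l]add0r; exact: ulimD.
Qed.

Lemma extension_linear c f g z : hardy p f -> hardy p g ->
  hardy p (fun w => c * f w + g w) -> normc z < 1 ->
  extension (fun w => c * f w + g w) z = c * extension f z + extension g z.
Proof.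
move=> hf hg hfg z1; apply: (ulim_unique (ulim_extension hfg z1)).
apply: (@ulim_Gamma_eq _ (fun j => c *: approx f j + approx g j) (2 + normc c)) => //.
- by rewrite addr_ge0 ?normc_ge0.
- move=> j w w1.
  have [af _] := hf; have [ag _] := hg; have [afg _] := hfg.
  have h1 := approxP j af w1; have h2 := approxP j ag w1; have h3 := approxP j afg w1.
  rewrite hornerD hornerZ; set u := _%:C%C * w in h1 h2 h3.
  have -> : (approx (fun w => c * f w + g w) j).[w] - (c * (approx f j).[w] + (approx g j).[w]) =
    ((approx (fun w => c * f w + g w) j).[w] - (c * f u + g u)) -
    ((c * ((approx f j).[w] - f u)) + ((approx g j).[w] - g u)) by ring.
  apply: le_trans (ler_normcB _ _) _.
  have h4 := ler_normcD (c * ((approx f j).[w] - f u)) ((approx g j).[w] - g u).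
  have h5 : normc (c * ((approx f j).[w] - f u)) <= normc c * j.+1%:R^-1.
    by rewrite Normc.normcM ler_wpM2l ?normc_ge0.
  rewrite mulrDl; move: h2 h3 h4 h5; move: (j.+1%:R^-1) => t; lra.
have -> : (fun j => Gamma_poly mu (c *: approx f j + approx g j) z) =
    (fun j => c * Gamma_poly mu (approx f j) z + Gamma_poly mu (approx g j) z).
  by apply/funext => j; rewrite Gamma_poly_linear.
by apply: ulimD; [apply: ulimZ|]; exact: ulim_extension.
Qed.

Lemma hardy_horner q : hardy p (horner q).
Proof.
split; first by apply/analytic_on_discP; exists (fun n => q`_n); exact: sums_to_horner.
have [M M0 HM] := horner_bound q.
by apply: le_lt_trans (hardy_norm_horner_sup (ltW M0) HM) (ltry _).
Qed.

Lemma extension_horner q z : normc z < 1 -> extension (horner q) z = Gamma_poly mu q z.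
Proof.
move=> z1; have hq := hardy_horner q; apply: (ulim_unique (ulim_extension hq z1)).
have [L L0 HL] := horner_lipschitz q.
apply: (@ulim_Gamma_eq _ (fun=> q) (1 + L)) => //; first by rewrite addr_ge0// ltW.
  move=> j w w1; have [aq _] := hq; have h1 := approxP j aq w1.
  have r1 := normc_dilation j w1; have /andP[r0 rj] := radius01 j.
  have u1 : normc ((radius j)%:C%C * w) <= 1 by apply: le_trans r1 _; exact: ltW.
  have h2 := HL _ _ u1 w1.
  have h3 : normc ((radius j)%:C%C * w - w) <= j.+1%:R^-1.
    have -> : (radius j)%:C%C * w - w = - (j.+1%:R^-1)%:C%C * w.
      by rewrite /radius rmorphB /=; ring.
    rewrite Normc.normcM -rmorphN /= normcR normrN ger0_norm ?invr_ge0//.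
    by rewrite ler_piMr.
  have h4 : L * normc ((radius j)%:C%C * w - w) <= L * j.+1%:R^-1 by rewrite ler_pM2l.
  have -> : (approx (horner q) j).[w] - q.[w] =
    ((approx (horner q) j).[w] - q.[(radius j)%:C%C * w]) - (q.[w] - q.[(radius j)%:C%C * w]).
    by ring.
  apply: le_trans (ler_normcB _ _) _; rewrite (normcBC q.[w]) mulrDl mul1r.
  by apply: lerD => //; exact: le_trans h4.
by apply: (ulim_cvg oU) => e e0; exists 0%N => j _; rewrite subrr Normc.normc0 ltW.
Qed.

End Extension.

(** * The norm of the operator *)

Section OperatorNorm.
Context {R : realType}.
Implicit Types (mu : {finite_measure set R -> \bar R}) (p C : R) (q : {poly R[i]}).

Local Notation D := (`]0%R, 1%R[%classic : set R).

Lemma hardy_normZ_le p (c : R[i]) (F G : R[i] -> R[i]) : 1 <= p ->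
  (forall r, 0 <= r < 1 -> cmeasurable setT (fun x => F (circle_pt r x))) ->
  (forall z, normc z < 1 -> G z = c * F z) ->
  (hardy_norm p G <= (normc c)%:E * hardy_norm p F)%E.
Proof.
move=> p1 mF FG; have p0 : 0 < p by lra.
rewrite [leLHS]/hardy_norm; apply: ub_ereal_sup => y [r]; rewrite /= in_itv/= => r01 <- {y}.
have eG : (fun x => G (circle_pt r x)) = (fun x => c * F (circle_pt r x)).
  by apply/funext => x; apply: FG; rewrite normc_circle_pt ger0_norm//; case/andP: r01.
have mG : cmeasurable setT (fun x => G (circle_pt r x)).
  by rewrite eG; apply: cmeasurableM; [exact: cmeasurable_cst|exact: mF].
apply: (@le_trans _ _ ((normc c)%:E * integral_mean p F r)%E); last first.
  by apply: lee_wpmul2l; [rewrite lee_fin normc_ge0|exact: integral_mean_le_hardy].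
rewrite !integral_mean_lpnorm//; last exact: mF.
have i0 : (0 <= \int[circ]_x (normc (F (circle_pt r x)) `^ p)%:E)%E.
  by apply: integral_ge0 => x _; rewrite lee_fin powR_ge0.
rewrite eG /lpnorm.
under eq_integral do rewrite Normc.normcM powRM ?normc_ge0// EFinM.
rewrite ge0_integralZl//; last 3 first.
- by apply: measurable_mean_integrand; exact: mF.
- by move=> x _; rewrite lee_fin powR_ge0.
- by rewrite lee_fin powR_ge0.
rewrite poweRM ?lee_fin ?powR_ge0// poweR_EFin -powRrM mulfV ?gt_eqF//.
by rewrite powRr1 ?normc_ge0.
Qed.

Lemma hardy_norm_fin_poly p q : 1 <= p ->
  exists2 H : R, 0 <= H & hardy_norm p (horner q) = H%:E.
Proof.
move=> p1; have [M M0 HM] := horner_bound q.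
have := hardy_norm_horner_sup p1 (ltW M0) HM; have := hardy_norm_ge0 p (horner q).
case: (hardy_norm p (horner q)) => // H; rewrite !lee_fin => H0 _.
by exists H.
Qed.

Lemma hardy_linear p c f g : 1 <= p -> hardy p f -> hardy p g ->
  hardy p (fun w => c * f w + g w).
Proof.
move=> p1 hf hg.
have [/analytic_on_discP[a af] _] := hf; have [/analytic_on_discP[b bg] _] := hg.
have sfg : sums_to (fun n => c * a n + b n) (fun w => c * f w + g w).
  move=> w w1 e e0; have c0 : 0 < normc c + 1 by rewrite ltr_wpDl ?normc_ge0.
  have ec : 0 < e / 2 / (normc c + 1) by rewrite !divr_gt0.
  have e2 : 0 < e / 2 by rewrite divr_gt0.
  have [N1 h1] := af w w1 _ ec; have [N2 h2] := bg w w1 _ e2.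
  exists (maxn N1 N2) => N; rewrite geq_max => /andP[NN1 NN2].
  have -> : \sum_(n < N) (c * a n + b n) * w ^+ n - (c * f w + g w) =
      c * (\sum_(n < N) a n * w ^+ n - f w) + (\sum_(n < N) b n * w ^+ n - g w).
    rewrite mulrBr mulr_sumr.
    have -> : \sum_(n < N) (c * a n + b n) * w ^+ n =
        \sum_(n < N) c * (a n * w ^+ n) + \sum_(n < N) b n * w ^+ n.
      by rewrite -big_split /=; apply: eq_bigr => n _; ring.
    ring.
  apply: le_trans (ler_normcD _ _) _.
  have -> : e = (normc c + 1) * (e / 2 / (normc c + 1)) + e / 2.
    by field; rewrite gt_eqF.
  apply: lerD; last exact: h2.
  by rewrite Normc.normcM; apply: ler_pM; rewrite ?normc_ge0 ?lerDl// h1.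
split; first by apply/analytic_on_discP; exists (fun n => c * a n + b n).
have [Hf Hf0 fE] := hardyP hf; have [Hg Hg0 gE] := hardyP hg.
apply: (@le_lt_trans _ _ (normc c * Hf + Hg)%:E); last exact: ltry.
apply: ub_ereal_sup => y [r]; rewrite /= in_itv/= => r01 <- {y}.
have mf := cmeasurable_sums_to af r01; have mg := cmeasurable_sums_to bg r01.
have mcf : cmeasurable setT (fun x => c * f (circle_pt r x)).
  by apply: cmeasurableM => //; exact: cmeasurable_cst.
rewrite integral_mean_lpnorm; last exact: (cmeasurable_sums_to sfg r01).
apply: le_trans (lpnormD p1 mcf mg) _; rewrite EFinD; apply: leeD.
  rewrite -(integral_mean_lpnorm p (F := fun w => c * f w))//.
  apply: le_trans (integral_mean_le_hardy p _ r01) _.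
  rewrite EFinM -fE; apply: hardy_normZ_le => // s s01.
  exact: (cmeasurable_sums_to af s01).
rewrite -gE -integral_mean_lpnorm//; exact: integral_mean_le_hardy.
Qed.

Lemma eq_hardy_norm p (F G : R[i] -> R[i]) : (forall z, normc z < 1 -> F z = G z) ->
  hardy_norm p F = hardy_norm p G.
Proof.
move=> FG; have e r : 0 <= r < 1 -> integral_mean p F r = integral_mean p G r.
  move=> /andP[r0 r1]; have e : (\int[lebesgue_measure]_(x in `[0%R, (2 * pi)%R])
        (normc (F (circle_pt r x)) `^ p)%:E =
      \int[lebesgue_measure]_(x in `[0%R, (2 * pi)%R])
        (normc (G (circle_pt r x)) `^ p)%:E)%E.
    by apply: eq_integral => x _; rewrite FG// normc_circle_pt ger0_norm.
  by rewrite /integral_mean e.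
congr ereal_sup; apply/seteqP.
split=> y [r r01 <-]; have r01' : 0 <= r < 1 by move: r01; rewrite /= in_itv.
  by exists r; [exact: r01|rewrite e].
by exists r; [exact: r01|rewrite -e].
Qed.

(** The extension along any ultrafilter finer than [\oo] is a witness for the
    infimum. *)
Lemma Gamma_norm_le p mu C : 1 <= p -> 0 <= C ->
  (forall q, (hardy_norm p (Gamma_poly mu q) <= C%:E * hardy_norm p (horner q))%E) ->
  (Gamma_norm p mu <= C%:E)%E.
Proof.
move=> p1 C0 HC.
have [U [UU oU]] := @ultraFilterLemma nat \oo _.
pose T := @extension R mu U.
have TH f H : hardy p f -> 0 <= H -> (hardy_norm p f <= H%:E)%E ->
    (hardy_norm p (T f) <= (C * H)%:E)%E by exact: hardy_norm_extension.
have hT f : hardy p f -> hardy p (T f).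
  move=> hf; have [H H0 fH] := hardyP hf; split.
    have [c [_ sc]] := extension_coef oU p1 C0 HC hf.
    by apply/analytic_on_discP; exists c.
  by apply: le_lt_trans (TH f H hf H0 _) (ltry _); rewrite fH.
apply: (@le_trans _ _ (operator_norm p T)).
  apply: ereal_inf_lbound; exists T; [split|exact: erefl].
  - exact: hT.
  - move=> c f g hf hg z /unit_discE z1; exact: (extension_linear oU p1 C0 HC hf hg (hardy_linear c p1 hf hg) z1).
  - exists C => f hf; have [H H0 fH] := hardyP hf.
    by rewrite fH -EFinM; apply: TH => //; rewrite fH.
  - by move=> q z /unit_discE z1; exact: (extension_horner oU p1 C0 HC).
apply: ub_ereal_sup => y [f [hf f1] <- {y}].
by rewrite -[C]mulr1; apply: TH.
Qed.

(** Applying the operator norm to a normalized polynomial turns the norm of any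
    extension into a bound for the polynomials; a polynomial of norm [0] is dealt
    with by the boundedness of the extension. *)
Lemma Gamma_norm_ge p mu (K : \bar R) : 1 <= p ->
  (forall C, 0 <= C ->
    (forall q, (hardy_norm p (Gamma_poly mu q) <= C%:E * hardy_norm p (horner q))%E) ->
    (K <= C%:E)%E) ->
  (K <= Gamma_norm p mu)%E.
Proof.
move=> p1 HK; apply: le_ereal_inf_tmp => _ [T [hT linT [C' bT] polyT] <-].
have N0 : (0 <= operator_norm p T)%E.
  apply: le_trans (hardy_norm_ge0 p (T (horner 0))) _.
  apply: ereal_sup_ubound; exists (horner 0); last exact: erefl.
  split; first exact: hardy_horner.
  apply: (hardy_norm_horner_sup p1 ler01) => z _.
  by rewrite horner0 Normc.normc0.
case E : (operator_norm p T) => [N| |]; last by rewrite E in N0.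
  apply: HK; first by rewrite E lee_fin in N0.
  rewrite E lee_fin in N0.
  move=> q; have [H H0 qH] := hardy_norm_fin_poly q p1.
  have eT q' : hardy_norm p (T (horner q')) = hardy_norm p (Gamma_poly mu q').
    by apply: eq_hardy_norm => z z1; rewrite polyT//; exact/unit_discE.
  have [H00|Hn] := eqVneq H 0.
    have := bT _ (hardy_horner p1 q); rewrite eT qH H00 mule0.
    by rewrite mule0.
  have Hp : 0 < H by rewrite lt_neqAle eq_sym Hn.
  pose g : {poly R[i]} := (H^-1)%:C%C *: q.
  have g1 : (hardy_norm p (horner g) <= 1)%E.
    apply: le_trans (@hardy_normZ_le p (H^-1)%:C%C (horner q) (horner g) p1 _ _) _.
    - by move=> r r01; exact: cmeasurable_horner_circle.
    - by move=> z _; rewrite /g hornerZ.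
    - by rewrite qH -EFinM normcR ger0_norm ?invr_ge0// mulVf.
  have gN : (hardy_norm p (Gamma_poly mu g) <= N%:E)%E.
    rewrite -eT -E; apply: ereal_sup_ubound; exists (horner g); last exact: erefl.
    by split; [exact: hardy_horner|exact: g1].
  rewrite qH muleC.
  apply: le_trans (@hardy_normZ_le p H%:C%C (Gamma_poly mu g) _ p1 _ _) _.
  - by move=> r r01; exact: cmeasurable_Gamma.
  - move=> z z1; have := Gamma_poly_linear mu (H^-1)%:C%C q 0 z1.
    have -> : Gamma_poly mu 0 z = 0.
      have := Gamma_poly_linear mu 1 0 0 z1; rewrite scaler0 addr0 mul1r => /eqP.
      by rewrite -[X in X == _]addr0 (inj_eq (addrI _)) eq_sym => /eqP.
    by rewrite !addr0 -/g => ->; rewrite mulrA -rmorphM /= mulfV// mul1r.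
  - by rewrite normcR ger0_norm//; apply: lee_wpmul2l; rewrite ?lee_fin.
by rewrite leey.
Qed.

Lemma Gamma_bounded_nneg p mu : Gamma_bounded p mu -> exists2 C : R, 0 <= C &
  forall q, (hardy_norm p (Gamma_poly mu q) <= C%:E * hardy_norm p (horner q))%E.
Proof.
move=> [C HC]; exists (Num.max C 0); first by rewrite le_max lexx orbT.
move=> q; apply: le_trans (HC q) _; apply: lee_wpmul2r; first exact: hardy_norm_ge0.
by rewrite lee_fin le_max lexx.
Qed.

(** The bounds for the polynomials require a positive number above the integral,
    which may be [0]; the slack is removed by letting it tend to [0]. *)
Lemma Gamma_norm_le_integral p mu (B : R) (S : \bar R) : 1 <= p -> 0 < B -> (0 <= S)%E ->
  (forall I q, 0 < I -> (S <= I%:E)%E ->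
    (hardy_norm p (Gamma_poly mu q) <= (B * I)%:E * hardy_norm p (horner q))%E) ->
  (Gamma_norm p mu <= B%:E * S)%E.
Proof.
move=> p1 B0; case: S => [s|_ _|//]; last by rewrite gt0_muley ?lte_fin// leey.
rewrite lee_fin => s0 HB; apply/lee_addgt0Pr => e e0.
rewrite -EFinM -EFinD; have eB : 0 < e / B by rewrite divr_gt0.
have -> : B * s + e = B * (s + e / B) by field; rewrite gt_eqF.
apply: Gamma_norm_le => //; first by rewrite mulr_ge0 ?addr_ge0// ltW.
by move=> q; apply: HB; rewrite ?lee_fin ?lerDl ?(ltW eB)// ltr_wpDl.
Qed.

Lemma psi_integral_ge0 p mu : (0 <= \int[mu]_(t in D) (psi p t)%:E)%E.
Proof. by apply: integral_ge0 => t /itv01P t01; rewrite lee_fin ltW ?psi_gt0. Qed.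

End OperatorNorm.

Theorem theorem2p3 (R : realType) (p : R) (hp : 1 <= p) :
  (forall mu : {finite_measure set R -> \bar R},
     mu (~` `]0, 1[) = 0%E ->
     Gamma_bounded p mu <->
     (\int[mu]_(t in `]0%R, 1%R[) (psi p t)%:E < +oo)%E)
  /\ (exists A B : R, [/\ 0 < A, 0 < B &
       forall mu : {finite_measure set R -> \bar R},
         mu (~` `]0, 1[) = 0%E ->
         (A%:E * \int[mu]_(t in `]0%R, 1%R[) (psi p t)%:E <= Gamma_norm p mu /\
          Gamma_norm p mu <= B%:E * \int[mu]_(t in `]0%R, 1%R[) (psi p t)%:E)%E])
  /\ (2 <= p ->
      forall mu : {finite_measure set R -> \bar R},
        mu (~` `]0, 1[) = 0%E ->
        Gamma_norm p mu =
        (\int[mu]_(t in `]0%R, 1%R[)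
           (t `^ (p^-1 - 1) / (1 - t) `^ p^-1)%:E)%E).
Proof.
have [B B0 HB] := Gamma_psi_le hp; have [A A0 HA] := psi_integral_le hp.
split; last split.
- move=> mu _; have S0 := psi_integral_ge0 p mu; split=> [bd|fin].
    have [C C0 HC] := Gamma_bounded_nneg bd; have := HA mu C C0 HC.
    move: S0; case: (\int[mu]_(t in _) _)%E => [s|_|//]; first by rewrite ltry.
    by rewrite gt0_muley ?lte_fin// leye_eq.
  move: S0 fin (HB mu); case: (\int[mu]_(t in _) _)%E => [s|//|//].
  rewrite lee_fin => s0 _ H; exists (B * (s + 1)) => q.
  by apply: H; rewrite ?lee_fin ?lerDl// ltr_wpDl.
- exists A, B; split=> // mu _; split.
    by apply: Gamma_norm_ge => // C C0 HC; exact: HA.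
  apply: Gamma_norm_le_integral => //; first exact: psi_integral_ge0.
  by move=> I q; exact: HB.
- move=> p2 mu _; apply/le_anti/andP; split; last first.
    by apply: Gamma_norm_ge => // C C0 HC; exact: kern_integral_le.
  rewrite -[leRHS]mul1e; apply: Gamma_norm_le_integral => //.
    by apply: integral_ge0 => t /itv01P t01; rewrite lee_fin ltW// (kern_gt0 p).
  by move=> I q I0 kI; rewrite mul1r; exact: Gamma_kern_le.
Qed.
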